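(* Let $\Gamma$ be a metric graph with a fixed vertex set $\Omega$, let $D$ be an effective divisor on $\Gamma$ and let $v_0\in\Gamma$. Then the following iterative procedure terminates after finitely many iterations: set $D^{(0)}=D$ and $i=0$; (1) run Dhar's algorithm on $D^{(i)}$ and $v_0$, obtaining output $S^{(i)}$; if $S^{(i)}=\emptyset$, stop and output $D^{(i)}$; (2) otherwise set $D^{(i+1)}=\Delta^{(1)}_{D^{(i)},S^{(i)},v_0}$ (the end of the $v_0$-move of $D^{(i)}$ with respect to $S^{(i)}$ and $\Omega$), replace $i$ by $i+1$, and go to (1).
   Context: A metric graph $\Gamma$ is the geometric realization of a finite connected loopless multigraph with each edge identified with a closed interval of positive length; a vertex set $\Omega$ is a nonempty finite subset such that $\Gamma\setminus\Omega$ is a disjoint union of open intervals (edge interiors), each whose closure adds exactly two distinct points of $\Omega$. Divisors are elements of the free abelian group on points of $\Gamma$; a rational function $f$ is continuous piecewise linear with integral slopes and $(f)=\sum_v\mathrm{ord}_vf\,(v)$ with $\mathrm{ord}_vf$ the sum of outgoing slopes at $v$. $\mathrm{supp}\,D=\{v:D(v)\neq0\}$. For a closed subset $X$ with finitely many components and $v\in\partial X$, $\mathrm{outdeg}_X(v)$ is the maximum number of internally disjoint segments of $\Gamma\setminus X$ having an open end at $v$; $v$ is saturated (w.r.t. $X$ and $D$) if $D(v)\ge\mathrm{outdeg}_X(v)$ and non-saturated otherwise. For finite $S\subseteq\Gamma$, $\mathcal U_{S,v_0}$ is the connected component of $\Gamma\setminus S$ containing $v_0$ (empty if $v_0\in S$),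 and $\mathcal U_{S,v_0}^c$ its complement. Dhar's algorithm (input: effective $D$, point $v_0$): set $S_0=\mathrm{supp}\,D\setminus\{v_0\}$, $k=0$. If $S_k=\emptyset$ or all boundary points of $\mathcal U^c_{S_k,v_0}$ are saturated w.r.t. $\mathcal U^c_{S_k,v_0}$ and $D$, output $S=S_k$. Otherwise let $N_k$ be the set of non-saturated boundary points of $\mathcal U^c_{S_k,v_0}$, set $S_{k+1}=S_k\setminus N_k$, $k\leftarrow k+1$, and repeat. A rational function $f$ is basic $v_0$-extremal if there are disjoint closed connected $X_{\max}(f),X_{\min}(f)$ with $v_0\in X_{\min}(f)$, $\Gamma\setminus(X_{\max}\cup X_{\min})$ a disjoint union of open segments all of the same length, $f$ attaining its maximum on $X_{\max}$ and its minimum on $X_{\min}$, and $f$ having constant slope $1$ from $X_{\min}$ to $X_{\max}$ on these segments. $v_0$-move: given effective $D$ and $S\subseteq\mathrm{supp}\,D\setminus\{v_0\}$ such that all boundary points of $\mathcal U^c_{S,v_0}$ are saturated, let $X_1,\dots,X_J$ be the connected components of $\mathcal U_{S,v_0}^c$. For $t\in(0,1]$ let $d_j^{(t)}=t\cdot\mathrm{dist}(X_j,\mathcal U_{S,v_0}\cap(\Omega\cup\{v_0\}))$, $P_j^{(t)}=\{p\in\mathcal U_{S,v_0}:\mathrm{dist}(X_j,p)=d_j^{(t)}\}$, and $f_j^{(t)}$ a basic $v_0$-extremal function with $X_{\max}(f_j^{(t)})=X_j$ and $\partial X_{\min}(f_j^{(t)})=P_j^{(t)}$. Then $\Delta^{(0)}_{D,S,v_0}=D$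 and $\Delta^{(t)}_{D,S,v_0}=D+\sum_{j=1}^J(f_j^{(t)})$ for $t\in(0,1]$. *)

(* Defs.v *)
From HB Require Import structures.
From mathcomp Require Import all_boot all_order all_algebra.
From mathcomp Require Import all_classical all_reals all_analysis.
From mathcomp Require Import lra.
From mathcomp.multinomials Require Export freeg.

Set Implicit Arguments.
Unset Strict Implicit.
Unset Printing Implicit Defensive.

Import Order.TTheory GRing.Theory Num.Theory.
Import numFieldNormedType.Exports.

Local Open Scope classical_set_scope.
Local Open Scope ring_scope.

(** * Metric graphs *)

Record metric_graph (R : realType) := MetricGraph {
  vert : finType;
  edge : finType;
  src : edge -> vert;
  tgt : edge -> vert;
  len : edge -> R;
  loopless : forall e, src e != tgt e;
  len_gt0 : forall e, 0 < len e;
  graph_connected : forall u v,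
    connect [rel x y | [exists e, ((src e == x) && (tgt e == y)) ||
                                  ((src e == y) && (tgt e == x))]] u v
}.

Section Realization.
Context {R : realType} (G : metric_graph R).

Inductive realization : Type :=
| Vertex of vert G
| Interior (e : edge G) of {x : R | 0 < x < len e}.

(* The point at distance [x] from [src e] on the closed edge [e]; only used
   for 0 <= x <= len e. *)
Definition edge_pt (e : edge G) (x : R) : realization :=
  if insub x is Some u then Interior (e := e) u
  else if x <= 0 then Vertex (src e) else Vertex (tgt e).

(* [walk p q r]: one can go from [p] to [q] by finitely many moves, each of them
   inside one closed edge, of total length [r]. *)
Inductive walk : realization -> realization -> R -> Prop :=
| walk_nil p : walk p p 0
| walk_cons e x y q r :
    0 <= x <= len e -> 0 <= y <= len e ->
    walk (edge_pt e y) q r -> walk (edge_pt e x) q (`|x - y| + r).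

Definition walk_dist (p q : realization) : R := inf [set r | walk p q r].

Lemma walk_ge0 p q r : walk p q r -> 0 <= r.
Proof. by elim=> // e x y {}q {}r _ _ _ r0; rewrite addr_ge0. Qed.

Lemma walk_cat p q s r r' : walk p q r -> walk q s r' -> walk p s (r + r').
Proof.
elim=> [{}p|e x y {}q {}r xe ye _ IH] h; first by rewrite add0r.
by rewrite -addrA; apply: walk_cons => //; exact: IH.
Qed.

Lemma walk_rev p q r : walk p q r -> walk q p r.
Proof.
elim=> [{}p|e x y {}q {}r xe ye _ IH]; first exact: walk_nil.
rewrite addrC; apply: (walk_cat IH); rewrite distrC -[`|_|]addr0.
by apply: walk_cons => //; exact: walk_nil.
Qed.

Lemma edge_pt0 e : edge_pt e 0 = Vertex (src e).
Proof. by rewrite /edge_pt insubF ?ltxx// lexx. Qed.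

Lemma edge_ptl e : edge_pt e (len e) = Vertex (tgt e).
Proof. by rewrite /edge_pt insubF ?ltxx ?andbF// leNgt len_gt0. Qed.

Lemma edge_pt_in e (u : {x : R | 0 < x < len e}) :
  edge_pt e (val u) = Interior u.
Proof. by rewrite /edge_pt valK. Qed.

Lemma walk_edge e x y : 0 <= x <= len e -> 0 <= y <= len e ->
  walk (edge_pt e x) (edge_pt e y) `|x - y|.
Proof.
by move=> xe ye; rewrite -[`|_|]addr0; apply: walk_cons => //; exact: walk_nil.
Qed.

Lemma walk_vertex p : exists v r, walk p (Vertex v) r.
Proof.
case: p => [v|e u]; first by exists v, 0; exact: walk_nil.
exists (src e); rewrite -edge_pt0 -edge_pt_in; eexists; apply: walk_edge.
  by case: u => x /= /andP[/ltW -> /ltW ->].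
by rewrite lexx ltW// len_gt0.
Qed.

Lemma walk_vertices u v : exists r, walk (Vertex u) (Vertex v) r.
Proof.
have /connectP[s] := graph_connected u v.
elim: s u => [|w s IH] u /=; first by move=> _ ->; exists 0; exact: walk_nil.
move=> /andP[/existsP[e /orP He] ws] vE; have [r wr] := IH w ws vE.
have l0 : 0 <= len e := ltW (len_gt0 e).
have L0 : 0 <= (0 : R) <= len e by rewrite lexx l0.
have LL : 0 <= len e <= len e by rewrite lexx l0.
have w1 : walk (Vertex (src e)) (Vertex (tgt e)) (len e).
  have := walk_edge L0 LL; rewrite edge_pt0 edge_ptl.
  by rewrite sub0r normrN ger0_norm.
exists (len e + r); case: He wr => /andP[/eqP <- /eqP <-] wr.
  exact: walk_cat w1 wr.
exact: walk_cat (walk_rev w1) wr.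
Qed.

Lemma walk_ex p q : [set r | walk p q r] !=set0.
Proof.
have [u [r1 w1]] := walk_vertex p; have [v [r2 w2]] := walk_vertex q.
have [r3 w3] := walk_vertices u v.
exists (r1 + r3 + r2); exact: walk_cat (walk_cat w1 w3) (walk_rev w2).
Qed.

Lemma walk_has_inf p q : has_inf [set r | walk p q r].
Proof. by split; [exact: walk_ex|exists 0 => r /walk_ge0]. Qed.

Lemma walk_dist_le p q r : walk p q r -> walk_dist p q <= r.
Proof. by move=> w; apply: ge_inf => //; exact: (walk_has_inf p q).2. Qed.

Lemma walk_distxx p : walk_dist p p = 0.
Proof.
apply/eqP; rewrite eq_le walk_dist_le ?andTb; last exact: walk_nil.
by apply: lb_le_inf; [exact: walk_ex|move=> r /walk_ge0].
Qed.

Lemma walk_dist_sym p q : walk_dist p q = walk_dist q p.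
Proof.
by congr inf; apply/seteqP; split => r /= /walk_rev.
Qed.

Lemma walk_dist_triangle q p s : walk_dist p s <= walk_dist p q + walk_dist q s.
Proof.
rewrite -lerBlDr; apply: lb_le_inf; first exact: walk_ex.
move=> r /= w; rewrite lerBlDr -lerBlDl; apply: lb_le_inf; first exact: walk_ex.
by move=> r' /= w'; rewrite lerBlDl; apply: walk_dist_le; exact: walk_cat w'.
Qed.

(* The positivity of [walk_dist] is proved with the help of a tent function
   around one of the two points. *)
Lemma walk_lipschitz (phi : realization -> R) :
  (forall e x y, 0 <= x <= len e -> 0 <= y <= len e ->
    phi (edge_pt e x) <= phi (edge_pt e y) + `|x - y|) ->
  forall p q, phi p - phi q <= walk_dist p q.
Proof.
move=> lip p q; apply: lb_le_inf; first exact: walk_ex.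
move=> r /=; elim=> [{}p|e x y {}q {}r xe ye _ IH]; first by rewrite subrr.
by have := lip e x y xe ye; lra.
Qed.

Lemma dist_interior_gt0 e (u : {x : R | 0 < x < len e}) p :
  p <> Interior u -> 0 < walk_dist (Interior u) p.
Proof.
move=> pu; set m := Num.min (val u) (len e - val u).
have [mu ml] : m <= val u /\ m <= len e - val u by rewrite !ge_min !lexx ?orbT.
have m0 : 0 < m.
  by rewrite lt_min subr_gt0; case: (u) => x /= /andP[-> ->].
pose t x := Num.max 0 (m - `|x - val u|).
pose phi q := if q is Interior e' v then if e' == e then t (val v) else 0 else 0.
have phiE e' x : 0 <= x <= len e' ->
    phi (edge_pt e' x) = if e' == e then t x else 0.
  move=> /andP[x0 xl]; rewrite /edge_pt; case: insubP => [v _ <- //|].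
  rewrite negb_and -!leNgt => xE.
  suff -> : phi (if x <= 0 then Vertex (src e') else Vertex (tgt e')) = 0.
    case: eqP xl xE => // -> xl xE; symmetry; apply/max_idPl.
    rewrite subr_le0; case/orP: xE => xE.
      by rewrite (le_trans mu)// distrC (le_trans _ (ler_norm _))//; lra.
    by rewrite (le_trans ml)// (le_trans _ (ler_norm _))//; lra.
  by case: ifP.
have lip e' x y : 0 <= x <= len e' -> 0 <= y <= len e' ->
    phi (edge_pt e' x) <= phi (edge_pt e' y) + `|x - y|.
  move=> xe ye; rewrite !phiE//; case: eqP => _; last by rewrite add0r.
  have h := ler_distD x y (val u); rewrite (distrC y x) in h.
  rewrite /t ge_max addr_ge0 ?le_max ?lexx//= -lerBlDr le_max; apply/orP; right.
  by lra.
apply: lt_le_trans (walk_lipschitz lip _ _); rewrite subr_gt0.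
have -> : phi (Interior u) = m.
  by rewrite /phi eqxx /t subrr normr0 subr0; apply/max_idPr/ltW.
case: p pu => [//|e' v] pu; rewrite /phi; case: eqP => // ee.
move: v pu; rewrite ee => v pu; rewrite /t gt_max m0/= gtrBl normr_gt0 subr_eq0.
by apply/eqP => /val_inj vu; apply: pu; rewrite vu.
Qed.

Lemma dist_vertex_gt0 v w : v <> w -> 0 < walk_dist (Vertex w) (Vertex v).
Proof.
move=> vw; set m := \big[Num.min/1]_(e : edge G) len e.
have m0 : 0 < m.
  by apply: (big_ind (fun x => 0 < x)) => // [x y x0 y0|e _];
    [rewrite lt_min x0|exact: len_gt0].
have ml (e : edge G) : m <= len e by exact: bigmin_le.
pose t e x := Num.min m (if src e == v then x
                         else if tgt e == v then len e - x else m).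
pose phi q := match q with
  | Vertex u => if u == v then 0 else m
  | Interior e u => t e (val u) end.
have phiE e x : 0 <= x <= len e -> phi (edge_pt e x) = t e x.
  move=> /andP[x0 xl]; rewrite /edge_pt; case: insubP => [u _ <- //|].
  rewrite negb_and -!leNgt; case: (leP x 0) => /= [x0' _|_ lx].
    have {x0 xl x0'} -> : x = 0 by apply/eqP; rewrite eq_le x0' x0.
    rewrite /t subr0; case: eqP => [_|_]; first by symmetry; apply/min_idPr/ltW.
    by case: eqP => _; symmetry; apply/min_idPl.
  have {x0 xl lx} -> : x = len e by apply/eqP; rewrite eq_le xl.
  rewrite /t subrr; have := loopless e.
  case: (eqVneq (src e) v) => [-> /negbTE|_ _].
    by rewrite eq_sym => ->; symmetry; apply/min_idPl.
  by case: eqP => _; symmetry; [apply/min_idPr/ltW|apply/min_idPl].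
have lip e x y : 0 <= x <= len e -> 0 <= y <= len e ->
    phi (edge_pt e x) <= phi (edge_pt e y) + `|x - y|.
  move=> xe ye; rewrite !phiE//.
  have h1 := ler_norm (x - y); have h2 := ler_norm (y - x).
  rewrite distrC in h2; rewrite /t -lerBlDr le_min; apply/andP; split.
    by rewrite lerBlDr ge_min ler_wpDr.
  case: ifP => _; first by rewrite lerBlDr ge_min; apply/orP; right; lra.
  case: ifP => _; first by rewrite lerBlDr ge_min; apply/orP; right; lra.
  by rewrite lerBlDr ge_min ler_wpDr.
apply: lt_le_trans (walk_lipschitz lip _ _).
by rewrite /phi eqxx subr0; case: eqP => // wv; case: vw.
Qed.

Lemma walk_dist_positivity p q : walk_dist p q = 0 -> p = q.
Proof.
move=> pq0; apply: contrapT => pq; suff : 0 < walk_dist p q by rewrite pq0 ltxx.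
case: p q pq {pq0} => [v|e u] q pq; last first.
  by apply: dist_interior_gt0 => /esym.
case: q pq => [w|e u] pq; last by rewrite walk_dist_sym; exact: dist_interior_gt0.
by apply: dist_vertex_gt0 => wv; apply: pq; rewrite wv.
Qed.

HB.instance Definition _ := gen_eqMixin realization.
HB.instance Definition _ := gen_choiceMixin realization.
HB.instance Definition _ := @isMetric.Build R realization walk_dist
  walk_distxx walk_dist_positivity walk_dist_sym walk_dist_triangle.

End Realization.

(** * Divisors and rational functions *)

Notation divisor G := {freeg (realization G) / int}.

Section Divisors.
Context {R : realType} (G : metric_graph R).
Local Notation Gamma := (realization G).

Definition effective (D : divisor G) : Prop := forall p, 0 <= coeff p D.

Definition supp (D : divisor G) : set Gamma := [set p | coeff p D != 0].

(* A tangent direction is an edge together with an orientation: [(e, true)]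
   leads towards [tgt e], [(e, false)] leads towards [src e]. *)
Definition direction : finType := (edge G * bool)%type.

Definition dir_at (p : Gamma) (d : direction) : bool :=
  match p with
  | Vertex v => (if d.2 then src d.1 else tgt d.1) == v
  | Interior e _ => d.1 == e
  end.

(* The point at distance [h] from [p] in direction [d], for [dir_at p d] and
   small [h >= 0]. *)
Definition shift_pt (p : Gamma) (d : direction) (h : R) : Gamma :=
  let x := match p with
           | Vertex _ => if d.2 then 0 else len d.1
           | Interior _ u => val u
           end in
  edge_pt d.1 (if d.2 then x + h else x - h).

Definition piecewise_linear (f : Gamma -> R) : Prop :=
  forall e : edge G, exists2 B : set R, finite_set B &
    forall a b, 0 <= a -> a < b -> b <= len e ->
      (forall x, a < x < b -> ~ B x) ->
      exists k : int, forall x, a <= x <= b ->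
        f (edge_pt e x) = f (edge_pt e a) + k%:~R * (x - a).

Definition rational_function (f : Gamma -> R) : Prop :=
  continuous f /\ piecewise_linear f.

Definition outgoing_slope (f : Gamma -> R) (p : Gamma) (d : direction) : int :=
  xget 0 [set k : int |
    \forall h \near 0^'+, f (shift_pt p d h) = f p + k%:~R * h].

Definition ord (f : Gamma -> R) (p : Gamma) : int :=
  \sum_(d | dir_at p d) outgoing_slope f p d.

(* [E] is the divisor [(f)]. *)
Definition is_div (f : Gamma -> R) (E : divisor G) : Prop :=
  forall p, coeff p E = ord f p.

End Divisors.

(** * Segments, vertex sets and saturation *)

Section Segments.
Context {R : realType} (G : metric_graph R).
Local Notation Gamma := (realization G).

Definition bd (X : set Gamma) : set Gamma := closure X `\` interior X.

Definition set_dist (X Y : set Gamma) : R :=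
  inf [set mdist x y | x in X & y in Y].

(* The restriction of [g] to the open interval [`]0, l[] is an arc length
   parametrization of an open segment of length [l]: it is a local isometry and
   a homeomorphism onto its image. *)
Definition open_arc (l : R) (g : R -> Gamma) : Prop :=
  0 < l /\ forall t, 0 < t < l ->
    (exists2 e, 0 < e & forall s s', `|s - t| < e -> `|s' - t| < e ->
       mdist (g s) (g s') = `|s - s'|) /\
    (forall e, 0 < e -> exists2 d, 0 < d & forall s, 0 < s < l ->
       mdist (g t) (g s) < d -> `|s - t| < e).

Definition arc_set (l : R) (g : R -> Gamma) : set Gamma := g @` `]0, l[.

(* The disjoint union in the definition of a vertex set is a topological one,
   so the open intervals are the connected components. *)
Definition vertex_set (Om : set Gamma) : Prop :=
  [/\ Om !=set0, finite_set Om &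
    forall p, ~ Om p -> let C := connected_component (~` Om) p in
      (exists l g, open_arc l g /\ C = arc_set l g) /\
      exists a b, [/\ Om a, Om b, a <> b & closure C `\` C = [set a; b]]].

(* There are [n] disjoint open segments of the complement of [X] with an open
   end at [v]. *)
Definition outgoing_segments (X : set Gamma) (v : Gamma) (n : nat) : Prop :=
  exists (l : 'I_n -> R) (g : 'I_n -> R -> Gamma),
    [/\ forall i, open_arc (l i) (g i),
        forall i, arc_set (l i) (g i) `<=` ~` X,
        forall i, g i t @[t --> 0^'+] --> v \/ g i t @[t --> (l i)^'-] --> v &
        forall i j, i != j -> arc_set (l i) (g i) `&` arc_set (l j) (g j) = set0].

Definition outdeg (X : set Gamma) (v : Gamma) : nat :=
  xget 0%N [set n | outgoing_segments X v n /\
                    forall m, outgoing_segments X v m -> (m <= n)%N].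

Definition saturated (X : set Gamma) (D : divisor G) (v : Gamma) : Prop :=
  (outdeg X v)%:Z <= coeff v D.

End Segments.

(** * Dhar's algorithm and moves *)

Section Procedure.
Context {R : realType} (G : metric_graph R).
Local Notation Gamma := (realization G).

(* Empty when [S v0]. *)
Definition ucomp (S : set Gamma) (v0 : Gamma) : set Gamma :=
  connected_component (~` S) v0.

Definition all_saturated (D : divisor G) (v0 : Gamma) (S : set Gamma) : Prop :=
  forall v, bd (~` ucomp S v0) v -> saturated (~` ucomp S v0) D v.

Fixpoint dhar_set (D : divisor G) (v0 : Gamma) (k : nat) : set Gamma :=
  if k is k'.+1 then
    let S := dhar_set D v0 k' in
    S `\` [set v | bd (~` ucomp S v0) v /\ ~ saturated (~` ucomp S v0) D v]
  else supp D `\ v0.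

Definition dhar_stop (D : divisor G) (v0 : Gamma) (S : set Gamma) : Prop :=
  S = set0 \/ all_saturated D v0 S.

Definition dhar_output (D : divisor G) (v0 : Gamma) (S : set Gamma) : Prop :=
  effective D /\ exists k, [/\ dhar_stop D v0 (dhar_set D v0 k),
    forall j, (j < k)%N -> ~ dhar_stop D v0 (dhar_set D v0 j) &
    S = dhar_set D v0 k].

Definition basic_extremal (v0 : Gamma) (Xmax Xmin : set Gamma)
    (f : Gamma -> R) : Prop :=
  [/\ rational_function f,
      [/\ closed Xmax, connected Xmax & Xmax !=set0],
      [/\ closed Xmin, connected Xmin & Xmin v0],
      Xmax `&` Xmin = set0 &
      [/\ forall x y, Xmax x -> f y <= f x,
          forall x y, Xmin x -> f x <= f y &
          exists l, forall p, ~ (Xmax `|` Xmin) p ->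
            exists g a b, [/\ open_arc l g,
              connected_component (~` (Xmax `|` Xmin)) p = arc_set l g,
              Xmin a /\ g t @[t --> 0^'+] --> a,
              Xmax b /\ g t @[t --> l^'-] --> b &
              forall s t, 0 < s < l -> 0 < t < l -> f (g t) - f (g s) = t - s]]].

(* [E] is the divisor obtained from [D] at time [t] of the move with respect
   to [S] and [Om]. *)
Definition v0_move (Om : set Gamma) (v0 : Gamma) (D : divisor G)
    (S : set Gamma) (t : R) (E : divisor G) : Prop :=
  [/\ effective D, S `<=` supp D `\ v0, all_saturated D v0 S, 0 <= t <= 1 &
    if t == 0 then E = D else
    let U := ucomp S v0 in
    exists (J : nat) (X Xmin : 'I_J -> set Gamma) (f : 'I_J -> Gamma -> R)
        (F : 'I_J -> divisor G),
      [/\ injective X,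
          range X = [set connected_component (~` U) x | x in ~` U],
          forall j, let d := t * set_dist (X j) (U `&` (Om `|` [set v0])) in
            let P := [set p | U p /\ set_dist (X j) [set p] = d] in
            basic_extremal v0 (X j) (Xmin j) (f j) /\ bd (Xmin j) = P,
          forall j, is_div (f j) (F j) &
          E = D + \sum_j F j]].

Definition iteration (Om : set Gamma) (v0 : Gamma) (D E : divisor G) : Prop :=
  exists S, [/\ dhar_output D v0 S, S !=set0 & v0_move Om v0 D S 1 E].

(* The first [n] iterations of the procedure, started with [D]. *)
Definition run (Om : set Gamma) (v0 : Gamma) (D : divisor G) (n : nat)
    (Ds : nat -> divisor G) : Prop :=
  Ds 0%N = D /\ forall i, (i < n)%N -> iteration Om v0 (Ds i) (Ds i.+1).

End Procedure.

(* Main.v *)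
(* Put V = Om + v0, and let U_i be the component of v0 in the complement of the
   i-th output of Dhar's algorithm. The i-th move exists because, for a component
   X of the complement of U_i, the distance to X truncated at its minimal value on
   V inside U_i is piecewise linear; it is unique because a basic extremal function
   with the prescribed sets is this truncated distance up to sign and a constant.
   Every move keeps the degree, takes chips only from points outside U_i, drops a
   chip on a point of V inside U_i, and puts a chip on each segment leading from
   the complement of U_i into U_i.

   Suppose that the procedure never stops and let B be the set of the points of V
   that belong to U_i for all large i. The number of chips on a point of B is
   eventually nondecreasing, and bounded by the degree, hence eventually constant:
   late moves drop no chip on B. On a component of the complement of V joining b in
   B to c not in B, each late move for which c is not in U_i therefore leaves a chip
   strictly between b and c; and once such a chip exists, there is one forever after.
   Eventually all these segments are blocked by a chip. The fire reaches such a
   chip from one side only, so that the chip is saturated and the fire never gets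
   through: U_i meets V inside B. But then the chip that the move drops on V
   inside U_i contradicts the choice of B. *)

Require Import Defs.
From mathcomp Require Import all_boot all_order all_algebra.
From mathcomp Require Import all_classical all_reals all_analysis.
From mathcomp Require Import lra ring.
Set Implicit Arguments.
Unset Strict Implicit.
Unset Printing Implicit Defensive.
Import Order.TTheory GRing.Theory Num.Theory.
Import numFieldNormedType.Exports.
Local Open Scope classical_set_scope.
Local Open Scope ring_scope.

(** * Star neighbourhoods *)

Section Star.
Context {R : realType} (G : metric_graph R).
Local Notation Gamma := (realization G).
Implicit Types (p q : Gamma) (d : direction G) (e : edge G) (x y h : R).

(** The definitions are metric and topological: an arc is a local isometry, an outdegree is a
    maximal number of disjoint segments, an order is a sum of slopes at an unspecified small scale.
    The obstacle that shapes the proof is to bring them all down to germs: the points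
    [shift_pt p d h] for small [h > 0], in one of the finitely many directions [d] at [p]. Openness,
    slopes and outdegrees are decided on germs, and statements about whole segments follow by an
    induction along real intervals. The vertex set [Om] is a marking of the space, independent of
    the vertices of the model, so its segments may run through several edges. They are recovered as
    rays, each determined by its start and direction. Marking the points of [S] besides [V] has the
    effect that the interior of a ray lies entirely inside or entirely outside the burnt region.
    Chips sit at real positions without a common unit, so no potential on positions is available.
    Only the integer numbers of chips on the finite set [V] enter, and termination is reached by
    contradiction, without a bound on the number of moves. *)

Definition dpos p d : R :=
  match p with Vertex _ => if d.2 then 0 else len d.1 | Interior _ u => val u end.

Definition arm_length p d : R := if d.2 then len d.1 - dpos p d else dpos p d.

Lemma shift_ptE p d h :
  shift_pt p d h = edge_pt d.1 (if d.2 then dpos p d + h else dpos p d - h).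
Proof. by []. Qed.

Lemma shift_pt0 p d : dir_at p d -> shift_pt p d 0 = p.
Proof.
rewrite shift_ptE; case: p d => [v|e u] [e' b] /=.
  by case: b => /eqP <-; rewrite ?addr0 ?subr0 ?edge_pt0 ?edge_ptl.
by move=> /eqP ->; rewrite addr0 subr0 if_same edge_pt_in.
Qed.

Lemma arm_length_gt0 p d : dir_at p d -> 0 < arm_length p d.
Proof.
rewrite /arm_length; case: p d => [v|e u] [e' b] /=.
  by case: b => _; rewrite ?subr0 len_gt0.
by move=> /eqP ->; case: b; case: u => x /= /andP[x0 xl] //; rewrite subr_gt0.
Qed.

Lemma arm_in p d h : dir_at p d -> 0 <= h <= arm_length p d ->
  0 <= (if d.2 then dpos p d + h else dpos p d - h) <= len d.1.
Proof.
rewrite /arm_length; case: p d => [v|e u] [e' b] /=.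
  by case: b => _ h1; lra.
by move=> /eqP ->; case: b; case: u => x /= x1 h1; lra.
Qed.

(** Half of the shortest arm, so that a tent of height [rad p] is back at 0 by the end of every arm.
    The cap 1 covers a point without directions, that is, a graph without edges. *)
Definition rad p : R := \big[Num.min/1]_(d | dir_at p d) (arm_length p d / 2).

Lemma rad_gt0 p : 0 < rad p.
Proof.
apply: (big_ind (fun x => 0 < x)) => // [x y x0 y0|d pd].
  by rewrite lt_min x0.
by rewrite divr_gt0// arm_length_gt0.
Qed.

Lemma rad_arm p d : dir_at p d -> 2 * rad p <= arm_length p d.
Proof.
move=> pd; have : rad p <= arm_length p d / 2 by exact: bigmin_le_cond.
by lra.
Qed.

Lemma mdist_walk p q : mdist p q = walk_dist p q.
Proof. by []. Qed.

Lemma mdist_edge e x y : 0 <= x <= len e -> 0 <= y <= len e ->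
  mdist (edge_pt e x) (edge_pt e y) <= `|x - y|.
Proof. by move=> xe ye; apply: walk_dist_le; exact: walk_edge. Qed.

Lemma mdist_shift_le p d h h' : dir_at p d -> 0 <= h <= arm_length p d ->
  0 <= h' <= arm_length p d ->
  mdist (shift_pt p d h) (shift_pt p d h') <= `|h - h'|.
Proof.
move=> pd hl hl'; rewrite !shift_ptE.
apply: (le_trans (mdist_edge _ _)); rewrite ?arm_in//.
rewrite le_eqVlt; apply/orP; left; apply/eqP.
case: (d.2); first by congr `|_|; ring.
by rewrite distrC; congr `|_|; ring.
Qed.

Definition tent (r x : R) : R := Num.max 0 (Num.min x (2 * r - x)).

Lemma tent_lip r x y : tent r x - tent r y <= `|x - y|.
Proof.
have h1 := ler_norm (x - y); have h2 := ler_norm (y - x); rewrite distrC in h2.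
rewrite /tent /Num.max /Num.min; repeat case: ifPn => //; rewrite -?leNgt; lra.
Qed.

Lemma tent_le0 r x : x <= 0 -> tent r x = 0.
Proof. by move=> x0; apply/max_idPl; rewrite ge_min x0. Qed.

Lemma tent_ge r x : 2 * r <= x -> tent r x = 0.
Proof. by move=> x0; apply/max_idPl; rewrite ge_min subr_le0 x0 orbT. Qed.

Lemma tent_id r x : 0 <= x <= r -> tent r x = x.
Proof.
by move=> x0; rewrite /tent (min_idPl _) ?(max_idPr _)//; lra.
Qed.

Lemma tent_bound r x : 0 <= x -> 0 <= tent r x <= x.
Proof. by move=> x0; rewrite /tent le_max lexx/= ge_max x0 ge_min lexx. Qed.

Definition dir_weight d1 d2 d : R := (d == d1)%:R - (d == d2)%:R.

(* Signed distance to [p], positive along [d1] and negative along [d2] (zero if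
   [d1 = d2]), brought back to 0 before the end of the arms of the star. *)
Definition star_fun (s : direction G -> R) p q : R :=
  match q with
  | Vertex _ => 0
  | Interior e u => \sum_(b | dir_at p (e, b)) s (e, b) *
      tent (rad p) (if b then val u - dpos p (e, b) else dpos p (e, b) - val u)
  end.

Lemma star_funE s p e x : 0 <= x <= len e -> star_fun s p (edge_pt e x) =
  \sum_(b | dir_at p (e, b)) s (e, b) *
      tent (rad p) (if b then x - dpos p (e, b) else dpos p (e, b) - x).
Proof.
move=> xe; rewrite /edge_pt; case: insubP => [u _ <- //|].
rewrite negb_and -!leNgt => xE; transitivity (0 : R); first by case: ifP.
symmetry; apply: big1 => b pb; have := rad_arm pb; rewrite /arm_length /=.
case: b pb => pb h; last first.
  have [x0|x0] := leP x 0; first by rewrite tent_ge ?mulr0//; lra.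
  have {xE x0 xe} -> : x = len e by rewrite leNgt x0/= in xE; lra.
  rewrite tent_le0 ?mulr0//.
  by case: p pb {h} => [v|e' u]/=; rewrite ?subrr// => /eqP ->; case: u => y /=; lra.
have [x0|x0] := leP x 0; last first.
  by rewrite leNgt x0/= in xE; rewrite tent_ge ?mulr0//; lra.
rewrite tent_le0 ?mulr0//.
by case: p pb {h} => [v|e' u] /= _; [rewrite subr0|case: u => y /=; lra].
Qed.

Lemma weighted_tent_lip s r x y : `|s| <= 1 -> s * tent r x - s * tent r y <= `|x - y|.
Proof.
move=> s1; rewrite -mulrBr; have h1 := tent_lip r x y; have h2 := tent_lip r y x.
apply: le_trans (ler_norm _) _; rewrite normrM.
rewrite (le_trans (ler_wpM2r _ s1))// mul1r ler_norml; rewrite distrC in h2.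
by lra.
Qed.

(** Two tents share an edge only when [p] is interior to it. They then lie on opposite sides of [p],
    and the value at a point of either side is at most its distance to [p], so weights of any sign
    are harmless. *)
Lemma star_fun_lip s p e x y : (forall d, `|s d| <= 1) ->
  0 <= x <= len e -> 0 <= y <= len e ->
  star_fun s p (edge_pt e x) <= star_fun s p (edge_pt e y) + `|x - y|.
Proof.
move=> s1 xe ye; rewrite !star_funE// !(big_mkcond (fun b => dir_at p (e, b))).
rewrite !big_bool/=.
have H (b : bool) c : s (e, b) * tent (rad p) (if b then x - c else c - x) -
    s (e, b) * tent (rad p) (if b then y - c else c - y) <= `|x - y|.
  apply: le_trans (weighted_tent_lip _ _ _ (s1 _)) _.
  rewrite le_eqVlt; apply/orP; left; apply/eqP.
  case: b; first by congr `|_|; ring.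
  by rewrite distrC; congr `|_|; ring.
have Ht c := H true c; have Hf c := H false c => {H}.
have n0 := normr_ge0 (x - y).
case: p Ht Hf => [v|e' u]/= Ht Hf.
  have := Ht 0; have := Hf (len e) => /=.
  case: (eqVneq (src e) v) => [sv|_]; case: (eqVneq (tgt e) v) => [tv|_] h1 h2;
    [by have := loopless e; rewrite sv tv eqxx|lra..].
have [_|_] := eqVneq e e'; last by lra.
set c := val u; have := Ht c; have := Hf c => /=.
have := s1 (e, true); have := s1 (e, false); rewrite !ler_norml.
set s2 := s (e, true); set s3 := s (e, false).
move: (s2) (s3) => {}s2 {}s3 s21 s31.
have [xc|cx] := leP x c; have [yc|cy] := leP y c.
- by rewrite (tent_le0 _ (x := x - c)) ?(tent_le0 _ (x := y - c))//; lra.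
- rewrite (tent_le0 _ (x := x - c)) ?(tent_le0 _ (x := c - y)) ?mulr0; [|lra..].
  move=> _ _; have /andP[a1 a2] : 0 <= tent (rad (Interior u)) (c - x) <= c - x by apply: tent_bound; lra.
  have /andP[b1 b2] : 0 <= tent (rad (Interior u)) (y - c) <= y - c by apply: tent_bound; lra.
  have := ler_norm (y - x); rewrite distrC => h; nra.
- rewrite (tent_le0 _ (x := y - c)) ?(tent_le0 _ (x := c - x)) ?mulr0; [|lra..].
  move=> _ _; have /andP[a1 a2] : 0 <= tent (rad (Interior u)) (c - y) <= c - y by apply: tent_bound; lra.
  have /andP[b1 b2] : 0 <= tent (rad (Interior u)) (x - c) <= x - c by apply: tent_bound; lra.
  have := ler_norm (x - y) => h; nra.
- by rewrite (tent_le0 _ (x := c - x)) ?(tent_le0 _ (x := c - y))//; lra.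
Qed.

Lemma star_fun_shift s p d h : dir_at p d -> 0 <= h <= rad p ->
  star_fun s p (shift_pt p d h) = s d * h.
Proof.
move=> pd hr; have r2 := rad_arm pd; rewrite shift_ptE star_funE; last first.
  by apply: arm_in => //; lra.
rewrite (bigD1 d.2)/=; last by rewrite -surjective_pairing.
rewrite -surjective_pairing big1 ?addr0 => [|b /andP[pb bd]].
  have -> : (if d.2 then (if d.2 then dpos p d + h else dpos p d - h) - dpos p d
     else dpos p d - (if d.2 then dpos p d + h else dpos p d - h)) = h.
    by case: (d.2); ring.
  by rewrite tent_id.
case: d pd r2 b pb bd => e []/= pd r2 [] //= pb _; case: p pd pb hr r2 => [v|e' u]/= pd pb hr r2.
- by have := loopless e; rewrite (eqP pd) (eqP pb) eqxx.
- by rewrite tent_le0 ?mulr0//; lra.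
- by have := loopless e; rewrite (eqP pd) (eqP pb) eqxx.
- by rewrite tent_le0 ?mulr0//; lra.
Qed.

Lemma star_fun_mdist s p q q' : (forall d, `|s d| <= 1) ->
  star_fun s p q - star_fun s p q' <= mdist q q'.
Proof.
move=> s1; apply: walk_lipschitz => e x y xe ye; exact: star_fun_lip.
Qed.

Lemma mdist_shift_same p d h h' : dir_at p d -> 0 <= h <= rad p ->
  0 <= h' <= rad p -> mdist (shift_pt p d h) (shift_pt p d h') = `|h - h'|.
Proof.
move=> pd hr hr'; have r2 := rad_arm pd; apply/eqP; rewrite eq_le; apply/andP; split.
  by apply: mdist_shift_le => //; lra.
have H k k' : 0 <= k <= rad p -> 0 <= k' <= rad p ->
    k - k' <= mdist (shift_pt p d k) (shift_pt p d k').
  move=> kr kr'.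
  have : forall d' : direction G, `|(d' == d)%:R| <= 1 :> R.
    by move=> d'; case: eqP => _; rewrite ?normr1 ?normr0.
  by move=> /(star_fun_mdist p (shift_pt p d k) (shift_pt p d k')); rewrite !star_fun_shift// eqxx !mul1r.
rewrite ler_norml; have := H _ _ hr hr'; have := H _ _ hr' hr; rewrite metric_sym; lra.
Qed.

(** The upper bound goes through [p]; the lower bound tests the 1-Lipschitz function with weight 1
    on [d] and -1 on [d']. *)
Lemma mdist_shift_diff p d d' h h' : dir_at p d -> dir_at p d' -> d != d' ->
  0 <= h <= rad p -> 0 <= h' <= rad p ->
  mdist (shift_pt p d h) (shift_pt p d' h') = h + h'.
Proof.
move=> pd pd' dd hr hr'; apply/eqP; rewrite eq_le; apply/andP; split.
  apply: (le_trans (metric_triangle _ p _)); have r0 := rad_gt0 p.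
  have h0 : 0 <= (0 : R) <= rad p by lra.
  have := mdist_shift_same pd hr h0; have := mdist_shift_same pd' hr' h0.
  rewrite !shift_pt0// !subr0 !ger0_norm; [|lra..].
  by rewrite (metric_sym p) => -> ->.
have : forall d'' : direction G, `|dir_weight d d' d''| <= 1 :> R.
  move=> d''; rewrite /dir_weight; do 2 case: eqP => _;
  by rewrite ?subrr ?subr0 ?sub0r ?normrN ?normr1 ?normr0.
move=> /(star_fun_mdist p (shift_pt p d h) (shift_pt p d' h')).
have dd' : (d' == d) = false by rewrite eq_sym; exact: negPf.
by rewrite !star_fun_shift// /dir_weight !eqxx (negPf dd) dd' /=; lra.
Qed.

Lemma mdist_shift p d h : dir_at p d -> 0 <= h <= rad p ->
  mdist p (shift_pt p d h) = h.
Proof.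
move=> pd hr; have r0 := rad_gt0 p; have h0 : 0 <= (0 : R) <= rad p by lra.
have := mdist_shift_same pd h0 hr.
by rewrite shift_pt0// sub0r normrN ger0_norm//; lra.
Qed.

(* Distance to [p], truncated at [rad p]. *)
Definition near_fun p q : R :=
  match p, q with
  | Vertex v, Vertex w => if w == v then 0 else rad p
  | Vertex v, Interior e u => Num.min (rad p) (if src e == v then val u
                               else if tgt e == v then len e - val u else rad p)
  | Interior _ _, Vertex _ => rad p
  | Interior e u, Interior e' u' =>
      if e' == e then Num.min (rad p) `|val u' - val u| else rad p
  end.

Lemma near_fun_lip p q q' : near_fun p q - near_fun p q' <= mdist q q'.
Proof.
apply: walk_lipschitz => e x y xe ye; case: p => [v|e0 u0].
  set r := rad (Vertex v).
  have phiE z : 0 <= z <= len e -> near_fun (Vertex v) (edge_pt e z) =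
      Num.min r (if src e == v then z else if tgt e == v then len e - z else r).
    move=> /andP[z0 zl]; rewrite /edge_pt; case: insubP => [u _ <- //|].
    rewrite negb_and -!leNgt; case: (leP z 0) => /= [z0' _|_ lz].
      have {z0 zl z0'} -> : z = 0 by apply/eqP; rewrite eq_le z0' z0.
      case: eqP => [_|]; first by symmetry; apply/min_idPr/ltW/rad_gt0.
      move=> _; case: eqP => [te|_]; last by rewrite minxx.
      rewrite subr0; symmetry; apply/min_idPl.
      have := @rad_arm (Vertex v) (e, false); rewrite /= te eqxx => /(_ isT).
      by rewrite /arm_length /= -/r; have := rad_gt0 (Vertex v); rewrite -/r; lra.
    have {z0 zl lz} -> : z = len e by apply/eqP; rewrite eq_le zl.
    have ll := loopless e; case: (eqVneq (src e) v) => [se|_].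
      have -> : (tgt e == v) = false by rewrite -se eq_sym; exact: negPf.
      symmetry; apply/min_idPl.
      have := @rad_arm (Vertex v) (e, true); rewrite /= se eqxx => /(_ isT).
      by rewrite /arm_length /= subr0 -/r; have := rad_gt0 (Vertex v); rewrite -/r; lra.
    case: eqP => [_|]; last by rewrite minxx.
    by rewrite subrr; symmetry; apply/min_idPr/ltW/rad_gt0.
  rewrite !phiE//; have h1 := ler_norm (x - y); have h2 := ler_norm (y - x).
  rewrite distrC in h2; have := rad_gt0 (Vertex v); rewrite -/r.
  by repeat (rewrite /Num.min; case: ifPn => //); rewrite -?leNgt; lra.
set r := rad (Interior u0).
have phiE z : 0 <= z <= len e -> near_fun (Interior u0) (edge_pt e z) =
    if e == e0 then Num.min r `|z - val u0| else r.
  move=> ze; rewrite /edge_pt; case: insubP => [u _ <- //|].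
  rewrite negb_and -!leNgt => zE; have -> : near_fun (Interior u0)
     (if z <= 0 then Vertex (src e) else Vertex (tgt e)) = r by case: ifP.
  case: eqP => // ee; symmetry; apply/min_idPl; move: zE ze; rewrite ee => zE ze.
  have := @rad_arm (Interior u0) (e0, true); have := @rad_arm (Interior u0) (e0, false).
  rewrite /= eqxx => /(_ isT) a1 /(_ isT); move: a1.
  rewrite /arm_length/= -/r => a1 a2; have := rad_gt0 (Interior u0); rewrite -/r => r0.
  have h1 := ler_norm (z - val u0); have h2 := ler_norm (val u0 - z).
  by rewrite distrC in h2; rewrite /= in h1 h2 *; case/orP: zE => zE; lra.
rewrite !phiE//; case: eqP => _; last by rewrite lerDl.
have := ler_distD y x (val u0); have := normr_ge0 (x - y).
rewrite /Num.min; repeat case: ifPn => //; rewrite -?leNgt; lra.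
Qed.

Lemma near_fun_id p : near_fun p p = 0.
Proof.
case: p => [v|e u]/=; rewrite eqxx// subrr normr0.
by apply/min_idPr/ltW/rad_gt0.
Qed.

(** [near_fun p] is 1-Lipschitz and vanishes at [p], so it is below [rad p] at [q]; its definition
    then exhibits the arm that carries [q]. *)
Lemma star_ball p q : mdist p q < rad p -> q <> p ->
  exists d, dir_at p d /\ q = shift_pt p d (mdist p q).
Proof.
move=> pq qp; have {pq} : near_fun p q < rad p.
  by apply: le_lt_trans pq; have := near_fun_lip p q p; rewrite near_fun_id subr0 metric_sym.
suff : near_fun p q < rad p ->
    exists d h, [/\ dir_at p d, 0 <= h <= rad p & q = shift_pt p d h].
  by move=> H /H[d [h [pd hr qE]]]; exists d; split=> //; rewrite {2}qE mdist_shift.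
case: p q qp => [v|e u] [w|e' u'] /= qp.
- by case: eqP => [wv|_]; [case: qp; rewrite wv|rewrite ltxx].
- rewrite gt_min ltxx/=; case: u' qp => x /= xe qp.
  case: eqP => [se|_] xr.
    exists (e', true), x; split; rewrite /= ?se ?eqxx//; first by lra.
    by rewrite shift_ptE/= add0r -[LHS]edge_pt_in.
  case: eqP xr => [te|_] xr; last by rewrite ltxx in xr.
  exists (e', false), (len e' - x); split; rewrite /= ?te ?eqxx//; first by lra.
  by rewrite shift_ptE/= subKr -[LHS]edge_pt_in.
- by rewrite ltxx.
- case: eqP => [ee|]; last by rewrite ltxx.
  move: u' qp; rewrite ee => -[x' x'e] qp; rewrite gt_min ltxx/=.
  case: u qp => x xe /= qp ur; have [uu|uu] := leP x x'.
    exists (e, true), (x' - x); split; rewrite /= ?eqxx//.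
      by rewrite ger0_norm in ur; lra.
    by rewrite shift_ptE/= addrC subrK -[LHS]edge_pt_in.
  exists (e, false), (x - x'); split; rewrite /= ?eqxx//.
    by rewrite ltr0_norm in ur; lra.
  by rewrite shift_ptE/= subKr -[LHS]edge_pt_in.
Qed.

End Star.

(** * Local criteria *)

Section IntervalInduction.
Context {R : realType}.

(** Induction along a real interval: the supremum of the points reachable from [a] cannot fall short
    of [b]. The local hypothesis only concerns intervals that contain [x], which is all that the
    germs at [x] control. *)
Lemma interval_ind (Q : R -> R -> Prop) (a b : R) : a <= b ->
  (forall x, a <= x <= b -> exists2 e, 0 < e & forall s t, a <= s -> s <= x ->
     x <= t -> t <= b -> x - e < s -> t < x + e -> Q s t) ->
  (forall s t u, a <= s -> s <= t -> t <= u -> u <= b -> Q s t -> Q t u -> Q s u) ->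
  Q a b.
Proof.
move=> ab loc trans.
have Qxx x : a <= x <= b -> Q x x.
  move=> /[dup] xab /loc[e e0]; apply; lra.
pose A := [set t | a <= t <= b /\ Q a t].
have Aa : A a by split; [lra|apply: Qxx; lra].
have supA : has_sup A by split; [exists a|exists b => t [/andP[]]].
have ac : a <= sup A by exact: sup_upper_bound.
have cb : sup A <= b by apply: ge_sup => [|t [/andP[]]]; first by exists a.
have [e e0 He] := loc (sup A) ltac:(lra).
have [t [tab Qat] te] := sup_adherent e0 supA.
have tc : t <= sup A by exact: sup_upper_bound.
have [c'b|bc'] := leP (sup A + e / 2) b.
  suff : A (sup A + e / 2) by move=> /(sup_upper_bound supA); lra.
  split; first by lra.
  apply: (trans _ t) => //; [lra..|]; apply: He; lra.
apply: (trans _ t) => //; [lra..|]; apply: He; lra.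
Qed.

Lemma finite_set_gap (B : set R) (c : R) : finite_set B ->
  exists2 e, 0 < e & forall x, B x -> 0 < `|x - c| -> e <= `|x - c|.
Proof.
move=> /finite_seqP[s ->]; elim: s => [|y s [e e0 IH]]; first by exists 1.
have [yc|yc] := eqVneq y c.
  exists e => // x; rewrite /= inE => /orP[/eqP ->|]; last exact: IH.
  by rewrite yc subrr normr0 ltxx.
exists (Num.min e `|y - c|); first by rewrite lt_min e0 normr_gt0 subr_eq0.
move=> x; rewrite /= inE => /orP[/eqP -> _|xs xc]; first by rewrite ge_min lexx orbT.
by rewrite ge_min IH.
Qed.

End IntervalInduction.

(** * Germs in a direction: slopes, neighbourhoods, connectedness *)

Section Germs.
Context {R : realType} (G : metric_graph R).
Local Notation Gamma := (realization G).
Implicit Types (p q : Gamma) (d : direction G) (e : edge G) (x y h : R).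

Lemma shift_edge_true e x h : 0 <= x < len e ->
  dir_at (edge_pt e x) (e, true) /\ shift_pt (edge_pt e x) (e, true) h = edge_pt e (x + h).
Proof.
move=> /andP[x0 xl]; rewrite shift_ptE /=.
have [->|xn] := eqVneq x 0; first by rewrite edge_pt0 /= eqxx.
have xe : 0 < x < len e by rewrite lt_neqAle eq_sym xn x0.
by rewrite /edge_pt insubT /= eqxx.
Qed.

Lemma shift_edge_false e x h : 0 < x <= len e ->
  dir_at (edge_pt e x) (e, false) /\ shift_pt (edge_pt e x) (e, false) h = edge_pt e (x - h).
Proof.
move=> /andP[x0 xl]; rewrite shift_ptE /=.
have [->|xn] := eqVneq x (len e); first by rewrite edge_ptl /= eqxx.
have xe : 0 < x < len e by rewrite x0 lt_neqAle xn.
by rewrite /edge_pt insubT /= eqxx.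
Qed.

(** Turns facts about germs into facts about edge coordinates. The guards [x + h <= len e] and
    [0 <= x - h] rule out the directions that do not exist at the ends of the edge. *)
Lemma edge_germ (P : Gamma -> direction G -> R -> Prop) :
  (forall p d, dir_at p d -> exists2 eps, 0 < eps & forall h, 0 < h < eps -> P p d h) ->
  forall e x, 0 <= x <= len e -> exists2 eps, 0 < eps & forall h, 0 < h < eps ->
    (x + h <= len e -> P (edge_pt e x) (e, true) h /\
       shift_pt (edge_pt e x) (e, true) h = edge_pt e (x + h)) /\
    (0 <= x - h -> P (edge_pt e x) (e, false) h /\
       shift_pt (edge_pt e x) (e, false) h = edge_pt e (x - h)).
Proof.
move=> HP e x xe.
have [e1 e10 H1] : exists2 eps, 0 < eps & forall h, 0 < h < eps ->
    x + h <= len e -> P (edge_pt e x) (e, true) h /\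
       shift_pt (edge_pt e x) (e, true) h = edge_pt e (x + h).
  have [xl|xl] := ltP x (len e); last by exists 1 => // h h1 xh; exfalso; move: h1 xh xl; clear; lra.
  have xe' : 0 <= x < len e by case/andP: xe => ->.
  have [eps eps0 H] := HP _ _ (shift_edge_true 0 xe').1.
  by exists eps => // h h1 _; split; [exact: H|exact: (shift_edge_true h xe').2].
have [e2 e20 H2] : exists2 eps, 0 < eps & forall h, 0 < h < eps ->
    0 <= x - h -> P (edge_pt e x) (e, false) h /\
       shift_pt (edge_pt e x) (e, false) h = edge_pt e (x - h).
  have [xl|xl] := ltP 0 x; last by exists 1 => // h h1 xh; exfalso; move: h1 xh xl; clear; lra.
  have xe' : 0 < x <= len e by case/andP: xe => _ ->; rewrite xl.
  have [eps eps0 H] := HP _ _ (shift_edge_false 0 xe').1.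
  by exists eps => // h h1 _; split; [exact: H|exact: (shift_edge_false h xe').2].
exists (Num.min e1 e2); first by rewrite lt_min e10.
by move=> h; rewrite lt_min => /and3P[h0 h1 h2]; split; [apply: H1|apply: H2]; rewrite h0.
Qed.

(** The germwise bounds add up along an edge by [interval_ind], then along walks. *)
Lemma local_lipschitz (f : Gamma -> R) :
  (forall p d, dir_at p d -> exists2 eps, 0 < eps & forall h, 0 < h < eps ->
     `|f (shift_pt p d h) - f p| <= h) ->
  forall p q, f p - f q <= mdist p q.
Proof.
move=> /edge_germ H; apply: walk_lipschitz => e x y xe ye.
suff L s t : 0 <= s -> s <= t -> t <= len e ->
    `|f (edge_pt e s) - f (edge_pt e t)| <= t - s.
  rewrite -lerBlDl; apply: le_trans (ler_norm _) _; clear H.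
  case/andP: xe ye => x0 xl /andP[y0 yl]; have [xy|/ltW yx] := leP x y.
    by rewrite [leRHS]distrC (ger0_norm (x := y - x)) ?subr_ge0// L.
  by rewrite [leLHS]distrC (ger0_norm (x := x - y)) ?subr_ge0// L.
move=> s0 st tl; apply: (interval_ind (Q := fun s t =>
    `|f (edge_pt e s) - f (edge_pt e t)| <= t - s)) => // [z ze|a b c _ ab bc _ h1 h2].
  have [|eps eps0 Heps] := H e z; first by lra.
  exists eps => // a b sa az zb bt za bz.
  have h1 : `|f (edge_pt e a) - f (edge_pt e z)| <= z - a.
    have [->|zn] := eqVneq a z; first by rewrite !subrr normr0.
    have ha : 0 < z - a < eps by rewrite subr_gt0 lt_neqAle zn az/=; lra.
    by have [|+ h3] := (Heps _ ha).2; [lra|]; rewrite h3 subKr.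
  have h2 : `|f (edge_pt e b) - f (edge_pt e z)| <= b - z.
    have [->|zn] := eqVneq b z; first by rewrite !subrr normr0.
    have ha : 0 < b - z < eps by rewrite subr_gt0 lt_neqAle eq_sym zn zb/=; lra.
    by have [|+ h3] := (Heps _ ha).1; [lra|]; rewrite h3 (addrC z) subrK.
  have := ler_distD (f (edge_pt e z)) (f (edge_pt e a)) (f (edge_pt e b)).
  by rewrite distrC in h2; lra.
by have := ler_distD (f (edge_pt e b)) (f (edge_pt e a)) (f (edge_pt e c)); lra.
Qed.

(** Connectedness of the graph in terms of germs: if [A] failed at [q], the function with value
    [mdist p q + 1] on [A] and 0 elsewhere would be locally constant, hence 1-Lipschitz, although it
    jumps by more than the distance. *)
Lemma locally_constant (A : set Gamma) :
  (forall p d, dir_at p d -> exists2 eps, 0 < eps & forall h, 0 < h < eps ->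
     (A (shift_pt p d h) <-> A p)) ->
  forall p q, A p -> A q.
Proof.
move=> H p q Ap; apply: contrapT => Aq.
pose k := mdist p q + 1; pose f r : R := if `[< A r >] then k else 0.
have : f p - f q <= mdist p q.
  apply: local_lipschitz => r d /H[eps eps0 He]; exists eps => // h /[dup] h1 /He hA.
  have -> : f (shift_pt r d h) = f r by rewrite /f (propext hA).
  by rewrite subrr normr0; lra.
by rewrite /f asboolT// asboolF// /k; lra.
Qed.

Definition germ (f : Gamma -> R) p d (k : int) : Prop :=
  exists2 eps, 0 < eps & forall h, 0 < h < eps -> f (shift_pt p d h) = f p + k%:~R * h.

Lemma germ_outgoing_slope f p d k : germ f p d k -> outgoing_slope f p d = k.
Proof.
move=> [eps eps0 He]; apply: xget_unique.
  near=> h; apply: He; apply/andP; split; near: h.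
    exact: nbhs_right_gt.
  exact: nbhs_right_lt.
move=> k' Hk'; near (0 : R)^'+ => h.
have h0 : 0 < h by near: h; exact: nbhs_right_gt.
have heps : h < eps by near: h; exact: nbhs_right_lt.
have := He h; rewrite h0 heps => /(_ isT) h1.
have h2 : f (shift_pt p d h) = f p + k'%:~R * h by near: h.
move: h2; rewrite h1 => /addrI /(mulIf (lt0r_neq0 h0)) /eqP.
by rewrite eqr_int => /eqP.
Unshelve. all: by end_near. Qed.

Lemma nbhs_mdist p (A : set Gamma) :
  nbhs p A <-> exists2 eps, 0 < eps & forall q, mdist p q < eps -> A q.
Proof.
split=> [/nbhs_ballP[eps /= eps0 H]|[eps eps0 H]].
  by exists eps => // q pq; apply: H; rewrite ballEmdist.
by apply/nbhs_ballP; exists eps => //= q; rewrite ballEmdist => /H.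
Qed.

Lemma finite_min_pos (T : finType) (P : pred T) (Q : T -> R -> Prop) :
  (forall t, P t -> exists2 eps, 0 < eps & forall h, 0 < h < eps -> Q t h) ->
  exists2 eps, 0 < eps & forall t, P t -> forall h, 0 < h < eps -> Q t h.
Proof.
move=> H; have {H} : forall t, exists eps, 0 < eps /\ (P t -> forall h, 0 < h < eps -> Q t h).
  move=> t; have [/H[eps e0 He]|nP] := boolP (P t); first by exists eps.
  by exists 1.
move=> /choice[E HE]; exists (\big[Num.min/1]_t E t).
  by apply: (big_ind (fun x => 0 < x)) => // [x y x0 y0|d _]; [rewrite lt_min x0|have [] := HE d].
move=> t Pt h /andP[h0 hE]; apply: (HE t).2 => //; rewrite h0/=.
by apply: lt_le_trans hE _; exact: bigmin_le_cond.
Qed.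

(** A small ball is a star by [star_ball], and its finitely many arms allow a common radius. *)
Lemma nbhs_germ p (A : set Gamma) : nbhs p A <-> A p /\
  forall d, dir_at p d -> exists2 eps, 0 < eps & forall h, 0 < h < eps -> A (shift_pt p d h).
Proof.
split=> [pA|[Ap H]].
  split; first exact: nbhs_singleton.
  move=> d pd; have [eps eps0 He] := (nbhs_mdist _ _).1 pA.
  have r0 := rad_gt0 p.
  exists (Num.min eps (rad p)); first by rewrite lt_min eps0.
  by move=> h; rewrite lt_min => h1; apply: He; rewrite mdist_shift//; lra.
have [eps eps0 He] := finite_min_pos H.
apply/nbhs_mdist; have r0 := rad_gt0 p.
exists (Num.min eps (rad p)); first by rewrite lt_min eps0.
move=> q; rewrite lt_min => /andP[qe qr]; have [->//|/eqP qp] := eqVneq q p.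
have [d [pd ->]] := star_ball qr qp; apply: He => //.
by rewrite qe mdist_gt0 eq_sym andbT; exact/eqP.
Qed.

Lemma open_germ (A : set Gamma) : open A <-> forall p, A p -> forall d, dir_at p d ->
  exists2 eps, 0 < eps & forall h, 0 < h < eps -> A (shift_pt p d h).
Proof.
rewrite openE; split=> [oA p /oA/nbhs_germ[]//|H p Ap].
by apply/nbhs_germ; split => //; exact: H.
Qed.

Lemma lipschitz_within (A : set R) (g : R -> Gamma) :
  (forall s t, A s -> A t -> mdist (g s) (g t) <= `|s - t|) -> {within A, continuous g}.
Proof.
move=> H; apply/subspace_continuousP => x Ax.
apply/metricType_numDomainType.cvgrPdist_lt => eps eps0.
rewrite near_withinE; near=> t => At.
apply: le_lt_trans (H _ _ Ax At) _; near: t.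
exact: (@cvgr_dist_lt _ _ _ (nbhs x) _ id).
Unshelve. all: by end_near. Qed.

Lemma lipschitz_itv_connected (i : interval R) (g : R -> Gamma) :
  (forall s t, s \in i -> t \in i -> mdist (g s) (g t) <= `|s - t|) ->
  connected (g @` [set` i]).
Proof.
move=> H; apply: connected_continuous_connected; last exact: lipschitz_within.
apply/connected_intervalP; exact: interval_is_interval.
Qed.

Lemma arm_connected p d h : dir_at p d -> h <= arm_length p d ->
  connected (shift_pt p d @` `[0, h]).
Proof.
move=> pd hl; apply: lipschitz_itv_connected => s t; rewrite !in_itv/= => s1 t1.
by apply: mdist_shift_le => //; lra.
Qed.

Lemma component_shift (A : set Gamma) p d h : dir_at p d -> A p -> 0 <= h -> h <= arm_length p d ->
  (forall h', 0 < h' <= h -> A (shift_pt p d h')) -> connected_component A p (shift_pt p d h).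
Proof.
move=> pd Ap h0 hl H.
apply: (@connected_component_max _ A (shift_pt p d @` `[0, h]) p).
- by exists 0; [rewrite /= in_itv/= lexx h0|rewrite shift_pt0].
- move=> _ [t /= ] + <-; rewrite in_itv/= => /andP[t0 th].
  have [->|tn] := eqVneq t 0; first by rewrite shift_pt0.
  by apply: H; rewrite th lt_neqAle eq_sym tn t0.
- exact: arm_connected.
- by exists h => //=; rewrite in_itv/= h0 lexx.
Qed.

Lemma component_open (A : set Gamma) p : open A -> open (connected_component A p).
Proof.
move=> oA; apply/open_germ => q Cq d qd.
have Aq : A q by exact: connected_component_sub Cq.
have [eps eps0 He] := (open_germ _).1 oA _ Aq _ qd.
have l0 := arm_length_gt0 qd.
exists (Num.min eps (arm_length q d)); first by rewrite lt_min eps0.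
move=> h; rewrite lt_min => h1.
apply: (connected_component_trans Cq); apply: component_shift => //; [lra..|].
by move=> h' h'1; apply: He; lra.
Qed.

Lemma Gamma_compact : compact [set: Gamma].
Proof.
have -> : [set: Gamma] =
   (\bigcup_(e in [set` enum (edge G)]) (edge_pt e @` `[0, len e])) `|`
   (\bigcup_(v in [set` enum (vert G)]) [set Vertex v]).
  apply/seteqP; split=> // -[v|e u] _.
    by right; exists v => //=; rewrite mem_enum.
  left; exists e; first by rewrite /= mem_enum.
  by exists (val u); rewrite ?edge_pt_in//= in_itv/=; case: u => x /= /andP[/ltW -> /ltW ->].
rewrite !bigcup_seq; apply: compactU; apply: bigsetU_compact => i _; last exact: compact_set1.
apply: continuous_compact; last exact: segment_compact.
by apply: lipschitz_within => s t; rewrite /= !in_itv/= => s1 t1; exact: mdist_edge.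
Qed.

Lemma mdist_lipschitz_continuous (f : Gamma -> R) :
  (forall p q, f p - f q <= mdist p q) -> continuous f.
Proof.
move=> lip p; have FF : Filter (nbhs p) := @nbhs_filter _ p.
apply/(@cvgrPdist_lt _ _ _ _ FF) => eps eps0.
have : nbhs p [set q | mdist p q < eps].
  apply/nbhs_mdist; exists eps => //.
apply: filterS => q /=.
apply: le_lt_trans; rewrite ler_norml; have := lip p q; have := lip q p; rewrite metric_sym.
lra.
Qed.

(** Slopes bounded by 1 give the Lipschitz bound, hence continuity. The break points are collected
    by interval induction: [z] itself close to [z], and the joint [t] whenever two intervals are
    concatenated. *)
Lemma germ_rational (f : Gamma -> R) :
  (forall p d, dir_at p d -> exists2 k, `|k| <= 1 & germ f p d k) ->
  rational_function f /\ forall p q, f p - f q <= mdist p q.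
Proof.
move=> H.
have lip : forall p q, f p - f q <= mdist p q.
  apply: local_lipschitz => p d /H[k k1 [eps eps0 He]]; exists eps => // h h1.
  rewrite He// addrAC subrr add0r normrM (gtr0_norm (x := h)); last by lra.
  by rewrite -[leRHS]mul1r ler_wpM2r//; [lra|rewrite -intr_norm lerz1].
split=> //; split; first exact: mdist_lipschitz_continuous.
move=> e; have l0 := len_gt0 e.
pose lin a b := exists k : int, forall x, a <= x <= b ->
        f (edge_pt e x) = f (edge_pt e a) + k%:~R * (x - a).
apply: (interval_ind (Q := fun s t => exists2 B : set R, finite_set B & forall a b,
   s <= a -> a < b -> b <= t -> (forall x, a < x < b -> ~ B x) -> lin a b)) => [|z ze|s t u s0 st tu ul].
- exact: ltW.
- have [|eps eps0 He] := edge_germ _ ze (P := fun p d h => exists2 k, outgoing_slope f p d = k & f (shift_pt p d h) = f p + k%:~R * h).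
    move=> p d /H[k k1 fk]; have := germ_outgoing_slope fk; case: fk => eps eps0 He kE.
    by exists eps => // h h1; exists k => //; exact: He.
  have He1 x : z <= x <= len e -> x < z + eps -> f (edge_pt e x) = f (edge_pt e z) + (outgoing_slope f (edge_pt e z) (e, true))%:~R * (x - z).
    move=> zx xe; have [->|xz] := eqVneq x z; first by rewrite subrr mulr0 addr0.
    have hx : 0 < x - z < eps by rewrite subr_gt0 lt_neqAle eq_sym xz; lra.
    have [|[k -> <-] ->] := (He _ hx).1; first by lra.
    by rewrite addrC subrK.
  have He2 x : 0 <= x <= z -> z - eps < x -> f (edge_pt e x) = f (edge_pt e z) + (outgoing_slope f (edge_pt e z) (e, false))%:~R * (z - x).
    move=> zx xe; have [->|xz] := eqVneq x z; first by rewrite subrr mulr0 addr0.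
    have hx : 0 < z - x < eps by rewrite subr_gt0 lt_neqAle xz; lra.
    have [|[k -> <-] ->] := (He _ hx).2; first by lra.
    by rewrite subKr.
  exists eps => // s t s0 sz zt tl zs tz; exists [set z]; first exact: finite_set1.
  move=> a b sa ab bt noB; have [za|az] := leP z a.
    exists (outgoing_slope f (edge_pt e z) (e, true)) => x x1.
    rewrite (He1 x) ?(He1 a); [ring|lra..].
  have bz : b <= z.
    by rewrite leNgt; apply/negP => zb; apply: (noB z) => //; rewrite az zb.
  exists (- outgoing_slope f (edge_pt e z) (e, false)) => x x1.
  rewrite (He2 x) ?(He2 a); [rewrite mulrNz; ring|lra..].
- move=> [B1 fB1 H1] [B2 fB2 H2]; exists (B1 `|` B2 `|` [set t]).
    by rewrite !finite_setU; do !split => //; exact: finite_set1.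
  move=> a b sa ab bu noB; have [bt|tb] := leP b t.
    by apply: H1 => // x /noB; apply: contra_not; left; left.
  have [ta|at_] := leP t a; first by apply: H2 => // x /noB; apply: contra_not; left; right.
  by case: (noB t); [rewrite at_ tb|right].
Qed.

Lemma dpos_in p d : dir_at p d -> 0 <= dpos p d <= len d.1.
Proof.
move=> pd; have := arm_in pd (h := 0); rewrite addr0 subr0 if_same; apply.
by rewrite lexx ltW// arm_length_gt0.
Qed.

(** A finite set of break points leaves a gap next to the position of [p], where a single linear
    piece applies; towards [src] its slope is read backwards, whence the sign. *)
Lemma rational_germ (f : Gamma -> R) p d : rational_function f -> dir_at p d ->
  germ f p d (outgoing_slope f p d).
Proof.
move=> [_ /(_ d.1)[B fB HB]] pd.
suff [k fk] : exists k, germ f p d k by rewrite (germ_outgoing_slope fk).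
have [e1 e10 He1] := finite_set_gap (dpos p d) fB.
have a0 := arm_length_gt0 pd.
pose eps := Num.min e1 (arm_length p d).
have eps0 : 0 < eps by rewrite lt_min e10.
have [epse epsa] : eps <= e1 /\ eps <= arm_length p d by rewrite !ge_min !lexx ?orbT.
have fp : f p = f (edge_pt d.1 (dpos p d)).
  by rewrite -{1}(shift_pt0 pd) shift_ptE addr0 subr0 if_same.
case: d pd {HB} (HB) fp He1 a0 eps eps0 epse epsa => e [] pd HB fp He1 a0 eps eps0 epse epsa;
  rewrite /arm_length/= in epsa a0 fp *.
- have posb : 0 <= dpos p (e, true).
    by have /andP[] := dpos_in pd.
  have [||||k Hk] := HB (dpos p (e, true)) (dpos p (e, true) + eps) => //; [lra..| |].
    move=> x x1 Bx; have := He1 x Bx; rewrite gtr0_norm; lra.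
  exists k; exists eps => // h h1; rewrite shift_ptE /= Hk; last by lra.
  by rewrite fp [_ + h - _]addrAC subrr add0r.
- have posb : dpos p (e, false) <= len e.
    by have /andP[] := dpos_in pd.
  have [||||k Hk] := HB (dpos p (e, false) - eps) (dpos p (e, false)) => //; [lra..| |].
    move=> x x1 Bx; have := He1 x Bx; rewrite ltr0_norm; lra.
  exists (- k); exists eps => // h h1; rewrite shift_ptE /= Hk; last by lra.
  by rewrite fp (Hk (dpos p (e, false))) ?mulrNz; [ring|lra].
Qed.

End Germs.

(** * Open arcs *)

(** [lra] in a context stripped of quantified hypotheses; a goal that is not arithmetic is proved by
    contradiction from the numerical ones. *)
Ltac slra :=
  repeat match goal with H : forall _, _ |- _ => clear H end;
  lazymatch goal with
  | |- @eq (realization _) _ _ => exfalso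
  | |- @eq (Finite.sort _) _ _ => exfalso
  | |- @eq _ _ _ => idtac
  | |- is_true _ => idtac
  | |- _ -> _ => idtac
  | |- _ /\ _ => idtac
  | |- _ \/ _ => idtac
  | |- _ => exfalso
  end; lra.

Lemma exists_small (R : realFieldType) (a b c : R) : 0 < a -> 0 < b -> 0 < c ->
  exists x, [/\ 0 < x, x < a, x < b & x < c].
Proof.
move=> a0 b0 c0; pose m := Num.min a (Num.min b c).
have m0 : 0 < m by rewrite !lt_min a0 b0.
have [ma [mb mc]] : m <= a /\ m <= b /\ m <= c by rewrite !ge_min !lexx ?orbT.
by exists (m / 2); split; lra.
Qed.

Section Arcs.
Context {R : realType} (G : metric_graph R).
Local Notation Gamma := (realization G).
Implicit Types (p q w : Gamma) (d : direction G) (g j : R -> Gamma) (l h : R) (W : set Gamma).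

Definition local_isometry (a b : R) (j : R -> Gamma) : Prop :=
  forall t, a < t < b -> exists2 e : R, 0 < e & forall s s', `|s - t| < e -> `|s' - t| < e ->
       mdist (j s) (j s') = `|s - s'|.

(** Near [x], polarization of the three preserved distances gives [(f y - f x) * (f y1 - f x) = (y -
    x) * (y1 - x)], so the slope is 1 or -1 there. Overlapping neighbourhoods have the same sign,
    which [interval_ind] propagates. *)
Lemma affine_of_local_isometry (a b : R) (f : R -> R) : a < b ->
  (forall x, a < x < b -> exists2 e : R, 0 < e & forall y y', `|y - x| < e -> `|y' - x| < e ->
     `|f y - f y'| = `|y - y'|) ->
  exists (sg : bool) (c : R), forall y, a < y < b -> f y = c + (if sg then y else - y).
Proof.
move=> ab H; pose sgn (b : bool) (x : R) := if b then x else - x.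
have L x : a < x < b -> exists (sg : bool) (e : R), 0 < e /\ forall y, `|y - x| < e -> f y = f x + sgn sg (y - x).
  move=> /H[e e0 He]; pose y1 := x + e / 2.
  have e1x : y1 - x = e / 2 by rewrite /y1; ring.
  have y1e : `|y1 - x| < e by rewrite e1x gtr0_norm; slra.
  have xe : `|x - x| < e by rewrite subrr normr0.
  have sq (u v : R) : `|u| = `|v| -> u ^+ 2 = v ^+ 2.
    by move=> uv; rewrite -(real_normK (num_real u)) uv real_normK ?num_real.
  exists (0 <= f y1 - f x), e; split => // y ye.
  have f1 := He _ _ y1e xe.
  have f2 := sq _ _ (He _ _ ye xe); have f3 := sq _ _ (He _ _ ye y1e).
  have f4 : (f y - f x) * (f y1 - f x) = (y - x) * (e / 2).
    have f5 := sq _ _ f1; rewrite e1x in f5.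
    have E : y - y1 = y - x - e / 2 by rewrite /y1; ring.
    by rewrite E in f3; slra.
  rewrite e1x (gtr0_norm (x := e / 2)) in f1; last by slra.
  have e2 : e / 2 != 0 by rewrite lt0r_neq0//; slra.
  move: f1 f4; rewrite /sgn; have [f0|f0] := leP 0 (f y1 - f x).
    by rewrite (ger0_norm f0) => -> /(mulIf e2); slra.
  rewrite (ltr0_norm f0) => f1; rewrite (_ : f y1 - f x = - (e / 2)); last by slra.
  by rewrite mulrN -mulNr => /(mulIf e2); slra.
have same (b1 b2 : bool) (x : R) : 0 < x -> sgn b1 x = sgn b2 x -> b1 = b2.
  by case: b1; case: b2 => //= x0; rewrite /sgn; slra.
pose Q u v := exists (sg : bool) (e : R), 0 < e /\ forall y, u - e < y < v + e -> f y = f u + sgn sg (y - u).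
have HQ u v : a < u -> u <= v -> v < b -> Q u v.
  move=> au uv vb; apply: (interval_ind (Q := Q)) => // [x xuv|s t w us st tw wv].
    have [|sg [e [e0 He]]] := L x; first by slra.
    exists (e / 2); first by slra.
    move=> s t us sx xt tv xs tx; exists sg, (e / 2); split; first by slra.
    move=> y y1; rewrite (He y) ?(He s) ?ltr_distl; [|slra..].
    by rewrite /sgn; case: (sg); slra.
  move=> [s1 [e1 [e10 H1]]] [s2 [e2 [e20 H2]]].
  have ss : s1 = s2.
    pose x := Num.min e1 e2 / 2; have x0 : 0 < x by rewrite divr_gt0// lt_min e10.
    have [xe1 xe2] : x < e1 /\ x < e2.
      by rewrite /x /Num.min; case: ifPn => //; rewrite -?leNgt; slra.
    apply: (same _ _ x) => //; have := H1 (t + x); have := H2 (t + x); have := H1 t.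
    by rewrite /sgn; case: (s1); case: (s2); slra.
  subst s2; exists s1, (Num.min e1 e2); split; first by rewrite lt_min e10.
  move=> y y1; have [xe1 xe2] : s - e1 < y /\ y < w + e2.
    by move: y1; rewrite /Num.min; case: ifPn => //; rewrite -?leNgt; slra.
  have [yt|ty] := leP y t; first by apply: H1; slra.
  rewrite H2 ?(H1 t); [|slra..].
  by rewrite /sgn; case: (s1); slra.
pose m := (a + b) / 2; have [sg [e [e0 He]]] := L m ltac:(rewrite /m; slra).
exists sg, (f m - sgn sg m) => y yab; have [my|ym] := leP m y.
  have [s1 [e1 [e10 H1]]] := HQ m y ltac:(rewrite /m; slra) my ltac:(slra).
  have ss : s1 = sg.
    pose x := Num.min e e1 / 2; have x0 : 0 < x by rewrite divr_gt0// lt_min e0.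
    have [xe1 xe2] : x < e /\ x < e1.
      by rewrite /x /Num.min; case: ifPn => //; rewrite -?leNgt; slra.
    apply: (same _ _ x) => //; have := H1 (m + x); have := He (m + x).
    rewrite addrAC subrr add0r gtr0_norm// => /(_ xe1) -> /(_ _); move=> h.
    by have := h ltac:(slra); rewrite /sgn; case: (s1); case: (sg); slra.
  by rewrite H1 ?ss /sgn; [case: (sg); slra|slra].
have [s1 [e1 [e10 H1]]] := HQ y m ltac:(slra) (ltW ym) ltac:(rewrite /m; slra).
have ss : s1 = sg.
  pose x := Num.min e e1 / 2; have x0 : 0 < x by rewrite divr_gt0// lt_min e0.
  have [xe1 xe2] : x < e /\ x < e1.
    by rewrite /x /Num.min; case: ifPn => //; rewrite -?leNgt; slra.
  apply: (same _ _ x) => //; have := H1 (m + x); have := H1 m; have := He (m + x).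
  rewrite addrAC subrr add0r gtr0_norm// => /(_ xe1) -> /(_ _) h1 /(_ _) h2.
  by have {}h1 := h1 ltac:(slra); have {}h2 := h2 ltac:(slra); move: h1 h2; rewrite /sgn; case: (s1); case: (sg); slra.
have := H1 m ltac:(slra); rewrite ss /sgn; case: (sg); slra.
Qed.

Lemma open_arc_inj l g s t : open_arc l g -> 0 < s < l -> 0 < t < l -> g s = g t -> s = t.
Proof.
move=> [l0 H] sl tl gst; apply/eqP; rewrite -subr_eq0 -normr_le0 leNgt; apply/negP => e0.
have [_ /(_ _ e0)[d d0 /(_ s sl)]] := H t tl.
by rewrite gst mdistxx ltxx => /(_ d0).
Qed.

Lemma open_arc_local_isometry l g : open_arc l g -> local_isometry 0 l g.
Proof. by move=> [l0 H] t /H[]. Qed.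

Lemma local_isometry_lip a b j s t : local_isometry a b j -> a < s < b -> a < t < b ->
  mdist (j s) (j t) <= `|s - t|.
Proof.
move=> H; wlog st : s t / s <= t.
  move=> W sab tab; have [st|/ltW ts] := leP s t; first exact: W.
  by rewrite metric_sym distrC; exact: W.
move=> sab tab; rewrite distrC ger0_norm ?subr_ge0//.
apply: (interval_ind (Q := fun s t => mdist (j s) (j t) <= t - s)) => // [x xst|x y z _ xy yz _ h1 h2].
  have [|e e0 He] := H x; first by slra.
  exists e => // u v su ux xv vt xu vx.
  rewrite He; [|rewrite ltr_distl; slra..].
  by rewrite distrC ger0_norm; slra.
by have := metric_triangle (j x) (j y) (j z); slra.
Qed.

Definition arc_inv l g p : R := xget 0 [set s | 0 < s < l /\ g s = p].

Lemma arc_invP l g p : arc_set l g p -> 0 < arc_inv l g p < l /\ g (arc_inv l g p) = p.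
Proof.
move=> [s /=]; rewrite in_itv/= => sl gs.
by apply: (xgetI 0 (P := [set s | 0 < s < l /\ g s = p])); exact: (conj sl gs).
Qed.

(** [g] is a local isometry and a homeomorphism onto its image, so the coordinate change from [j] to
    [g] is a local isometry between real intervals, hence affine. Every later comparison of two
    parametrizations rests on this. *)
Lemma arc_transition l g a b j : open_arc l g -> a < b -> local_isometry a b j ->
  (forall t, a < t < b -> arc_set l g (j t)) ->
  exists (sg : bool) (c : R), forall t, a < t < b ->
    0 < c + (if sg then t else - t) < l /\ j t = g (c + (if sg then t else - t)).
Proof.
move=> ag ab lj H; pose s t := arc_inv l g (j t).
have [sl gs] : (forall t, a < t < b -> 0 < s t < l) /\ (forall t, a < t < b -> g (s t) = j t).
  by split=> t /H /arc_invP[].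
have [|sg [c Hc]] := @affine_of_local_isometry a b s ab.
  move=> x xab; have [e2 e20 H2] := lj x xab.
  have [[e1 e10 H1] /(_ e1 e10)[d d0 Hd]] := ag.2 _ (sl x xab).
  pose e := Num.min (Num.min e2 d) (Num.min (x - a) (b - x)).
  have [[ee2 ed] [ea eb]] : (e <= e2 /\ e <= d) /\ (e <= x - a /\ e <= b - x).
    by rewrite /e !ge_min !lexx ?orbT.
  exists e; first by rewrite !lt_min e20 d0 !subr_gt0.
  have near_s y : `|y - x| < e -> a < y < b /\ `|s y - s x| < e1.
    move=> yx; have yab : a < y < b by rewrite ltr_distl in yx; slra.
    split=> //; apply: Hd; first exact: sl.
    by rewrite !gs// H2 ?subrr ?normr0 ?(distrC x) //; slra.
  move=> y y' yx y'x; have [yab sy] := near_s y yx; have [y'ab sy'] := near_s y' y'x.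
  by rewrite -H1// !gs// H2//; [exact: lt_le_trans ee2..].
exists sg, c => t tab; rewrite -Hc//; split; first exact: sl.
by rewrite gs.
Qed.

Definition lim0 g p : Prop :=
  forall e : R, 0 < e -> exists2 dl : R, 0 < dl & forall t, 0 < t < dl -> mdist p (g t) < e.

Lemma lim0_unique g p q : lim0 g p -> lim0 g q -> p = q.
Proof.
move=> gp gq; apply/eqP; rewrite -[_ == _]negbK -mdist_gt0; apply/negP => pq.
have h : 0 < mdist p q / 2 by slra.
have [d1 d10 H1] := gp _ h; have [d2 d20 H2] := gq _ h.
pose x := Num.min d1 d2 / 2; have x0 : 0 < x by rewrite divr_gt0// lt_min d10.
have [x1 x2] : x < d1 /\ x < d2.
  by rewrite /x /Num.min; case: ifPn => //; rewrite -?leNgt; slra.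
have := H1 x; have := H2 x; have := metric_triangle p (g x) q.
rewrite (metric_sym q) x0 x1 x2 => h3 /(_ isT) h4 /(_ isT); slra.
Qed.

(** Compactness gives a cluster point at 0, and the Lipschitz bound makes it a limit. *)
Lemma lim0_ex l g : open_arc l g -> exists p, lim0 g p.
Proof.
move=> ag; have l0 := ag.1; have lip := local_isometry_lip (open_arc_local_isometry ag).
have [|p [_ Hp]] := @Gamma_compact R G (g x @[x --> 0^'+]) _; first exact: filterT.
exists p => e e0.
have eh : 0 < Num.min l (e / 2) by rewrite lt_min l0 divr_gt0.
have nb : nbhs p [set q | mdist p q < e / 2].
  by apply/nbhs_mdist; exists (e / 2) => //; rewrite divr_gt0.
have [|q [[s /= sl <-] ps]] := Hp (g @` [set s | 0 < s < Num.min l (e / 2)]) _ _ nb.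
  suff : \forall x \near (0 : R)^'+, (g @` [set s | 0 < s < Num.min l (e / 2)]) (g x) by [].
  near=> x; exists x => //=; apply/andP; split; near: x.
    exact: nbhs_right_gt.
  exact: nbhs_right_lt.
exists (Num.min l (e / 2)) => // t tl; rewrite !lt_min in sl tl.
have := lip s t ltac:(slra) ltac:(slra); have := metric_triangle p (g s) (g t).
have : `|s - t| < e / 2 by rewrite ltr_norml; slra.
rewrite /= in ps; slra.
Unshelve. all: by end_near. Qed.

Lemma arc_rev l g : open_arc l g -> open_arc l (fun t => g (l - t)).
Proof.
move=> [l0 H]; split=> // t tl; have [|[e e0 He] H2] := H (l - t); first by slra.
split.
  exists e => // s s' st s't; rewrite He; first by rewrite distrC; congr `|_|; ring.
    by rewrite (_ : l - s - _ = t - s); [rewrite distrC|ring].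
  by rewrite (_ : l - s' - _ = t - s'); [rewrite distrC|ring].
move=> e' /H2[d d0 Hd]; exists d => // s sl gts.
have := Hd (l - s) ltac:(slra) gts.
by rewrite (_ : l - s - _ = t - s); [rewrite distrC|ring].
Qed.

Lemma arc_set_rev l g : arc_set l (fun t => g (l - t)) = arc_set l g.
Proof.
apply/seteqP; split=> _ [t /= + <-]; rewrite in_itv/= => tl.
  by exists (l - t) => //=; rewrite in_itv/=; slra.
by exists (l - t); rewrite /= ?in_itv/= ?subKr//; slra.
Qed.

Lemma open_arc_ext l g j : (forall t, 0 < t < l -> g t = j t) -> open_arc l g -> open_arc l j.
Proof.
move=> gj [l0 H]; split=> // t tl; have [[e e0 He] H2] := H t tl; split.
  pose e' := Num.min e (Num.min t (l - t)).
  have [ee [et el]] : e' <= e /\ e' <= t /\ e' <= l - t by rewrite !ge_min !lexx ?orbT.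
  exists e'; first by rewrite !lt_min e0; slra.
  move=> s s' st s't; rewrite -!gj; first by apply: He; slra.
    by rewrite ltr_distl in s't; slra.
  by rewrite ltr_distl in st; slra.
move=> e' /H2[d d0 Hd]; exists d => // s sl; rewrite -!gj//; exact: Hd.
Qed.

Lemma arc_set_ext l g j : (forall t, 0 < t < l -> g t = j t) -> arc_set l g = arc_set l j.
Proof.
move=> gj; apply/seteqP; split=> _ [t /= tl <-]; exists t => //=; rewrite ?gj//;
by move: tl; rewrite in_itv.
Qed.

Lemma arc_sub l g a b : open_arc l g -> 0 <= a -> a < b -> b <= l ->
  open_arc (b - a) (fun t => g (a + t)).
Proof.
move=> [l0 H] a0 ab bl; split; first by slra.
move=> t tl; have [|[e e0 He] H2] := H (a + t); first by slra.
have E x y : a + x - (a + y) = x - y by ring.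
split; first by exists e => // s s' st s't; rewrite He ?E.
move=> e' /H2[d d0 Hd]; exists d => // s sl gts.
by have := Hd (a + s) ltac:(slra) gts; rewrite E.
Qed.

Lemma arc_sub_rev l g a b : open_arc l g -> 0 <= a -> a < b -> b <= l ->
  open_arc (b - a) (fun t => g (b - t)).
Proof.
move=> ag a0 ab bl; apply: open_arc_ext (arc_rev (arc_sub ag a0 ab bl)) => t _.
by congr g; ring.
Qed.

Lemma arm_arc p d (r : R) : dir_at p d -> 0 < r <= rad p -> open_arc r (shift_pt p d).
Proof.
move=> pd rr; split; first by slra.
move=> t tr; split.
  pose e := Num.min t (r - t); have [et er] : e <= t /\ e <= r - t by rewrite !ge_min !lexx ?orbT.
  exists e; first by rewrite lt_min; slra.
  by move=> s s'; rewrite !ltr_distl => st s't; rewrite mdist_shift_same//; slra.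
move=> e e0; exists e => // s sr; rewrite mdist_shift_same//; [by rewrite distrC|slra..].
Qed.

Lemma arm_eq p d d' h h' : dir_at p d -> dir_at p d' -> 0 < h <= rad p -> 0 < h' <= rad p ->
  shift_pt p d h = shift_pt p d' h' -> d = d' /\ h = h'.
Proof.
move=> pd pd' hr hr' E; have := mdistxx (shift_pt p d h); rewrite {2}E.
have [<-|dd] := eqVneq d d'.
  by rewrite mdist_shift_same//; [move=> /normr0_eq0 ?; split=> //; slra|slra..].
by rewrite mdist_shift_diff//; slra.
Qed.

(** Close to 0 the arc runs in the star of [p] without meeting [p]. It cannot jump between arms,
    since points at heights [h] and [h'] on different arms are [h + h'] apart. On a single arm
    [arc_transition] leaves an offset [c], which the limit [p] forces to be 0. *)
Lemma arc_end_germ l g p : open_arc l g -> lim0 g p ->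
  exists2 d, dir_at p d & exists2 eps : R, 0 < eps & forall t, 0 < t < eps -> g t = shift_pt p d t.
Proof.
move=> ag gp; have l0 := ag.1; have r0 := rad_gt0 p.
have [d1 d10 H1] := gp _ r0.
(* By injectivity the arc passes through [p] at most once, hence not at all close to 0. *)
have [d2 d20 H2] : exists2 d2 : R, 0 < d2 & forall t, 0 < t < d2 -> t < l -> g t <> p.
  have [[t [tl gt]]|no] := pselect (exists t, 0 < t < l /\ g t = p).
    exists t; first by slra.
    move=> s st sl gs; suff : s = t by slra.
    by apply: (open_arc_inj ag); [slra|slra|rewrite gs gt].
  by exists 1 => // t t1 tl gt; apply: no; exists t; split => //; slra.
pose dl := Num.min l (Num.min d1 d2).
have [dll [dl1 dl2]] : dl <= l /\ dl <= d1 /\ dl <= d2 by rewrite !ge_min !lexx ?orbT.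
have dl0 : 0 < dl by rewrite !lt_min l0 d10.
pose arm d q := exists h, 0 < h < rad p /\ q = shift_pt p d h.
have Harm t : 0 < t < dl -> exists d, dir_at p d /\ arm d (g t).
  move=> tl; have ptr : mdist p (g t) < rad p by apply: H1; slra.
  have gtp : g t <> p by apply: H2; slra.
  have [d [pd gE]] := star_ball ptr gtp; exists d; split=> //.
  by exists (mdist p (g t)); split=> //; rewrite ptr mdist_gt0 eq_sym andbT; exact/eqP.
have [|d [pd ad]] := Harm (dl / 2); first by slra.
have lg := open_arc_local_isometry ag.
have Q s t : 0 < s -> s <= t -> t < dl -> forall d, dir_at p d -> arm d (g s) <-> arm d (g t).
  move=> s0 st tdl; apply: (interval_ind (Q := fun s t => forall d, dir_at p d -> arm d (g s) <-> arm d (g t))) => // [x xst|a b c _ _ _ _ h1 h2 d' pd'].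
    have [|dx [pdx [h [hr gx]]]] := Harm x; first by slra.
    have [|e e0 He] := lg x; first by slra.
    exists (Num.min e h); first by rewrite lt_min e0; slra.
    move=> u v su ux xv vt xu vx d' pd'.
    have key y : s <= y <= t -> `|y - x| < Num.min e h -> arm dx (g y).
      rewrite lt_min => yst /andP[ye yh]; have [|dy [pdy [h' [hr' gy]]]] := Harm y; first by slra.
      have [<-|dd] := eqVneq dy dx; first by exists h'.
      have := He y x ye; rewrite subrr normr0 => /(_ e0).
      by rewrite gy gx mdist_shift_diff//; slra.
    have [eu ev] : `|u - x| < Num.min e h /\ `|v - x| < Num.min e h.
      by rewrite !ltr_distl; slra.
    have [au av] := (key u ltac:(slra) eu, key v ltac:(slra) ev).
    have un q : arm dx q -> arm d' q -> d' = dx.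
      move=> [h1 [h1r ->]] [h2 [h2r /esym E]].
      by have [||->] := arm_eq pd' pdx _ _ E; [slra|slra|].
    by split=> [/(un _ au) ->|/(un _ av) ->].
  exact: iff_trans (h1 _ pd') (h2 _ pd').
have ar t : 0 < t < dl -> arm d (g t).
  move=> tdl; have [tm|/ltW mt] := leP t (dl / 2).
    by apply/(Q t (dl / 2)) => //; slra.
  by apply/(Q (dl / 2) t) => //; slra.
have aarm : open_arc (rad p) (shift_pt p d) by apply: arm_arc => //; slra.
have [|t tdl|sg [c Hc]] := @arc_transition _ _ 0 dl g aarm dl0.
- by move=> t tdl; apply: lg; slra.
- by have [h [hr ->]] := ar t tdl; exists h => //=; rewrite in_itv.
have E t : 0 < t < dl -> mdist p (g t) = c + (if sg then t else - t).
  by move=> /Hc[h1 ->]; rewrite mdist_shift//; slra.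
have c0 : c = 0.
  have [c0|c0|//] := ltgtP c 0.
    have [|x [x0 x1 x2 _]] := exists_small dl0 (b := - c) _ dl0; first by slra.
    by have [+ _] := Hc x ltac:(slra); case: (sg); slra.
  have [|d3 d30 H3] := gp (c / 2); first by slra.
  have [|x [x0 x1 x2 x3]] := exists_small dl0 d30 (c := c / 2); first by slra.
  by have := H3 x ltac:(slra); rewrite E; [case: (sg)|]; slra.
exists d => //; exists dl => // t tdl; have [h1 ->] := Hc t tdl; rewrite c0 add0r in h1 *.
by case: (sg) h1 => // h1; slra.
Qed.

Lemma arc_interior_germ l g t : open_arc l g -> 0 < t < l ->
  exists d1 d2, [/\ dir_at (g t) d1, dir_at (g t) d2, d1 <> d2 &
  exists2 eps : R, 0 < eps & forall h, 0 < h < eps ->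
    g (t + h) = shift_pt (g t) d1 h /\ g (t - h) = shift_pt (g t) d2 h].
Proof.
move=> ag tl; have lip := local_isometry_lip (open_arc_local_isometry ag).
have [||d1 pd1 [e1 e10 H1]] := @arc_end_germ (l - t) (fun h => g (t + h)) (g t).
- by apply: (arc_sub ag); slra.
- move=> e e0; exists (Num.min e (l - t)); first by rewrite lt_min e0; slra.
  move=> s; rewrite lt_min => sl; apply: le_lt_trans (lip _ _ _ _) _; [slra..|].
  by rewrite distrC ger0_norm; slra.
have [||d2 pd2 [e2 e20 H2]] := @arc_end_germ t (fun h => g (t - h)) (g t).
- by have := arc_sub_rev (a := 0) (b := t) ag; rewrite subr0; apply; slra.
- move=> e e0; exists (Num.min e t); first by rewrite lt_min e0; slra.
  move=> s; rewrite lt_min => sl; apply: le_lt_trans (lip _ _ _ _) _; [slra..|].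
  by rewrite ger0_norm; slra.
pose e := Num.min (Num.min e1 e2) (Num.min t (l - t)).
have e0 : 0 < e by rewrite !lt_min e10 e20; slra.
have [[ee1 ee2] [et el]] : (e <= e1 /\ e <= e2) /\ (e <= t /\ e <= l - t) by rewrite !ge_min !lexx ?orbT.
exists d1, d2; split=> //; last first.
  by exists e => // h he; rewrite H1 ?H2//; slra.
move=> dd; have he : 0 < e / 2 by slra.
suff : t + e / 2 = t - e / 2 by slra.
apply: (open_arc_inj ag); [slra|slra|].
by rewrite H1 ?H2 ?dd//; slra.
Qed.

End Arcs.

(** * Segments between marked points *)

Section Rays.
Context {R : realType} (G : metric_graph R).
Local Notation Gamma := (realization G).
Implicit Types (p q w : Gamma) (d : direction G) (g j : R -> Gamma) (l h : R) (W : set Gamma).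

Lemma finite_points_gap W p : finite_set W ->
  exists2 eps : R, 0 < eps & forall q, W q -> q <> p -> eps <= mdist p q.
Proof.
move=> /finite_seqP[s ->]; elim: s => [|y s [e e0 IH]]; first by exists 1.
have [yp|yp] := eqVneq y p.
  by exists e => // q; rewrite /= inE => /orP[/eqP ->|]; [rewrite yp|exact: IH].
exists (Num.min e (mdist p y)); first by rewrite lt_min e0 mdist_gt0 eq_sym.
move=> x; rewrite /= inE => /orP[/eqP -> _|xs xp]; first by rewrite ge_min lexx orbT.
by rewrite ge_min IH.
Qed.

Lemma finite_setC_open W : finite_set W -> open (~` W).
Proof.
move=> fW; rewrite openE => p Wp; have [e e0 He] := finite_points_gap p fW.
apply/nbhs_mdist; exists e => // q pq Wq; have := He q Wq; rewrite leNgt pq => H.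
by have := H (fun qp => Wp (eq_ind q W Wq p qp)).
Qed.

Lemma shift_avoid W w : finite_set W -> exists2 eps : R, 0 < eps <= rad w &
  forall d h, dir_at w d -> 0 < h < eps -> ~ W (shift_pt w d h).
Proof.
move=> fW; have [e e0 He] := finite_points_gap w fW; have r0 := rad_gt0 w.
exists (Num.min e (rad w)); first by rewrite lt_min e0 r0 ge_min lexx orbT.
move=> d h wd; rewrite lt_min => h1 Wh; have hr : 0 <= h <= rad w by slra.
have := He _ Wh; rewrite mdist_shift// => H.
suff : e <= h by slra.
by apply: H => E; have := mdist_shift wd hr; rewrite E mdistxx; slra.
Qed.

Lemma connected_split (T : topologicalType) (Q A B : set T) : connected Q -> open A -> open B ->
  Q `<=` A `|` B -> Q `&` A `&` B = set0 -> (Q `&` A) !=set0 -> Q `<=` A.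
Proof.
move=> cQ oA oB QAB QAB0 QA0.
suff <- : Q `&` A = Q by move=> x [].
apply: cQ => //; first by exists A.
exists (~` B); first exact: open_closedC.
apply/seteqP; split=> x [Qx xA]; split=> //.
  by move=> Bx; have : (Q `&` A `&` B) x by []; rewrite QAB0.
by case: (QAB x Qx).
Qed.

Lemma component_mono (T : topologicalType) (A B : set T) (p : T) : A `<=` B ->
  connected_component A p `<=` connected_component B p.
Proof.
move=> AB; have [Ap|Ap] := pselect (A p); last by rewrite connected_component_out.
apply: connected_component_max; last exact: component_connected.
  exact: connected_component_refl.
by move=> x /connected_component_sub /AB.
Qed.

(** The form in which a marking is carried along: it is stable under adding finitely many points,
    and both [v0] and the points of [S] have to become marked. *)
Definition arc_decomp W : Prop := finite_set W /\ forall p, ~ W p ->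
  exists l g, open_arc l g /\ connected_component (~` W) p = arc_set l g.

Lemma vertex_set_arc_decomp W : vertex_set W -> arc_decomp W.
Proof. by move=> [_ fW H]; split=> // p /H[[l [g Hg]] _]; exists l, g. Qed.

Lemma arc_sub_open l g a b : open (arc_set l g) -> open_arc l g -> 0 <= a -> b <= l ->
  open (g @` `]a, b[).
Proof.
move=> oA ag a0 bl; rewrite openE => _ [t /= + <-]; rewrite in_itv/= => tab.
have tl : 0 < t < l by slra.
have [e1 e10 H1] : exists2 e : R, 0 < e & forall q, mdist (g t) q < e -> arc_set l g q.
  by apply/nbhs_mdist; move: oA; rewrite openE; apply; exists t => //=; rewrite in_itv.
have [_ /(_ (Num.min (t - a) (b - t)))[|d d0 Hd]] := ag.2 t tl; first by rewrite lt_min; slra.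
apply/nbhs_mdist; exists (Num.min e1 d); first by rewrite lt_min e10.
move=> q; rewrite lt_min => /andP[/H1[s /= + <-]]; rewrite in_itv/= => sl /(Hd s sl).
rewrite lt_min !ltr_distl => st; exists s => //=; rewrite in_itv/=; slra.
Qed.

Lemma arc_connected l g a b : open_arc l g -> 0 <= a -> b <= l -> connected (g @` `]a, b[).
Proof.
move=> ag a0 bl; apply: lipschitz_itv_connected => s t; rewrite !in_itv/= => s1 t1.
by apply: (local_isometry_lip (open_arc_local_isometry ag)); slra.
Qed.

Lemma component_open_arc W p l g : finite_set W -> connected_component (~` W) p = arc_set l g ->
  open (arc_set l g).
Proof. by move=> fW <-; apply: component_open; exact: finite_setC_open. Qed.

(** The part of the arc beyond [q] is a second open piece, disjoint from the first. A connected set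
    that contains [p] and avoids [q] therefore stays in the first one. *)
Lemma component_split W p q l g tp tq : finite_set W -> open_arc l g ->
  connected_component (~` W) p = arc_set l g -> 0 < tp -> tp < tq -> tq < l ->
  g tp = p -> g tq = q -> connected_component (~` (W `|` [set q])) p = arc_set tq g.
Proof.
move=> fW ag Cp tp0 tpq tql gp gq; have oC := component_open_arc fW Cp.
have Wp : (~` W) p.
  apply: contrapT => Wp; have := connected_component_out Wp; rewrite Cp => E.
  suff : arc_set l g p by rewrite E.
  by exists tp => //=; rewrite in_itv/=; slra.
have sub : arc_set tq g `<=` ~` (W `|` [set q]).
  move=> _ [s /= + <-]; rewrite in_itv/= => sq [].
    suff : connected_component (~` W) p (g s) by move=> /connected_component_sub.
    by rewrite Cp; exists s => //=; rewrite in_itv/=; slra.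
  by rewrite -gq => /(open_arc_inj ag) E; have := E ltac:(slra) ltac:(slra); slra.
apply/seteqP; split; last first.
  apply: connected_component_max => //; last by apply: (arc_connected ag); slra.
  by exists tp => //=; rewrite in_itv/=; slra.
have sp : (~` (W `|` [set q])) p.
  by apply: sub; exists tp => //=; rewrite in_itv/=; slra.
apply: (connected_split (B := g @` `]tq, l[)).
- exact: component_connected.
- by apply: (arc_sub_open oC ag); slra.
- by apply: (arc_sub_open oC ag); slra.
- move=> x /[dup] /connected_component_sub Wx Cx.
  have : connected_component (~` W) p x.
    by apply: component_mono Cx => y; apply: contra_not; left.
  rewrite Cp => -[s /= + E]; rewrite in_itv/= => sl.
  have [sq|sq|sq] := ltgtP s tq.
  + by left; exists s => //=; rewrite in_itv/= sq; slra.
  + by right; exists s => //=; rewrite in_itv/= sq; slra.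
  + by case: Wx; right; rewrite /= -E sq.
- rewrite -subset0 => x [[_ [s /= + <-]] [t /= + E]]; rewrite !in_itv/= => s1 t1.
  by have := open_arc_inj ag _ _ E; move=> /(_ ltac:(slra) ltac:(slra)); slra.
- exists p; split; first exact: connected_component_refl.
  by exists tp => //=; rewrite in_itv/=; slra.
Qed.

Lemma arc_decompU1 W q : arc_decomp W -> arc_decomp (W `|` [set q]).
Proof.
move=> [fW H]; split=> [|p Wqp]; first by rewrite finite_setU; split=> //; exact: finite_set1.
have [Wp qp] : ~ W p /\ p <> q by split=> h; apply: Wqp; [left|right].
have [l [g [ag Cp]]] := H p Wp.
have Cpp : arc_set l g p by rewrite -Cp; exact: connected_component_refl.
have [Cq|Cq] := pselect (arc_set l g q); last first.
  exists l, g; split=> //; apply/seteqP; split=> [x Cx|].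
    by rewrite -Cp; apply: component_mono Cx => y; apply: contra_not; left.
  apply: connected_component_max => //; last by rewrite -Cp; exact: component_connected.
  move=> x Cx []; last by move=> xq; apply: Cq; rewrite -xq.
  by rewrite -Cp in Cx; move: Cx => /connected_component_sub.
case: Cpp => tp /=; rewrite in_itv/= => tpl gp; case: Cq => tq /=; rewrite in_itv/= => tql gq.
have [tpq|tpq|tpq] := ltgtP tp tq; last by case: qp; rewrite -gp -gq tpq.
  exists tq, g; split; last by apply: (component_split fW ag Cp _ tpq _ gp gq); slra.
  by have := arc_sub (a := 0) (b := tq) ag; rewrite subr0 => /(_ ltac:(slra) ltac:(slra) ltac:(slra)); apply: open_arc_ext => t _; rewrite add0r.
rewrite -arc_set_rev in Cp.
exists (l - tq), (fun t => g (l - t)); split; last first.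
  by apply: (component_split (tp := l - tp) fW (arc_rev ag) Cp); rewrite ?subKr//; slra.
have := arc_sub (a := 0) (b := l - tq) (arc_rev ag); rewrite subr0 => /(_ ltac:(slra) ltac:(slra) ltac:(slra)).
by apply: open_arc_ext => t _; rewrite add0r.
Qed.

Lemma arc_decompU W S : arc_decomp W -> finite_set S -> arc_decomp (W `|` S).
Proof.
move=> HW /finite_seqP[s ->]; elim: s => [|x s IH].
  by rewrite (_ : [set` [::]] = set0) ?setU0//; apply/seteqP; split.
rewrite (_ : _ `|` _ = (W `|` [set` s]) `|` [set x]); first exact: arc_decompU1.
apply/seteqP; split=> y; rewrite /= inE.
  by case=> [Wy|/orP[/eqP ->|ys]]; [left; left|right|left; right].
by case=> [[Wy|ys]|->]; [left|right; rewrite ys orbT|right; rewrite eqxx].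
Qed.

Lemma lim0_germ g p d (eps : R) : dir_at p d -> 0 < eps ->
  (forall t, 0 < t < eps -> g t = shift_pt p d t) -> lim0 g p.
Proof.
move=> pd eps0 H e e0; have r0 := rad_gt0 p.
exists (Num.min (Num.min e eps) (rad p)); first by rewrite !lt_min e0 eps0.
by move=> t; rewrite !lt_min => t1; rewrite H ?mdist_shift//; slra.
Qed.

Lemma germ_eq p q d d' (eps : R) : dir_at p d -> dir_at q d' -> 0 < eps ->
  (forall t, 0 < t < eps -> shift_pt p d t = shift_pt q d' t) -> p = q /\ d = d'.
Proof.
move=> pd qd' eps0 H.
have pq : p = q.
  apply: (@lim0_unique _ _ (shift_pt p d)); first exact: (lim0_germ pd ltr01).
  exact: lim0_germ H.
move: qd' H; rewrite -pq => pd' H; split=> //; have r0 := rad_gt0 p.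
have [x [x0 x1 x2 _]] := exists_small eps0 r0 r0.
by have [||//] := arm_eq pd pd' (h := x) (h' := x) _ _ (H x ltac:(slra)); slra.
Qed.

(** Otherwise the star of [q] would join it to the component, so [q = g s] for some [s]. Points
    [g y] with [y] close to 0 would then approach [g s], against the homeomorphism clause of
    [open_arc]. *)
Lemma component_arc_end W p l g q : arc_decomp W -> ~ W p -> open_arc l g ->
  connected_component (~` W) p = arc_set l g -> lim0 g q -> W q.
Proof.
move=> [fW _] Wp ag Cp gq; apply: contrapT => Wq.
have [d qd [e e0 He]] := arc_end_germ ag gq; have l0 := ag.1.
have [e1 e1r He1] := shift_avoid q fW.
have [|x [x0 x1 x2 x3]] := exists_small e0 (b := e1) _ l0; first by slra.
have Cq : connected_component (~` W) q (shift_pt q d x).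
  apply: component_shift => //; [slra| |]; first by have := rad_arm qd; slra.
  by move=> h' h1; apply: He1 => //; slra.
have : arc_set l g q.
  rewrite -Cp; apply: (connected_component_trans (y := g x)).
    by rewrite Cp; exists x => //=; rewrite in_itv/=; slra.
  by apply: connected_component_sym; rewrite He//; slra.
move=> [s /= + gs]; rewrite in_itv/= => sl.
have [_ /(_ (s / 2))[|d1 d10 Hd]] := ag.2 s sl; first by slra.
have [d2 d20 H2] := gq _ d10.
have [|y [y0 y1 y2 _]] := exists_small d20 (b := s / 2) _ d20; first by slra.
have := Hd y ltac:(slra); rewrite gs => /(_ (H2 y ltac:(slra))).
by rewrite ltr_distl; slra.
Qed.

(* On [0, l], [g] is an arc length parametrization of the closure of a component
   of [~` W] that leaves [w] in direction [d]. *)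
Definition ray W w d l g : Prop :=
  [/\ open_arc l g, W w /\ dir_at w d,
      exists2 eps : R, 0 < eps & forall t, 0 <= t < eps -> g t = shift_pt w d t,
      forall t, 0 < t < l -> connected_component (~` W) (g t) = arc_set l g &
      exists d', [/\ W (g l), dir_at (g l) d' &
        exists2 eps : R, 0 < eps & forall t, 0 <= t < eps -> g (l - t) = shift_pt (g l) d' t]].

Lemma ray0 W w d l g : ray W w d l g -> g 0 = w.
Proof. by move=> [_ [_ wd] [e e0 He] _ _]; rewrite He ?shift_pt0// lexx. Qed.

Lemma ray_notin W w d l g t : ray W w d l g -> 0 < t < l -> ~ W (g t).
Proof.
move=> [_ _ _ C _] /[dup] tl /C Ct Wt.
have : arc_set l g (g t) by exists t => //=; rewrite in_itv.
by rewrite -Ct connected_component_out.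
Qed.

Lemma ray_rev W w d l g : ray W w d l g -> exists d', ray W (g l) d' l (fun t => g (l - t)).
Proof.
move=> Hr; have gw := ray0 Hr; case: Hr => ag [Ww wd] [e e0 He] C [d' [Wl gd' [e' e'0 He']]].
exists d'; split=> //.
- exact: arc_rev.
- by exists e'.
- by move=> t tl; rewrite arc_set_rev; apply: C; slra.
exists d; rewrite subrr gw; split=> //; exists e => // t te; rewrite subKr; exact: He.
Qed.

Lemma ray_lip W w d l g s t : ray W w d l g -> 0 <= s <= l -> 0 <= t <= l ->
  mdist (g s) (g t) <= `|s - t|.
Proof.
move=> Hr; wlog st : s t / s <= t.
  move=> H sab tab; have [st|/ltW ts] := leP s t; first exact: H.
  by rewrite metric_sym distrC; exact: H.
move=> sl tl; rewrite distrC ger0_norm ?subr_ge0//.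
case: Hr => ag [Ww wd] [e1 e10 He1] C [d' [Wl gd' [e2 e20 He2]]].
apply: (interval_ind (Q := fun s t => mdist (g s) (g t) <= t - s)) => // [x xst|x y z _ xy yz _ h1 h2]; last first.
  by have := metric_triangle (g x) (g y) (g z); slra.
have [x0|x0] := leP x 0.
  have {x0} -> : x = 0 by slra.
  exists (Num.min e1 (rad w)); first by rewrite lt_min e10 rad_gt0.
  move=> u v su u0 v0 vt _; rewrite add0r lt_min => v1; have {u0} -> : u = 0 by slra.
  by rewrite !He1 ?shift_pt0 ?mdist_shift//; slra.
have [xl|xl] := leP l x.
  have {xl} -> : x = l by slra.
  exists (Num.min e2 (rad (g l))); first by rewrite lt_min e20 rad_gt0.
  move=> u v su u0 v0 vt; rewrite ltrBlDl -ltrBlDr lt_min => u1 _; have {v0} -> : v = l by slra.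
  have := He2 (l - u) ltac:(slra); rewrite subKr => ->.
  by rewrite metric_sym mdist_shift//; slra.
have [|e e0 He] := open_arc_local_isometry ag (t := x); first by slra.
exists e => // u v su ux xv vt xu vx.
rewrite He; [|rewrite ltr_distl; slra..].
by rewrite distrC ger0_norm; slra.
Qed.

Lemma ray_of_arc W p l g : arc_decomp W -> ~ W p -> open_arc l g ->
  connected_component (~` W) p = arc_set l g ->
  exists w d g', ray W w d l g' /\ forall t, 0 < t < l -> g' t = g t.
Proof.
move=> dW Wp ag Cp; have l0 := ag.1.
have [w gw] := lim0_ex ag; have [d wd [e e0 He]] := arc_end_germ ag gw.
have [w' gw'] := lim0_ex (arc_rev ag).
have [d' wd' [e' e'0 He']] := arc_end_germ (arc_rev ag) gw'.
have Ww := component_arc_end dW Wp ag Cp gw.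
have Ww' : W w' by apply: (component_arc_end dW Wp (arc_rev ag) _ gw'); rewrite arc_set_rev.
(* An open arc says nothing about [g] outside []0, l[], whereas a ray has prescribed ends: [g] is
   redefined there by its limits. *)
pose g' t := if t <= 0 then w else if l <= t then w' else g t.
have gE t : 0 < t < l -> g' t = g t.
  by move=> /andP[t0 tl]; rewrite /g' leNgt t0 leNgt tl.
have g'l : g' l = w' by rewrite /g' leNgt l0 lexx.
have aE : arc_set l g' = arc_set l g by exact: arc_set_ext.
exists w, d, g'; split=> //; split=> //.
- by apply: open_arc_ext ag => t tl; rewrite gE.
- exists (Num.min e l); first by rewrite lt_min e0.
  move=> t; rewrite lt_min => t1; have [t0|t0] := eqVneq t 0.
    by rewrite t0 shift_pt0// /g' lexx.
  by rewrite gE ?He//; rewrite lt_neqAle eq_sym t0; slra.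
- move=> t tl; rewrite aE -Cp gE//; apply/esym/same_connected_component.
  by rewrite Cp; exists t => //=; rewrite in_itv.
exists d'; rewrite g'l; split=> //; exists (Num.min e' l); first by rewrite lt_min e'0.
move=> t; rewrite lt_min => t1; have [t0|t0] := eqVneq t 0.
  by rewrite t0 shift_pt0// subr0.
have tp : 0 < t by rewrite lt_neqAle eq_sym t0; slra.
by rewrite gE -?He'//; slra.
Qed.

Lemma ray_cover W p : arc_decomp W -> ~ W p ->
  exists w d l g t, ray W w d l g /\ 0 < t < l /\ p = g t.
Proof.
move=> dW Wp; have [l [g [ag Cp]]] := dW.2 p Wp.
have [w [d [g' [r gE]]]] := ray_of_arc dW Wp ag Cp.
have : arc_set l g p by rewrite -Cp; exact: connected_component_refl.
move=> [t /= + gp]; rewrite in_itv/= => tl.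
by exists w, d, l, g', t; rewrite gE.
Qed.

(** The component entered by the arm is an arc [g], in whose coordinate the arm is affine with
    offset [c]. If [c] were strictly inside []0, l[], then [g c] would be the marked point [w]. So
    [c] is an end, and [g] or its reverse is the ray. *)
Lemma ray_ex W w d : arc_decomp W -> W w -> dir_at w d -> exists l g, ray W w d l g.
Proof.
move=> dW Ww wd; have [e er He] := shift_avoid w dW.1.
have Wp := He d (e / 2) wd ltac:(slra).
have [l [g [ag Cp]]] := dW.2 _ Wp; have l0 := ag.1.
have as_ : open_arc e (shift_pt w d) by apply: arm_arc => //; slra.
have js t : 0 < t < e -> arc_set l g (shift_pt w d t).
  move=> te; rewrite -Cp; apply: (@connected_component_max _ _ (shift_pt w d @` `]0, e[)).
  - by exists (e / 2) => //=; rewrite in_itv/=; slra.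
  - by move=> _ [s /= + <-]; rewrite in_itv/= => se; exact: He.
  - by apply: (arc_connected as_); slra.
  - by exists t => //=; rewrite in_itv.
have [|sg [c Hc]] := arc_transition ag _ (open_arc_local_isometry as_) js; first by slra.
have lip := local_isometry_lip (open_arc_local_isometry ag).
have notmid : ~ (0 < c < l).
  move=> cl; suff gc : g c = w.
    have := connected_component_sub (A := ~` W) (x := shift_pt w d (e / 2)) (t := w).
    rewrite Cp => H; apply: H => //; exists c => //=; rewrite in_itv//.
  apply/eqP; rewrite -[_ == _]negbK -mdist_gt0; apply/negP => m0.
  have [|||x [x0 x1 x2 _]] := @exists_small R e (mdist (g c) w / 2) e; [slra..|].
  have [c1 c2] := Hc x ltac:(slra).
  have := lip c _ cl c1; rewrite -c2 => h1.
  have := mdist_shift wd (h := x) ltac:(slra) => h2.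
  have := metric_triangle (g c) (shift_pt w d x) w; rewrite (metric_sym (shift_pt w d x)) h2.
  have : `|c - (c + (if sg then x else - x))| = x.
    by case: (sg); rewrite opprD addrA subrr add0r ?opprK ?normrN gtr0_norm.
  by move=> E; rewrite E in h1; slra.
have [c0 cl] : 0 <= c <= l /\ (if sg then c < l else 0 < c).
  have H1 x : 0 < x < e -> 0 < c + (if sg then x else - x) < l by move=> /Hc[].
  case: (sg) H1 => H1; have h1 := H1 (e / 2) ltac:(slra).
    split; last by slra.
    apply/andP; split; last by slra.
    rewrite leNgt; apply/negP => c0.
    have [|||x [x0 x1 x2 _]] := @exists_small R e (- c) e; [slra..|].
    by have := H1 x ltac:(slra); slra.
  split; last by slra.
  apply/andP; split; first by slra.
  rewrite leNgt; apply/negP => c0.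
  have [|||x [x0 x1 x2 _]] := @exists_small R e (c - l) e; [slra..|].
  by have := H1 x ltac:(slra); slra.
have fin (k : R -> Gamma) : open_arc l k -> connected_component (~` W) (shift_pt w d (e / 2)) = arc_set l k ->
    (forall t, 0 < t < e -> 0 < t < l /\ shift_pt w d t = k t) -> exists l g, ray W w d l g.
  move=> ak Ck Hk; have [w0 [d0 [k' [rk kE]]]] := ray_of_arc dW Wp ak Ck.
  have rk' := rk; case: rk' => _ [_ w0d0] [e1 e10 He1] _ _.
  have [||ww dd] := @germ_eq w w0 d d0 (Num.min e e1) wd w0d0.
  - by rewrite lt_min e10; slra.
  - move=> t; rewrite lt_min => te; have [tl ->] := Hk t ltac:(slra).
    by rewrite -He1 ?kE//; slra.
  by exists l, k'; rewrite ww dd.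
case: (sg) Hc cl => Hc cl.
  have c0' : c = 0 by have [|h] := leP c 0; [slra|case: notmid; rewrite h].
  by apply: (fin g) => // t te; have := Hc t te; rewrite c0' add0r.
have cl' : c = l by have [|h] := leP l c; [slra|case: notmid; rewrite cl].
apply: (fin (fun t => g (l - t))); [exact: arc_rev|by rewrite arc_set_rev|].
by move=> t te; have := Hc t te; rewrite cl' => -[h1 h2]; split=> //; slra.
Qed.

(** Both rays parametrize the component of the common point. The coordinate changes in the two
    directions are affine of slope 1 or -1 and send each interval into the other, which forces equal
    lengths and the offset 0 or [l]. *)
Lemma ray_eq W w d l g w' d' l' g' t t' : ray W w d l g -> ray W w' d' l' g' ->
  0 < t < l -> 0 < t' < l' -> g t = g' t' -> l = l' /\
  ([/\ w = w', d = d', t = t' & forall s, 0 <= s <= l -> g s = g' s] \/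
   [/\ g l = w', g' l = w, t' = l - t & forall s, 0 <= s <= l -> g' s = g (l - s)]).
Proof.
move=> r r' tl tl' gt.
have [ag [Ww wd] [e1 e10 He1] C [d2 [Wl gd2 [e2 e20 He2]]]] := r.
have [ag' [Ww' wd'] [e1' e10' He1'] C' [d2' [Wl' gd2' [e2' e20' He2']]]] := r'.
have l0 := ag.1; have l0' := ag'.1.
have EA : arc_set l g = arc_set l' g' by rewrite -(C t)// -(C' t')// gt.
have inA s : 0 < s < l -> arc_set l' g' (g s).
  by move=> sl; rewrite -EA; exists s => //=; rewrite in_itv.
have inA' s : 0 < s < l' -> arc_set l g (g' s).
  by move=> sl; rewrite EA; exists s => //=; rewrite in_itv.
have [sg [c Hc]] := arc_transition ag l0' (open_arc_local_isometry ag') inA'.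
have [sg' [c' Hc']] := arc_transition ag' l0 (open_arc_local_isometry ag) inA.
have bound (b : bool) (x m n : R) : 0 < m -> 0 < n -> (forall s, 0 < s < m -> 0 < x + (if b then s else - s) < n) ->
    if b then 0 <= x <= n - m else m <= x <= n.
  move=> m0 n0 H; have A (y : R) : (forall s, 0 < s < m -> 0 < y + s) -> 0 <= y.
    move=> Hy; rewrite leNgt; apply/negP => y0.
    have [|||z [z0 z1 z2 _]] := @exists_small R m (- y) m; [slra..|].
    by have := Hy z ltac:(slra); slra.
  case: b H => H.
    have := A x (fun s sm => proj1 (andP (H s sm))).
    have := A (n - m - x) => B; have : 0 <= n - m - x.
      by apply: B => s sm; have := H (m - s) ltac:(slra); slra.
    by slra.
  have : 0 <= x - m by apply: A => s sm; have := H (m - s) ltac:(slra); slra.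
  have : 0 <= n - x by apply: A => s sm; have := H s sm; slra.
  by slra.
have b1 := bound sg c l' l l0' l0 (fun s sl => proj1 (Hc s sl)).
have b2 := bound sg' c' l l' l0 l0' (fun s sl => proj1 (Hc' s sl)).
have ll : l = l' by case: (sg) b1; case: (sg') b2; slra.
split=> //; subst l'.
have ends (k : R -> Gamma) : lim0 k w' -> lim0 (fun s => k (l - s)) (g' l) ->
    (forall s, 0 < s < l -> g' s = k s) -> k 0 = w' -> k l = g' l -> forall s, 0 <= s <= l -> g' s = k s.
  move=> _ _ H k0 kl s sl; have [s0|s0] := eqVneq s 0; first by rewrite s0 (ray0 r').
  have [s1|s1] := eqVneq s l; first by rewrite s1.
  by apply: H; rewrite !lt_neqAle s1 eq_sym s0.
have limg : lim0 g w by apply: (lim0_germ wd e10) => s se; apply: He1; slra.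
have limgr : lim0 (fun s => g (l - s)) (g l) by apply: (lim0_germ gd2 e20) => s se; apply: He2; slra.
have limg' : lim0 g' w' by apply: (lim0_germ wd' e10') => s se; apply: He1'; slra.
have limgr' : lim0 (fun s => g' (l - s)) (g' l) by apply: (lim0_germ gd2' e20') => s se; apply: He2'; slra.
have lim_ext (k k' : R -> Gamma) q : (forall s, 0 < s < l -> k s = k' s) -> lim0 k q -> lim0 k' q.
  move=> E H e e0; have [dl dl0 Hd] := H e e0; exists (Num.min dl l); first by rewrite lt_min dl0.
  by move=> s; rewrite lt_min => s1; rewrite -E; [apply: Hd|]; slra.
case: (sg) Hc b1 => Hc b1.
  have c0 : c = 0 by slra.
  have E s : 0 < s < l -> g' s = g s by move=> sl; have [_] := Hc s sl; rewrite c0 add0r.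
  have ww : w = w'.
    by apply: lim0_unique limg' ; apply: lim_ext limg => s sl; rewrite E.
  have gl : g l = g' l.
    by apply: lim0_unique limgr'; apply: lim_ext limgr => s sl; rewrite E//; slra.
  left; split=> //.
  - pose m := Num.min l (Num.min e1 e1').
    have m0 : 0 < m by rewrite !lt_min l0 e10.
    have [|_ //] := @germ_eq w w' d d' m wd wd' m0.
    by move=> s; rewrite /m !lt_min => s1; rewrite -He1 -?He1' ?E//; slra.
  - by apply: (open_arc_inj ag) => //; rewrite gt E.
  - move=> s sl; rewrite (ends g) ?(ray0 r)//; first by rewrite -ww.
    by rewrite -gl.
have c0 : c = l by slra.
have E s : 0 < s < l -> g' s = g (l - s) by move=> sl; have [_] := Hc s sl; rewrite c0.
have gl : g l = w'.
  by apply: lim0_unique limg'; apply: lim_ext limgr => s sl; rewrite E.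
have gl' : g' l = w.
  apply: lim0_unique limgr' _; apply: lim_ext limg => s sl; rewrite E ?subKr//; slra.
right; split=> //.
- have : l - t' = t; last by slra.
  by apply: (open_arc_inj ag); rewrite ?gt ?E//; slra.
- apply: ends => //; [by rewrite -gl| |by rewrite subr0|by rewrite subrr (ray0 r)].
  rewrite gl'; apply: lim_ext limg => s _; by rewrite subKr.
Qed.

(** A point at small distance [x] from [g t], in any direction [d], is still on the arc, so its
    parameter is [t + x] or [t - x]. The arm [d] thus meets, hence equals, one of the two arms of
    the arc. *)
Lemma open_arc_valence l g t : open_arc l g -> open (arc_set l g) -> 0 < t < l ->
  exists d1 d2, [/\ dir_at (g t) d1 /\ dir_at (g t) d2, d1 <> d2,
    forall d, dir_at (g t) d -> d = d1 \/ d = d2 &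
    exists2 eps : R, 0 < eps & forall h, 0 < h < eps ->
      g (t + h) = shift_pt (g t) d1 h /\ g (t - h) = shift_pt (g t) d2 h].
Proof.
move=> ag oA tl; have [d1 [d2 [gd1 gd2 dd [e e0 He]]]] := arc_interior_germ ag tl.
exists d1, d2; split=> //; last by exists e.
move=> d gd; have [|e1 e10 He1] := (open_germ _).1 oA (g t) _ d gd.
  by exists t => //=; rewrite in_itv.
have [[e2 e20 He2] Hh] := ag.2 t tl; have [d3 d30 Hd] := Hh _ (e20); have r0 := rad_gt0 (g t).
have [d4 d40 Hd4] := Hh _ e0.
pose m := Num.min (Num.min e e1) (Num.min (Num.min d3 d4) (rad (g t))).
have m0 : 0 < m by rewrite !lt_min e0 e10 d30 d40.
pose x := m / 2; have x0 : 0 < x by rewrite divr_gt0.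
have : x < m by rewrite /x; slra.
rewrite !lt_min => /andP[/andP[x1 x2] /andP[/andP[x3 x5] x4]].
have dx := mdist_shift gd (h := x) ltac:(slra).
have [s /=] := He1 x ltac:(slra); rewrite in_itv/= => sl gs.
have st := Hd s sl; rewrite gs dx in st.
have := He2 s t (st x3); rewrite subrr normr0 gs metric_sym dx => /(_ e20) xs.
have E : s = t + x \/ s = t - x.
  have [h|h] := leP 0 (s - t); [left; rewrite ger0_norm// in xs|right; rewrite ltr0_norm// in xs]; slra.
have [h1 h2] := He x ltac:(slra).
by case: E => E; move: gs; rewrite E ?h1 ?h2 => /esym h3;
  [left; have [||//] := arm_eq gd gd1 _ _ h3|right; have [||//] := arm_eq gd gd2 _ _ h3]; slra.
Qed.

End Rays.

(** * Outdegrees *)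

Section Outdegree.
Context {R : realType} (G : metric_graph R).
Local Notation Gamma := (realization G).
Implicit Types (p q v w : Gamma) (d : direction G) (g j : R -> Gamma) (l h : R) (X W : set Gamma).

Lemma lim0_cvg g p : lim0 g p <-> g t @[t --> 0^'+] --> p.
Proof.
split=> [gp|/metricType_numDomainType.cvgrPdist_lt gp e e0].
  apply/metricType_numDomainType.cvgrPdist_lt => e e0; have [dl dl0 Hd] := gp e e0.
  near=> t; apply: Hd; apply/andP; split; near: t; first exact: nbhs_right_gt.
  exact: nbhs_right_lt.
have [dl /= dl0 Hd] := gp e e0; exists dl => // t tdl; apply: Hd; last by slra.
by rewrite /ball/= sub0r normrN gtr0_norm; slra.
Unshelve. all: by end_near. Qed.

Lemma lim0_cvg_left l g p : lim0 (fun t => g (l - t)) p <-> g t @[t --> l^'-] --> p.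
Proof.
split=> [gp|/metricType_numDomainType.cvgrPdist_lt gp e e0].
  apply/metricType_numDomainType.cvgrPdist_lt => e e0; have [dl dl0 Hd] := gp e e0.
  near=> t.
  have tl : t < l by near: t; exact: nbhs_left_lt.
  have tdl : l - dl < t by near: t; apply: nbhs_left_gt; slra.
  by have := Hd (l - t); rewrite subKr; apply; slra.
have [dl /= dl0 Hd] := gp e e0; exists dl => // t tdl; apply: Hd; last by slra.
by rewrite /ball/= subKr gtr0_norm; slra.
Unshelve. all: by end_near. Qed.

Definition outdirs X v : {set direction G} := [set d | dir_at v d && 
  `[< exists2 eps : R, 0 < eps & forall h, 0 < h < eps -> ~ X (shift_pt v d h) >]].

Lemma outdirsP X v d : reflect (dir_at v d /\ exists2 eps : R, 0 < eps &
  forall h, 0 < h < eps -> ~ X (shift_pt v d h)) (d \in outdirs X v).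
Proof. by rewrite inE; apply: (iffP andP) => -[-> /asboolP]. Qed.

Lemma outgoing_segments_outdirs X v : outgoing_segments X v #|outdirs X v|.
Proof.
have [|e0 e00 He0] := @finite_min_pos R _ (mem (outdirs X v))
    (fun d h => ~ X (shift_pt v d h)).
  by move=> d /outdirsP[].
have r0 := rad_gt0 v; pose e := Num.min e0 (rad v).
have [[ee er] e_gt0] : (e <= e0 /\ e <= rad v) /\ 0 < e.
  by rewrite !ge_min !lexx orbT lt_min e00 r0.
have od (i : 'I_#|outdirs X v|) : enum_val i \in outdirs X v by exact: enum_valP.
have dv (i : 'I_#|outdirs X v|) : dir_at v (enum_val i) by have /outdirsP[] := od i.
exists (fun=> e), (fun i => shift_pt v (enum_val i)); split=> [i|i _ [t /= + <-]|i|i j ij].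
- by apply: arm_arc => //; slra.
- by rewrite in_itv/= => te; apply: (He0 _ (od i)); slra.
- by left; apply/lim0_cvg; exact: (lim0_germ (dv i) ltr01).
rewrite -subset0 => _ [[t /= + <-] [s /= + E]]; rewrite !in_itv/= => te se.
have [||E' _] := arm_eq (dv j) (dv i) _ _ E; [slra|slra|].
by move: ij; rewrite (enum_val_inj E') eqxx.
Qed.

(** Read from its end at [v], each segment starts along an arm by [arc_end_germ], and disjoint
    segments use different arms. *)
Lemma outgoing_segments_le X v m : outgoing_segments X v m -> (m <= #|outdirs X v|)%N.
Proof.
move=> [l [g [ag gX gv gd]]].
have H i : exists d, d \in outdirs X v /\ exists2 eps : R, 0 < eps & forall h, 0 < h < eps ->
    arc_set (l i) (g i) (shift_pt v d h).
  (* A segment that tends to [v] at its other end is replaced by its reverse. *)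
  wlog gv0 : g ag gX gv gd / g i t @[t --> 0^'+] --> v.
    move=> W; case: (gv i); first exact: W.
    move=> gvl; pose g' k := if k == i then (fun t => g k (l k - t)) else g k.
    have E k : arc_set (l k) (g' k) = arc_set (l k) (g k).
      by rewrite /g'; case: eqP => // _; rewrite arc_set_rev.
    have := W g'; rewrite E; apply=> [k|k|k|k k' kk|].
    - by rewrite /g'; case: eqP => // _; exact: arc_rev.
    - by rewrite E; exact: gX.
    - rewrite /g'; case: eqP => [->|] //; left.
      by apply/lim0_cvg; apply/lim0_cvg_left.
    - by rewrite !E; exact: gd.
    - by rewrite /g' eqxx; apply/lim0_cvg; apply/lim0_cvg_left.
  have [d vd [e e0 He]] := arc_end_germ (ag i) ((lim0_cvg _ _).2 gv0).
  have l0 := (ag i).1.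
  have inA h : 0 < h < Num.min e (l i) -> arc_set (l i) (g i) (shift_pt v d h).
    rewrite lt_min => h1; rewrite -He; last by slra.
    by exists h => //=; rewrite in_itv/=; slra.
  exists d; split; last by exists (Num.min e (l i)) => //; rewrite lt_min e0.
  apply/outdirsP; split=> //; exists (Num.min e (l i)); first by rewrite lt_min e0.
  by move=> h /inA /gX.
move: H => /choice[dl Hdl].
have inj : injective dl.
  move=> i j E; apply/eqP; rewrite -[_ == _]negbK; apply/negP => ij.
  have [[_ [e1 e10 H1]] [_ [e2 e20 H2]]] := (Hdl i, Hdl j).
  have [x [x0 x1 x2 _]] := exists_small e10 e20 e10.
  suff : (set0 : set Gamma) (shift_pt v (dl i) x) by [].
  rewrite -(gd i j ij); split; first by apply: H1; slra.
  by rewrite E; apply: H2; slra.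
rewrite -[m]card_ord -(card_codom inj); apply: subset_leq_card.
by apply/fintype.subsetP => _ /codomP[i ->]; exact: (Hdl i).1.
Qed.

Lemma outdeg_card X v : outdeg X v = #|outdirs X v|.
Proof.
apply: xget_unique => [|m [h1 h2]].
  by split; [exact: outgoing_segments_outdirs|exact: outgoing_segments_le].
apply/eqP; rewrite eqn_leq outgoing_segments_le//=.
by apply: h2; exact: outgoing_segments_outdirs.
Qed.

(** Replaces a point at a given position on a geodesic: the walk is cut after length [s], inside one
    of its moves if necessary. *)
Lemma walk_split p q (r s : R) : walk p q r -> 0 <= s <= r ->
  exists m, mdist p m <= s /\ mdist m q <= r - s.
Proof.
move=> w; elim: w s => {p q r} [p|e x y q r xe ye w IH] s sr.
  by exists p; rewrite mdistxx; slra.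
have wd : mdist (edge_pt e y) q <= r by exact: walk_dist_le.
have [sx|xs] := leP s `|x - y|.
  pose z := if x <= y then x + s else x - s.
  have [ze [zx zy]] : 0 <= z <= len e /\ `|x - z| = s /\ `|z - y| = `|x - y| - s.
    rewrite /z; move: sx; case: (leP x y) => xy.
      rewrite (distrC x y) ger0_norm ?subr_ge0// => sx.
      rewrite opprD addrA subrr add0r normrN ger0_norm; last by slra.
      by rewrite distrC ger0_norm; slra.
    rewrite ger0_norm; last by slra.
    move=> sx; rewrite subKr ger0_norm; last by slra.
    by rewrite ger0_norm; slra.
  exists (edge_pt e z); have h1 := mdist_edge xe ze; have h2 := mdist_edge ze ye.
  have := metric_triangle (edge_pt e z) (edge_pt e y) q; rewrite zx in h1; rewrite zy in h2.
  by slra.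
have [|m [h1 h2]] := IH (s - `|x - y|); first by slra.
exists m; have := mdist_edge xe ye; have := metric_triangle (edge_pt e x) (edge_pt e y) m.
by slra.
Qed.

End Outdegree.

(** * The burnt region *)

Section BurntRegion.
Context {R : realType} (G : metric_graph R).
Local Notation Gamma := (realization G).
Implicit Types (p q v w x : Gamma) (d e : direction G) (g j : R -> Gamma) (l h t : R).
Context (V S : set Gamma) (v0 : Gamma) (dV : arc_decomp V) (Vv0 : V v0)
  (fS : finite_set S) (Sv0 : ~ S v0).
Local Notation U := (ucomp S v0).
Local Notation W := (V `|` S).

Lemma decompVS : arc_decomp W.
Proof. exact: arc_decompU. Qed.

Lemma ucomp_sub : U `<=` ~` S.
Proof. exact: connected_component_sub. Qed.

Lemma ucomp_base : U v0.
Proof. exact: connected_component_refl. Qed.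

Lemma ucomp_open : open U.
Proof. by apply: component_open; exact: finite_setC_open. Qed.

Lemma ucomp_connected : connected U.
Proof. exact: component_connected. Qed.

Lemma component_absorb (T : topologicalType) (A Q : set T) (b q : T) : connected Q -> Q `<=` A -> Q q ->
  connected_component A b q -> Q `<=` connected_component A b.
Proof.
move=> cQ QA Qq bq y Qy; apply: (connected_component_trans bq).
exact: (connected_component_max Qq).
Qed.

(** A short open arm avoids the finite set [S] and is connected, so one of its points in [U] brings
    in all the others. *)
Lemma ucomp_germ p d : dir_at p d -> exists2 eps : R, 0 < eps &
  (forall h, 0 < h < eps -> U (shift_pt p d h)) \/ (forall h, 0 < h < eps -> ~ U (shift_pt p d h)).
Proof.
move=> pd; have [e er He] := shift_avoid p fS; exists e; first by slra.
have ar : open_arc e (shift_pt p d) by apply: arm_arc => //; slra.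
have [[h0 [h0e Uh0]]|no] := pselect (exists h, 0 < h < e /\ U (shift_pt p d h)); last first.
  by right=> h he Uh; apply: no; exists h.
left=> h he; apply: (component_absorb (Q := shift_pt p d @` `]0, e[) (q := shift_pt p d h0)) => //.
- by apply: (arc_connected ar); slra.
- by move=> _ [s /= + <-]; rewrite in_itv/= => se; exact: He.
Qed.

Lemma ucomp_outdirsP p d : reflect (dir_at p d /\ exists2 eps : R, 0 < eps &
  forall h, 0 < h < eps -> U (shift_pt p d h)) (d \in outdirs (~` U) p).
Proof.
apply: (iffP (outdirsP _ _ _)) => -[pd [e e0 He]]; split=> //; exists e => // h he.
  by apply: contrapT; exact: He.
by move=> /(_ (He h he)).
Qed.

Lemma ucomp_outdirsPn p d : dir_at p d -> d \notin outdirs (~` U) p ->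
  exists2 eps : R, 0 < eps & forall h, 0 < h < eps -> ~ U (shift_pt p d h).
Proof.
move=> pd; have [e e0 [He|He]] := ucomp_germ pd; last by exists e.
by move=> /negP[]; apply/ucomp_outdirsP; split=> //; exists e.
Qed.

(** A point outside [S] that borders [U] would be absorbed by [U] through a short arm avoiding
    [S]. *)
Lemma outdirs_in_S p d : ~ U p -> d \in outdirs (~` U) p -> S p.
Proof.
move=> Up /ucomp_outdirsP[pd [e e0 He]]; apply: contrapT => Sp; apply: Up.
have [e1 er He1] := shift_avoid p fS.
have [|h [h0 h1 h2 _]] := @exists_small R e e1 e e0 _ e0; first by slra.
have ra := rad_arm pd.
apply: (component_absorb (Q := shift_pt p d @` `[0, h]) (q := shift_pt p d h)).
- by apply: arm_connected => //; slra.
- move=> _ [s /= + <-]; rewrite in_itv/= => sh.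
  have [->|s0] := eqVneq s 0; first by rewrite shift_pt0.
  by apply: He1 => //; rewrite lt_neqAle eq_sym s0; slra.
- by exists h => //=; rewrite in_itv/=; slra.
- by apply: He; slra.
- by exists 0; rewrite ?shift_pt0//= in_itv/=; slra.
Qed.

Lemma ray_ucomp w d l g t s : ray W w d l g -> 0 < t < l -> U (g t) -> 0 < s < l -> U (g s).
Proof.
move=> r tl Ut sl; have ag : open_arc l g by case: r.
apply: (component_absorb (Q := g @` `]0, l[) (q := g t)) => //.
- by apply: (arc_connected ag).
- by move=> _ [y /= + <-]; rewrite in_itv/= => /(ray_notin r) H /= Sy; apply: H; right.
Qed.

(** The end of the ray is in [V] or in [S]. If it were in [S], as [w] is, the open ray would be open
    and closed relative to [U] and would contain [U]; but [v0] is marked and no marked point is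
    inside a ray. *)
Lemma out_ray w d l g : ray W w d l g -> ~ U w -> d \in outdirs (~` U) w ->
  (forall t, 0 < t < l -> U (g t)) /\ U (g l) /\ V (g l).
Proof.
move=> r Uw od; have Sw := outdirs_in_S Uw od; have gw := ray0 r.
have [ag _ [e1 e10 He1] C [d' [Wl gd' [e2 e20 He2]]]] := r; have l0 := ag.1.
have Ug t : 0 < t < l -> U (g t).
  have /ucomp_outdirsP[wd [e e0 He]] := od.
  have [h [h0 h1 h2 h3]] := exists_small e0 e10 l0.
  apply: (ray_ucomp r (t := h)); first by slra.
  by rewrite He1; [apply: He|]; slra.
split=> //.
suff Sl : ~ S (g l).
  split; last by case: Wl.
  have [h [h0 h1 h2 _]] := exists_small e20 l0 e20.
  have [e3 er He3] := shift_avoid (g l) fS.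
  have [|k [k0 k1 k2 k3]] := @exists_small R e2 l e3 e20 l0; first by slra.
  have ra := rad_arm gd'.
  apply: (component_absorb (Q := shift_pt (g l) d' @` `[0, k]) (q := shift_pt (g l) d' k)).
  - by apply: arm_connected => //; slra.
  - move=> _ [s /= + <-]; rewrite in_itv/= => sk.
    have [->|s0] := eqVneq s 0; first by rewrite shift_pt0.
    by apply: He3 => //; rewrite lt_neqAle eq_sym s0; slra.
  - by exists k => //=; rewrite in_itv/=; slra.
  - by rewrite -He2; [apply: Ug|]; slra.
  - by exists 0; rewrite ?shift_pt0//= in_itv/=; slra.
move=> Sl.
have clA : closed (g @` `[0, l]).
  apply: compact_closed; first exact: metric_hausdorff.
  apply: continuous_compact; last exact: segment_compact.
  by apply: lipschitz_within => s t; rewrite /= !in_itv/= => s1 t1; exact: (ray_lip r).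
have : U `<=` arc_set l g.
  apply: (connected_split (B := ~` (g @` `[0, l]))).
  - exact: ucomp_connected.
  - by apply: (component_open_arc decompVS.1 (C (l / 2) _)); slra.
  - exact: closed_openC.
  - move=> y Uy; have [[t /= + ty]|] := pselect ((g @` `[0, l]) y); last by right.
    rewrite in_itv/= => tl; left; have Sy := ucomp_sub Uy.
    exists t => //=; rewrite in_itv/= !lt_neqAle.
    have -> : 0 != t by apply/eqP => t0; apply: Sy; rewrite -ty -t0 gw.
    have -> : t != l by apply/eqP => t0; apply: Sy; rewrite -ty t0.
    by slra.
  - rewrite -subset0 => y [[_ [t /= + ty]]]; rewrite in_itv/= => tl; apply.
    by exists t => //=; rewrite in_itv/=; slra.
  - exists (g (l / 2)); split; first by apply: Ug; slra.
    by exists (l / 2) => //=; rewrite in_itv/=; slra.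
move=> /(_ _ ucomp_base)[t /= + tv]; rewrite in_itv/= => /(ray_notin r) H.
by apply: H; left; rewrite tv.
Qed.

Lemma finite_argmin (T : eqType) (A : set T) (f : T -> R) : finite_set A -> A !=set0 ->
  exists a, A a /\ forall b, A b -> f a <= f b.
Proof.
move=> /finite_seqP[s ->]; elim: s => [|y s IH]; first by case.
move=> _; case: s IH => [_|z s /(_ _)[|a [sa Ha]]].
- by exists y; rewrite /= inE eqxx; split=> // b; rewrite inE => /eqP ->.
- by exists z; rewrite /= inE eqxx.
have [ya|ay] := leP (f y) (f a).
  exists y; split=> [|b]; first by rewrite /= inE eqxx.
  by rewrite /= inE => /orP[/eqP ->//|/Ha]; exact: le_trans.
exists a; split=> [|b]; first by rewrite /= inE sa orbT.
by rewrite /= inE => /orP[/eqP ->|/Ha//]; exact: ltW.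
Qed.

(** * Components of the complement of the burnt region and their exits *)

Section Component.
Context (x0 : Gamma) (Ux0 : ~ U x0).
Local Notation X := (connected_component (~` U) x0).

Lemma comp_closed : closed X.
Proof. by apply: component_closed; apply: open_closedC; exact: ucomp_open. Qed.

Lemma comp_sub : X `<=` ~` U.
Proof. exact: connected_component_sub. Qed.

Lemma comp_germ p d : X p -> dir_at p d -> d \notin outdirs (~` U) p ->
  exists2 eps : R, 0 < eps & forall h, 0 < h < eps -> X (shift_pt p d h).
Proof.
move=> Xp pd od; have [e e0 He] := ucomp_outdirsPn pd od; have a0 := arm_length_gt0 pd.
exists (Num.min e (arm_length p d)); first by rewrite lt_min e0.
move=> h; rewrite lt_min => h1.
apply: (component_absorb (Q := shift_pt p d @` `[0, h]) (q := p)) => //.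
- by apply: arm_connected => //; slra.
- move=> _ [s /= + <-]; rewrite in_itv/= => sh.
  have [->|s0] := eqVneq s 0; first by rewrite shift_pt0//; exact: comp_sub.
  by apply: He; rewrite lt_neqAle eq_sym s0; slra.
- by exists 0; rewrite ?shift_pt0//= in_itv/=; slra.
- by exists h => //=; rewrite in_itv/=; slra.
Qed.

Lemma compN_germ p d : ~ X p -> dir_at p d ->
  exists2 eps : R, 0 < eps & forall h, 0 < h < eps -> ~ X (shift_pt p d h).
Proof.
move=> Xp pd; apply: ((open_germ (~` X)).1 _ p Xp d pd).
by apply: closed_openC; exact: comp_closed.
Qed.

Definition outpair x d : Prop := X x /\ d \in outdirs (~` U) x.

(** Without an exit into [U], membership in [X] would be locally constant, and [v0] would belong to
    [X]. *)
Lemma outpair_ex : exists x d, outpair x d.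
Proof.
apply: contrapT => no.
have H : X x0 -> X v0.
  apply: locally_constant => p d pd; have [Xp|Xp] := pselect (X p).
    have [|e e0 He] := comp_germ Xp pd; last by exists e => // h /He.
    by apply/negP => od; apply: no; exists p, d.
  by have [e e0 He] := compN_germ Xp pd; exists e => // h /He.
by apply: (comp_sub (H _)); [exact: connected_component_refl|exact: ucomp_base].
Qed.

Lemma outpair_S x d : outpair x d -> S x.
Proof. by move=> [Xx]; apply: outdirs_in_S; exact: comp_sub. Qed.

(** The exits are finitely many because they start in [S]. The smallest length [dl] of an exit ray
    will turn out to be the distance from [X] to [V] inside [U], that is, how far the move goes. *)
Lemma out_rays_ex : exists (L : Gamma -> direction G -> R) (Gf : Gamma -> direction G -> R -> Gamma)
   (dl : R), [/\ forall x d, outpair x d -> ray W x d (L x d) (Gf x d),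
     forall x d, outpair x d -> dl <= L x d, 0 < dl & exists x d, outpair x d /\ L x d = dl].
Proof.
have /choice[F HF] : forall z : Gamma * direction G, exists y : R * (R -> Gamma),
    outpair z.1 z.2 -> ray W z.1 z.2 y.1 y.2.
  move=> [x d] /=; have [od|od] := pselect (outpair x d); last by exists (0, fun=> x).
  have Sx := outpair_S od; have /outdirsP[xd _] := od.2.
  have [//|l [g r]] := ray_ex decompVS (w := x) _ xd; first by right.
  by exists (l, g).
have fA : finite_set [set z : Gamma * direction G | outpair z.1 z.2].
  apply: (@sub_finite_set _ _ (S `*` [set: direction G])).
    by move=> [x d] /= /outpair_S.
  exact: finite_setX.
have [|[x d] [/= od Hm]] := finite_argmin (fun z => (F z).1) fA.
  by have [x [d od]] := outpair_ex; exists (x, d).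
exists (fun x d => (F (x, d)).1), (fun x d => (F (x, d)).2), (F (x, d)).1; split.
- by move=> y e oe; exact: (HF (y, e)).
- by move=> y e oe; exact: (Hm (y, e)).
- by have [[]] := HF (x, d) od.
- by exists x, d.
Qed.

End Component.
End BurntRegion.

(** * Extremal functions *)

Section ExtremalFunction.
Context {R : realType} (G : metric_graph R).
Local Notation Gamma := (realization G).
Implicit Types (p q v w x : Gamma) (d e : direction G) (g j : R -> Gamma) (l h t : R).
Context (V S : set Gamma) (v0 : Gamma) (dV : arc_decomp V) (Vv0 : V v0)
  (fS : finite_set S) (Sv0 : ~ S v0).
Local Notation U := (ucomp S v0).
Local Notation W := (V `|` S).
Context (x0 : Gamma) (Ux0 : ~ U x0).
Local Notation X := (connected_component (~` U) x0).
Local Notation outpair := (outpair S v0 x0).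
Context (L : Gamma -> direction G -> R) (Gf : Gamma -> direction G -> R -> Gamma) (dl : R).
Context (rayL : forall x d, outpair x d -> ray W x d (L x d) (Gf x d))
  (dl_le : forall x d, outpair x d -> dl <= L x d) (dl_gt0 : 0 < dl)
  (dl_ex : exists x d, outpair x d /\ L x d = dl).

Let subX := @comp_sub _ _ S v0 x0.

Lemma out_ray_U x d t : outpair x d -> 0 < t <= L x d -> U (Gf x d t).
Proof.
move=> od tl; have [|_ [U1 [U2 _]]] := (subX od.1, out_ray dV Vv0 fS Sv0 (rayL od) _ od.2).
  exact: subX od.1.
have [->//|tn] := eqVneq t (L x d).
by apply: U1; rewrite !lt_neqAle tn; slra.
Qed.

Lemma out_ray_end x d : outpair x d -> V (Gf x d (L x d)).
Proof.
by move=> od; have [||_ [_ ]] := out_ray dV Vv0 fS Sv0 (rayL od); [exact: subX od.1|exact: od.2|].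
Qed.

(** The only alternative in [ray_eq] is a reversal, excluded because an exit ray starts outside [U]
    and ends in [U]. *)
Lemma ray_meet x d t x' d' t' : outpair x d -> outpair x' d' -> 0 < t < L x d -> 0 < t' < L x' d' ->
  Gf x d t = Gf x' d' t' -> [/\ x = x', d = d' & t = t'].
Proof.
move=> od od' tl tl' E; have := ray_eq (rayL od) (rayL od') tl tl' E.
move=> [_ [[-> -> -> _]|[Ex _ _ _]]]; first by split.
case: (subX od'.1); rewrite -Ex; apply: (out_ray_U od); rewrite lexx andbT; slra.
Qed.

(* The distance to [X], truncated at [dl]. *)
Definition tdist p : R := if `[< X p >] then 0 else xget dl [set r |
  exists x d t, [/\ outpair x d, 0 < t < L x d, p = Gf x d t & r = Num.min dl t]].

Lemma tdist_X p : X p -> tdist p = 0.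
Proof. by move=> Xp; rewrite /tdist asboolT. Qed.

Lemma tdist_off p : ~ X p -> (forall x d t, outpair x d -> 0 < t < L x d -> p <> Gf x d t) -> tdist p = dl.
Proof.
move=> Xp H; rewrite /tdist asboolF//; apply: xgetPN => r [x [d [t [od tl pE _]]]].
exact: H od tl pE.
Qed.

Lemma tdist_ray_in x d t : outpair x d -> 0 < t < L x d -> tdist (Gf x d t) = Num.min dl t.
Proof.
have dl0 := dl_gt0.
move=> od tl; rewrite /tdist asboolF; last first.
  by move=> /subX; apply; apply: out_ray_U => //; slra.
apply: xget_unique => [|r [x' [d' [t' [od' tl' E ->]]]]]; first by exists x, d, t.
by have [_ _ ->] := ray_meet od od' tl tl' E.
Qed.

Lemma tdist_ray x d t : outpair x d -> 0 <= t <= L x d -> tdist (Gf x d t) = Num.min dl t.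
Proof.
have dl0 := dl_gt0.
move=> od tl; have l0 : 0 < L x d by have [[]] := rayL od.
have [->|t0] := eqVneq t 0.
  by rewrite (ray0 (rayL od)) tdist_X ?(min_idPr (ltW dl_gt0))//; exact: od.1.
have [->|tn] := eqVneq t (L x d); last first.
  by apply: tdist_ray_in => //; rewrite !lt_neqAle tn eq_sym t0; slra.
rewrite (min_idPl (dl_le od)); apply: tdist_off.
  by move=> /subX; apply; apply: out_ray_U => //; slra.
move=> x' d' t' od' tl' E; apply: (ray_notin (rayL od') tl'); rewrite -E; left.
exact: out_ray_end.
Qed.

Lemma tdist_bound p : 0 <= tdist p <= dl.
Proof.
have dl0 := dl_gt0.
rewrite /tdist; case: asboolP => _ /=; first by slra.
case: xgetP => [r _ [x [d [t [_ tl _ ->]]]]|]; last by slra.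
by rewrite le_min ge_min lexx andbT; slra.
Qed.

Lemma tdist_lt p : ~ X p -> tdist p < dl -> exists x d t, [/\ outpair x d, 0 < t < dl & p = Gf x d t].
Proof.
have dl0 := dl_gt0.
move=> Xp; rewrite /tdist asboolF//; case: xgetP => [r _ [x [d [t [od tl pE ->]]]]|]; last by rewrite ltxx.
by rewrite gt_min ltxx/= => tdl; exists x, d, t; split=> //; slra.
Qed.

(** [p] is where the exit ray of [(x, d)] reaches height [dl], and [e] is the direction at [p] that
    leads back along it. *)
Definition back_germ p e x d : Prop := exists2 eps : R, 0 < eps &
  forall h, 0 <= h < eps -> Gf x d (dl - h) = shift_pt p e h.

Lemma tdist_germ_X p d : X p -> dir_at p d ->
  germ tdist p d (d \in outdirs (~` U) p : nat)%:Z.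
Proof.
have dl0 := dl_gt0.
move=> Xp pd; case: (boolP (d \in outdirs (~` U) p)) => [od|nod].
  have opd : outpair p d by [].
  have [ag _ [e e0 He] _ _] := rayL opd; have l0 := ag.1.
  exists (Num.min e dl); first by rewrite lt_min e0.
  move=> h; rewrite lt_min => h1; have := dl_le opd => dlL.
  rewrite -He; last by slra.
  by rewrite tdist_ray ?(tdist_X Xp) ?add0r ?mul1r//; [apply/min_idPr; slra|slra].
have [e e0 He] := comp_germ fS Xp pd nod; exists e => // h he.
by rewrite !tdist_X ?mul0r ?addr0//; exact: He.
Qed.

Lemma tdist_germ_ray x d t : outpair x d -> 0 < t < dl ->
  exists d1 d2, [/\ dir_at (Gf x d t) d1 /\ dir_at (Gf x d t) d2, d1 <> d2,
    forall e, dir_at (Gf x d t) e -> e = d1 \/ e = d2,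
    germ tdist (Gf x d t) d1 1 & germ tdist (Gf x d t) d2 (-1)].
Proof.
have dl0 := dl_gt0.
move=> od tdl; have := dl_le od => dlL; have [ag _ _ C _] := rayL od.
have tL : 0 < t < L x d by slra.
have oA := component_open_arc (decompVS dV fS).1 (C t tL).
have [d1 [d2 [gd dd H [e e0 He]]]] := open_arc_valence ag oA tL.
have m0 : 0 < Num.min e (Num.min t (dl - t)) by rewrite !lt_min e0; slra.
exists d1, d2; split=> //; exists (Num.min e (Num.min t (dl - t))) => //;
  move=> h; rewrite !lt_min => h1; have [|E1 E2] := He h; [slra| |slra|].
  rewrite -E1 !tdist_ray//; [|slra..].
  by rewrite !(min_idPr _); [rewrite mul1r|slra..].
rewrite -E2 !tdist_ray//; [|slra..].
by rewrite !(min_idPr _); [rewrite mulN1r|slra..].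
Qed.

Lemma back_germ_end p e x d : outpair x d -> dir_at p e -> back_germ p e x d -> p = Gf x d dl.
Proof. by move=> od pe [eps e0 He]; rewrite -[dl]subr0 He ?lexx// shift_pt0. Qed.

Lemma back_germ_germ p e x d : outpair x d -> dir_at p e -> back_germ p e x d ->
  germ tdist p e (-1).
Proof.
have dl0 := dl_gt0.
move=> od pe bg; have pE := back_germ_end od pe bg; case: bg => eps e0 He.
have := dl_le od => dlL.
exists (Num.min eps dl); first by rewrite lt_min e0.
move=> h; rewrite lt_min => h1; rewrite -He; last by slra.
rewrite pE !tdist_ray//; [|slra..].
by rewrite minxx (min_idPr _) ?mulN1r//; slra.
Qed.

(** At the truncation level [tdist] can only decrease back along an exit ray. Three positions of [p]
    occur: inside an exit ray at or beyond height [dl]; at a marked point, where the ray leaving in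
    direction [e] is compared with the exit rays; and inside a component that is not an exit ray. *)
Lemma tdist_germ_top p e : ~ X p -> tdist p = dl -> dir_at p e ->
  germ tdist p e 0 \/ exists x d, outpair x d /\ back_germ p e x d.
Proof.
have dl0 := dl_gt0.
move=> Xp tp pe.
have [[x [d [t [od tL pE]]]]|noray] := pselect (exists x d t, [/\ outpair x d, 0 < t < L x d & p = Gf x d t]).
  have := tdist_ray_in od tL; rewrite -pE tp => tE.
  have tdl : dl <= t by rewrite tE ge_min lexx orbT.
  have [ag _ _ C _] := rayL od; have oA := component_open_arc (decompVS dV fS).1 (C t tL).
  have [d1 [d2 [gd dd H [eps eps0 He]]]] := open_arc_valence ag oA tL.
  move: pe; rewrite pE => pe; case: (H e pe) => ->.
    left; exists (Num.min eps (L x d - t)); first by rewrite lt_min eps0; slra.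
    move=> h; rewrite lt_min => h1; have [|<- _] := He h; first by slra.
    by rewrite !tdist_ray ?mul0r ?addr0//; [rewrite !(min_idPl _)//; slra|slra..].
  have [tdl'|tn] := eqVneq t dl.
    right; exists x, d; split=> //; exists eps => // h h1.
    have [->|hn] := eqVneq h 0; first by rewrite subr0 (shift_pt0 gd.2) tdl'.
    by rewrite -tdl'; apply: (He h _).2; rewrite lt_neqAle eq_sym hn; slra.
  have tdl2 : dl < t by rewrite lt_neqAle eq_sym tn.
  left; exists (Num.min eps (t - dl)); first by rewrite lt_min eps0; slra.
  move=> h; rewrite lt_min => h1; have [|_ <-] := He h; first by slra.
  by rewrite !tdist_ray ?mul0r ?addr0//; [rewrite !(min_idPl _)//; slra|slra..].
have [e1 e10 He1] := compN_germ fS Xp pe.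
(* If the short arm in direction [e] meets no exit ray, [tdist] keeps the value [dl] on it. *)
suff [[eps [eps0 Heps]]|//] : (exists eps : R, 0 < eps /\ forall h, 0 < h < eps -> forall x d t, outpair x d ->
    0 < t < L x d -> shift_pt p e h <> Gf x d t) \/
    (germ tdist p e 0 \/ exists x d, outpair x d /\ back_germ p e x d).
  left; exists (Num.min e1 eps); first by rewrite lt_min e10.
  move=> h; rewrite lt_min => h1; rewrite mul0r addr0 tp; apply: tdist_off.
    by apply: He1; slra.
  by apply: Heps; slra.
have [Wp|Wp] := pselect (W p).
  have [l [g r]] := ray_ex (decompVS dV fS) Wp pe.
  have [ag _ [e2 e20 He2] _ _] := r; have l0 := ag.1.
  have [[x [d [t [h [od tL hl E]]]]]|no] := pselect (exists x d t h,
      [/\ outpair x d, 0 < t < L x d, 0 < h < l & g h = Gf x d t]); last first.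
    left; exists (Num.min e2 l); split; first by rewrite lt_min e20.
    move=> h; rewrite lt_min => h1 x d t od tL E; apply: no; exists x, d, t, h; split=> //.
      by slra.
    by rewrite -E He2//; slra.
  right; have [ll [[px]|[_ pL _ Hs]]] := ray_eq r (rayL od) hl tL E.
    by case: Xp; rewrite px; exact: od.1.
  have gG s : 0 <= s <= l -> g s = Gf x d (l - s).
    by move=> sl; rewrite Hs ?subKr//; slra.
  have := dl_le od; rewrite -ll le_eqVlt => /orP[/eqP dll|dll].
    right; exists x, d; split=> //; exists (Num.min e2 l); first by rewrite lt_min e20.
    by move=> h'; rewrite lt_min => h1; rewrite dll -gG ?He2//; slra.
  left; exists (Num.min e2 (l - dl)); first by rewrite lt_min e20; slra.
  move=> h'; rewrite lt_min => h1; rewrite -He2; last by slra.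
  rewrite mul0r addr0 tp gG; last by slra.
  by rewrite tdist_ray//; [apply/min_idPl|rewrite -ll]; slra.
left; have [e3 er He3] := shift_avoid p (decompVS dV fS).1; have ra := rad_arm pe.
exists e3; split=> [|h h1 x d t od tL E]; first by slra.
have Cp : connected_component (~` W) p (shift_pt p e h).
  by apply: component_shift => //; [slra|slra|move=> h' h'1; apply: He3 => //; slra].
have [ag _ _ C _] := rayL od; have := C t tL; rewrite -E => CE.
have : arc_set (L x d) (Gf x d) p by rewrite -CE; exact: connected_component_sym.
by move=> [s /= + sp]; rewrite in_itv/= => sL; apply: noray; exists x, d, s.
Qed.

Lemma tdist_germ_off p e : ~ U p -> ~ X p -> dir_at p e -> germ tdist p e 0.
Proof.
have dl0 := dl_gt0.
move=> Up Xp pe.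
have tp : tdist p = dl.
  apply: tdist_off => // x d t od tL pE; apply: Up; rewrite pE.
  by apply: out_ray_U => //; slra.
have [//|[x [d [od /back_germ_end pE]]]] := tdist_germ_top Xp tp pe.
case: Up; rewrite (pE od pe); apply: out_ray_U => //; rewrite dl_gt0.
exact: dl_le.
Qed.

Lemma tdist_germ_ex p d : dir_at p d -> exists2 k : int, `|k| <= 1 & germ tdist p d k.
Proof.
move=> pd; have [Xp|Xp] := pselect (X p).
  by exists (d \in outdirs (~` U) p : nat)%:Z; [case: (_ \in _)|exact: tdist_germ_X].
have [tp|tp] := eqVneq (tdist p) dl.
  have [g0|[x [e [od bg]]]] := tdist_germ_top Xp tp pd; first by exists 0.
  by exists (-1) => //; exact: back_germ_germ bg.
have tdl : tdist p < dl by rewrite lt_neqAle tp; have /andP[] := tdist_bound p.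
have [x [e [t [od tl pE]]]] := tdist_lt Xp tdl.
have [d1 [d2 [_ _ H g1 g2]]] := tdist_germ_ray od tl.
move: pd; rewrite pE => /H[->|->]; first by exists 1.
by exists (-1).
Qed.

Lemma tdist_rational : rational_function (fun p => - tdist p).
Proof.
apply: (germ_rational _).1 => p d /tdist_germ_ex[k k1 [e e0 He]].
exists (- k); first by rewrite normrN.
by exists e => // h /He ->; rewrite mulrNz opprD mulNr.
Qed.

Lemma tdist_lip p q : tdist p - tdist q <= mdist p q.
Proof. by have [_] := germ_rational tdist_germ_ex; apply. Qed.

Lemma tdist_top_V p : U p -> V p -> tdist p = dl.
Proof.
move=> Up Vp; apply: tdist_off => [/subX//|x d t od tL pE].
by apply: (ray_notin (rayL od) tL); left; rewrite -pE.
Qed.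

Lemma set_dist_bounds (A B : set Gamma) (r : R) : (forall x y, A x -> B y -> r <= mdist x y) ->
  (forall eps : R, 0 < eps -> exists x y, [/\ A x, B y & mdist x y < r + eps]) -> set_dist A B = r.
Proof.
move=> lo up.
have [x [y [Ax By _]]] := up 1 ltr01.
have ne : [set mdist x y | x in A & y in B] !=set0 by exists (mdist x y), x => //; exists y.
have lb : lbound [set mdist x y | x in A & y in B] r by move=> _ [x' Ax' [y' By' <-]]; exact: lo.
apply/eqP; rewrite eq_le; apply/andP; split; last exact: lb_le_inf.
apply/ler_addgt0Pl => eps eps0; have [x' [y' [Ax' By' xy]]] := up eps eps0.
rewrite addrC; apply: le_trans (ltW xy); apply: ge_inf; first by exists r.
by exists x' => //; exists y'.
Qed.

(** [tdist] is 1-Lipschitz, 0 on [X] and [dl] on the marked points of [U]; a shortest exit ray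
    realizes the bound. *)
Lemma set_dist_verts : set_dist X (U `&` V) = dl.
Proof.
have dl0 := dl_gt0.
apply: set_dist_bounds => [x y Xx [Uy Vy]|eps eps0].
  by have := tdist_lip y x; rewrite (tdist_X Xx) (tdist_top_V Uy Vy) subr0 metric_sym.
have [x [d [od Ld]]] := dl_ex; have := rayL od; rewrite Ld => r.
exists x, (Gf x d dl); split; first exact: od.1.
  by split; [apply: out_ray_U; rewrite ?Ld ?dl_gt0 ?lexx|rewrite -Ld; exact: out_ray_end].
rewrite -{1}(ray0 r); apply: le_lt_trans (ray_lip r _ _) _; rewrite ?lexx ?(ltW dl_gt0)//.
by rewrite sub0r normrN gtr0_norm//; slra.
Qed.

Lemma ray_mdist x d t : outpair x d -> 0 <= t <= L x d -> mdist x (Gf x d t) <= t.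
Proof.
move=> od tL; rewrite -{1}(ray0 (rayL od)); apply: le_trans (ray_lip (rayL od) _ tL) _.
  by rewrite lexx; slra.
by rewrite sub0r normrN ger0_norm//; slra.
Qed.

Lemma set_dist_ray x d t : outpair x d -> 0 <= t <= dl -> set_dist X [set Gf x d t] = t.
Proof.
have dl0 := dl_gt0.
move=> od tl; have := dl_le od => dlL; apply: set_dist_bounds => [y _ Xy ->|eps eps0].
  have := tdist_lip (Gf x d t) y; rewrite (tdist_X Xy) tdist_ray//; last by slra.
  by rewrite (min_idPr _) ?subr0 ?(metric_sym y)//; slra.
exists x, (Gf x d t); split=> //; first exact: od.1.
by have := ray_mdist od (t := t) ltac:(slra); slra.
Qed.

(** * The truncation level set, which is the minimum set of the extremal function *)

Definition top_set : set Gamma := [set p | tdist p = dl].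

Lemma top_closed : closed top_set.
Proof.
have dl0 := dl_gt0.
rewrite -[top_set]setCK; apply: open_closedC; rewrite openE => p tp.
have tdl : tdist p < dl by rewrite lt_neqAle; have /andP[_ ->] := tdist_bound p; rewrite andbT; exact/eqP.
apply/nbhs_mdist; exists (dl - tdist p); first by slra.
move=> q pq tq; have := tdist_lip q p; rewrite metric_sym tq; slra.
Qed.

Lemma top_bd : bd top_set = [set p | U p /\ set_dist X [set p] = dl].
Proof.
have dl0 := dl_gt0.
apply/seteqP; split=> p.
  move=> [cp nip]; have tp : top_set p by rewrite (closure_id top_set).1//; exact: top_closed.
  have Xp : ~ X p by move=> /tdist_X E; move: tp; rewrite /top_set/= E; slra.
  (* Where no exit ray arrives at height [dl], all slopes are 0 and the point is interior to
     [top_set]. *)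
  suff [x [d [od pE]]] : exists x d, outpair x d /\ p = Gf x d dl.
    rewrite pE; split; first by apply: out_ray_U => //; rewrite dl_gt0 dl_le.
    by apply: set_dist_ray => //; slra.
  apply: contrapT => no; apply: nip; apply/nbhs_germ; split=> // d pd.
  have [[e e0 He]|[x [d' [od bg]]]] := tdist_germ_top Xp tp pd.
    by exists e => // h /He; rewrite mul0r addr0 tp.
  by case: no; exists x, d'; split=> //; exact: back_germ_end bg.
move=> [Up pX]; have tp : top_set p.
  apply: contrapT => tp.
  have tdl : tdist p < dl by rewrite lt_neqAle; have /andP[_ ->] := tdist_bound p; rewrite andbT; exact/eqP.
  have [x [d [t [od tl pE]]]] := tdist_lt (fun Xp => subX Xp Up) tdl.
  by move: pX; rewrite pE set_dist_ray//; slra.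
split; first exact: subset_closure.
move=> /nbhs_mdist[e e0 He].
(* With the margin [m = Num.min (e / 4) (dl / 2)], a walk from [X] to [p] of length less than
   [dl + m] is cut after length [dl - m]. The point [q] found there is within [2 * m < e] of [p], so
   [tdist q = dl], yet it is closer than [dl] to [X]. The bound [dl / 2] keeps the cutting length
   nonnegative. *)
have [x [Xx px]] : exists x, X x /\ mdist x p < dl + Num.min (e / 4) (dl / 2).
  have m0 : 0 < Num.min (e / 4) (dl / 2) by rewrite lt_min !divr_gt0.
  have hi : has_inf [set mdist x y | x in X & y in [set p]].
    split; first by exists (mdist x0 p), x0; [exact: connected_component_refl|exists p].
    by exists 0 => _ [y _ [z _ <-]]; exact: mdist_ge0.
  have [_ [x Xx [_ -> <-]]] := inf_adherent m0 hi.
  by rewrite -/(set_dist X [set p]) pX => H; exists x.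
have [r [wr rp]] : exists r, walk x p r /\ r < dl + Num.min (e / 4) (dl / 2).
  have [r wr rp] := inf_adherent (eps := dl + Num.min (e / 4) (dl / 2) - mdist x p) ltac:(slra) (walk_has_inf x p).
  by exists r; split=> //; move: rp; rewrite -/(walk_dist x p) -mdist_walk; slra.
have dr : dl <= r by have := tdist_lip p x; rewrite metric_sym tp (tdist_X Xx); have := walk_dist_le wr; rewrite -mdist_walk; slra.
have [m1 [m2 m3]] : Num.min (e / 4) (dl / 2) <= e / 4 /\ Num.min (e / 4) (dl / 2) <= dl / 2 /\ 0 < Num.min (e / 4) (dl / 2).
  by rewrite !ge_min !lexx orbT lt_min !divr_gt0.
have [|q [xq qp]] := walk_split wr (s := dl - Num.min (e / 4) (dl / 2)); first by slra.
have tq : tdist q = dl by apply: He; rewrite metric_sym; slra.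
by have := tdist_lip q x; rewrite tq (tdist_X Xx) metric_sym; slra.
Qed.

Lemma top_base : top_set v0.
Proof. by apply: tdist_top_V => //; exact: ucomp_base. Qed.

Lemma tdist_offU p : ~ U p -> ~ X p -> tdist p = dl.
Proof.
move=> Up Xp; apply: tdist_off => // x d t od tL pE; apply: Up; rewrite pE.
by apply: out_ray_U => //; slra.
Qed.

Lemma lt_tdist p : tdist p <> dl -> tdist p < dl.
Proof. by move=> tp; rewrite lt_neqAle; have /andP[_ ->] := tdist_bound p; rewrite andbT; exact/eqP. Qed.

Lemma ray_itv_connected x d (i : interval R) : outpair x d -> [set` i] `<=` `[0, L x d] ->
  connected (Gf x d @` [set` i]).
Proof.
move=> od iL; apply: lipschitz_itv_connected => s t /iL sL /iL tL.
by apply: (ray_lip (rayL od)); [move: sL|move: tL]; rewrite /= in_itv.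
Qed.

(* Pushes the open segments between [X] and [top_set] onto their ends in [top_set]. *)
Definition top_retract p : Gamma := xget p [set q |
  exists x d t, [/\ outpair x d, 0 < t < dl, p = Gf x d t & q = Gf x d dl]].

Lemma top_retract_ray x d t : outpair x d -> 0 < t < dl -> top_retract (Gf x d t) = Gf x d dl.
Proof.
move=> od tl; apply: xget_unique => [|q [x' [d' [t' [od' tl' E ->]]]]]; first by exists x, d, t.
have [h1 h2] := (dl_le od, dl_le od').
by have [||-> -> _ //] := ray_meet od od' _ _ E; slra.
Qed.

Lemma top_retract_id p : top_set p -> top_retract p = p.
Proof.
move=> tp; apply: xgetPN => q [x [d [t [od tl pE _]]]]; have h := dl_le od.
by move: tp; rewrite /top_set/= pE tdist_ray//; [rewrite (min_idPr _)|]; slra.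
Qed.

(** This set is the image of the connected set [U] under [top_retract]. Continuity at a point [p] of
    the set: a nearby [q] at height [t] on an exit ray has [dl - t <= mdist p q], as [tdist] is
    1-Lipschitz, so its image is within [2 * mdist p q] of [p]. *)
Lemma topU_connected : connected (U `&` top_set).
Proof.
have dl0 := dl_gt0.
have -> : U `&` top_set = top_retract @` U.
  apply/seteqP; split=> [p [Up tp]|_ [p Up <-]].
    by exists p => //; exact: top_retract_id.
  have [tp|/lt_tdist tp] := pselect (tdist p = dl); first by rewrite top_retract_id.
  have [x [d [t [od tl ->]]]] := tdist_lt (fun Xp => subX Xp Up) tp; have h := dl_le od.
  rewrite top_retract_ray//; split; first by apply: out_ray_U => //; slra.
  by rewrite /top_set/= tdist_ray ?minxx//; slra.
apply: connected_continuous_connected; first exact: ucomp_connected.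
apply/subspace_continuousP => p Up.
apply/metricType_numDomainType.cvgrPdist_lt => e e0; rewrite near_withinE.
have [tp|/lt_tdist tp] := pselect (tdist p = dl); last first.
  have [x [d [t [od tl pE]]]] := tdist_lt (fun Xp => subX Xp Up) tp; have h := dl_le od.
  have [ag _ _ C _] := rayL od.
  have oA : open (Gf x d @` `]0, dl[).
    by apply: (arc_sub_open (component_open_arc (decompVS dV fS).1 (C t _)) ag); slra.
  have : nbhs p (Gf x d @` `]0, dl[).
    by move: oA; rewrite openE; apply; rewrite pE; exists t => //=; rewrite in_itv.
  apply: filterS => _ [s /= + <-] _; rewrite in_itv/= pE => sl.
  by rewrite /from_subspace !top_retract_ray// mdistxx.
apply/nbhs_mdist; exists (e / 2); first by slra.
move=> q pq Uq; rewrite /from_subspace top_retract_id//.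
have [tq|/lt_tdist tq] := pselect (tdist q = dl); first by rewrite top_retract_id//; slra.
have [x [d [t [od tl qE]]]] := tdist_lt (fun Xq => subX Xq Uq) tq; have h := dl_le od.
have tqE : tdist q = t by rewrite qE tdist_ray ?(min_idPr _)//; slra.
have h1 := tdist_lip p q; have h2 := metric_triangle p q (Gf x d dl).
have h3 : mdist (Gf x d t) (Gf x d dl) <= `|t - dl| by apply: (ray_lip (rayL od)); slra.
rewrite -qE distrC ger0_norm in h3; last by slra.
by rewrite qE top_retract_ray//; slra.
Qed.

(** A component of the complement of [U] other than [X] lies in [top_set] and has an exit; [tdist]
    stays equal to [dl] at the beginning of that exit, which joins the component to the connected
    part inside [U]. *)
Lemma top_connected : connected top_set.
Proof.
have cU p : U p -> top_set p -> connected_component top_set v0 p.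
  move=> Up tp; apply: (connected_component_max _ _ topU_connected) => //.
    by split; [exact: ucomp_base|exact: top_base].
suff <- : connected_component top_set v0 = top_set by exact: component_connected.
apply/seteqP; split=> [|p tp]; first exact: connected_component_sub.
have [Up|Up] := pselect (U p); first exact: cU.
have Xp : ~ X p by move=> /tdist_X E; move: tp; rewrite /top_set/= E; have := dl_gt0; slra.
pose Y := connected_component (~` U) p.
have YX q : Y q -> ~ X q.
  by move=> Yq Xq; apply: Xp; apply: (connected_component_trans Xq); exact: connected_component_sym.
have Yt q : Y q -> top_set q.
  by move=> Yq; apply: tdist_offU (YX q Yq); exact: connected_component_sub Yq.
have [y [d [Yy od]]] := outpair_ex fS Sv0 Up.
have Uy : ~ U y by exact: connected_component_sub Yy.
have /ucomp_outdirsP[yd [e1 e10 He1]] := od.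
have [e2 e20 He2] := tdist_germ_off Uy (YX y Yy) yd.
have a0 := arm_length_gt0 yd.
have [h [h0 h1 h2 h3]] := exists_small e10 e20 a0.
have ty s : 0 < s < e2 -> top_set (shift_pt y d s).
  by move=> se; rewrite /top_set/= He2// mul0r addr0; exact: Yt.
apply: (connected_component_trans (y := shift_pt y d h)).
  by apply: cU; [apply: He1|apply: ty]; slra.
apply: connected_component_sym; apply: (connected_component_trans (y := y)); last first.
  apply: component_shift => //; [exact: Yt|slra|slra|move=> h' h'1; apply: ty; slra].
apply: (connected_component_max (B := Y)) => //; last exact: component_connected.
exact: connected_component_refl.
Qed.

Lemma segment_component p : ~ (X `|` top_set) p -> exists x d t, [/\ outpair x d, 0 < t < dl,
  p = Gf x d t & connected_component (~` (X `|` top_set)) p = arc_set dl (fun s => Gf x d (dl - s))].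
Proof.
move=> /not_orP[Xp /lt_tdist tp]; have [x [d [t [od tl pE]]]] := tdist_lt Xp tp.
have h := dl_le od; exists x, d, t; split=> //; rewrite arc_set_rev.
have [ag _ _ C _] := rayL od.
have H s : 0 < s < dl -> (~` (X `|` top_set)) (Gf x d s).
  move=> sl [/subX|]; first by apply; apply: out_ray_U => //; slra.
  by rewrite /top_set/= tdist_ray ?(min_idPr _)//; slra.
apply/seteqP; split; last first.
  apply: connected_component_max; last by apply: (arc_connected ag); slra.
    by rewrite pE; exists t => //=; rewrite in_itv.
  by move=> _ [s /= + <-]; rewrite in_itv/= => /H.
move=> q Cq; have /not_orP[Xq /lt_tdist tq] : ~ (X `|` top_set) q by exact: connected_component_sub Cq.
have [x' [d' [t' [od' tl' qE]]]] := tdist_lt Xq tq; have h' := dl_le od'.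
suff : connected_component (~` W) p q.
  rewrite pE C; last by slra.
  move=> [s /= + sq]; rewrite in_itv/= => sL; rewrite -sq in qE.
  have [||xx dd tt] := ray_meet od od' _ _ qE; [slra|slra|].
  by exists s => //=; rewrite in_itv/= tt.
apply: component_mono Cq => r Hr Wr; apply: Hr.
have [|/not_orP[Xr /lt_tdist tr]] := pselect ((X `|` top_set) r) => //.
have [y [e [s [oe sl rE]]]] := tdist_lt Xr tr; have h2 := dl_le oe.
by case: (ray_notin (rayL oe) (t := s)); [slra|rewrite -rE].
Qed.

Lemma tdist_extremal : basic_extremal v0 X top_set (fun p => - tdist p).
Proof.
have dl0 := dl_gt0; split.
- exact: tdist_rational.
- split; [exact: comp_closed|exact: component_connected|].
  by exists x0; exact: connected_component_refl.
- split; [exact: top_closed|exact: top_connected|exact: top_base].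
- by rewrite -subset0 => p [Xp]; rewrite /top_set/= tdist_X//; slra.
split=> [x y Xx|x y tx|].
- by rewrite (tdist_X Xx) oppr0 oppr_le0; have /andP[] := tdist_bound y.
- by rewrite tx lerN2; have /andP[] := tdist_bound y.
exists dl => p /segment_component[x [d [t [od tl pE ->]]]]; have h := dl_le od.
have [ag _ _ _ _] := rayL od.
have td s : 0 <= s <= dl -> tdist (Gf x d s) = s.
  by move=> sl; rewrite tdist_ray ?(min_idPr _)//; slra.
(* The exit ray is reversed, since slope 1 is required from the minimum set towards [X]. *)
exists (fun s => Gf x d (dl - s)), (Gf x d dl), x; split=> //.
- by have := arc_sub_rev (a := 0) (b := dl) ag; rewrite subr0; apply; slra.
- split; first by apply: td; slra.
  apply/lim0_cvg => e e0; exists (Num.min e dl); first by rewrite lt_min e0.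
  move=> s; rewrite lt_min => s1; apply: le_lt_trans (ray_lip (rayL od) _ _) _; [slra|slra|].
  by rewrite subKr ger0_norm; slra.
- split; first exact: od.1.
  apply/lim0_cvg_left => e e0; exists (Num.min e dl); first by rewrite lt_min e0.
  move=> s; rewrite lt_min => s1; rewrite subKr.
  by apply: le_lt_trans (ray_mdist od _) _; slra.
by move=> s r sl rl; rewrite !td; slra.
Qed.

Lemma connected_bd (Q K : set Gamma) : connected Q -> closed K -> Q `&` bd K = set0 ->
  (Q `&` K) !=set0 -> Q `<=` K.
Proof.
move=> cQ cK QK0 QK; suff <- : Q `&` K = Q by move=> x [].
apply: cQ => //; last by exists K.
exists (interior K); first exact: open_interior.
apply/seteqP; split=> x [Qx]; last by move=> /interior_subset.
move=> Kx; split=> //; apply: contrapT => iK.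
suff : (set0 : set Gamma) x by [].
by rewrite -QK0; split=> //; split=> //; exact: subset_closure.
Qed.

(** * Uniqueness of the extremal function up to a constant *)

Section Uniqueness.
Context (Xm : set Gamma) (f : Gamma -> R) (ext : basic_extremal v0 X Xm f)
  (bdXm : bd Xm = [set p | U p /\ set_dist X [set p] = dl]).

(** All points of [bd Xm] are at distance [dl] from [X], so a piece of an exit ray shorter than [dl]
    misses [bd Xm] and cannot lead from [X] into [Xm]. Conversely, a segment outside [X] and [Xm]
    that meets [top_set] misses the common boundary, hence stays in [top_set], although one of its
    ends tends to [X]. *)
Lemma extremal_min_set : Xm = top_set.
Proof.
have dl0 := dl_gt0.
case: ext => _ _ [clm cm mv0] disj [_ _ [l comps]].
apply/seteqP; split=> p.
  move=> mp; apply: contrapT => /lt_tdist tp.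
  have Xp : ~ X p by move=> Xp; suff : (set0 : set Gamma) p by []; rewrite -disj.
  have [x [d [t [od tl pE]]]] := tdist_lt Xp tp; have h := dl_le od.
  suff : (set0 : set Gamma) x by [].
  rewrite -disj; split; first exact: od.1.
  rewrite -(ray0 (rayL od)).
  apply: (connected_bd (Q := Gf x d @` `[0, t])) => //.
  - by apply: ray_itv_connected => // s; rewrite /= !in_itv/=; slra.
  - rewrite -subset0 => _ [[s /= + <-]]; rewrite in_itv/= bdXm => st [_].
    by rewrite set_dist_ray//; slra.
  - by exists p; split=> //; rewrite pE; exists t => //=; rewrite in_itv/=; slra.
  - by exists 0 => //=; rewrite in_itv/= lexx; slra.
move=> tp; apply: contrapT => mp.
have Xp : ~ X p by move=> /tdist_X E; move: tp; rewrite /top_set/= E; slra.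
have [|g [a [b [ag Cp _ [Xb gb] _]]]] := comps p; first by case.
have : arc_set l g `<=` top_set.
  rewrite -Cp; apply: connected_bd; [exact: component_connected|exact: top_closed| |].
    rewrite top_bd -bdXm -subset0 => q [/connected_component_sub Hq [+ _]].
    rewrite -(closure_id Xm).1// => mq; by apply: Hq; right.
  by exists p; split=> //; apply: connected_component_refl; case.
move=> gt; have [dd dd0 Hd] := (lim0_cvg_left l g b).2 gb dl dl0; have l0 := ag.1.
have [s [s0 s1 s2 _]] := exists_small dd0 l0 dd0.
have := Hd s ltac:(slra); have := tdist_lip (g (l - s)) b; rewrite (tdist_X Xb).
have -> : tdist (g (l - s)) = dl by apply: gt; exists (l - s) => //=; rewrite in_itv/=; slra.
by rewrite (metric_sym b); slra.
Qed.

(** A slope in a direction that meets one of the open segments is 1 or -1, because the germ and the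
    segment are both parametrized by arc length. In any other direction the germ stays in [X] and
    [Xm], where [f] takes at most two values, and the slope is 0. *)
Lemma extremal_lip p q : f p - f q <= mdist p q.
Proof.
have XmE := extremal_min_set; case: ext => rf _ _ _ [fmax fmin [l comps]].
have fX x y : X x -> X y -> f x = f y.
  by move=> Xx Xy; apply/eqP; rewrite eq_le !fmax.
have fm x y : Xm x -> Xm y -> f x = f y.
  by move=> Xx Xy; apply/eqP; rewrite eq_le !fmin.
have clXm : closed (X `|` Xm).
  by apply: closedU; [exact: comp_closed|rewrite XmE; exact: top_closed].
apply: local_lipschitz => {}p d pd; have [e e0 He] := rational_germ rf pd.
set k := outgoing_slope f p d in He.
suff k1 : `|k%:~R : R| <= 1.
  exists e => // h h1; rewrite He// addrAC subrr add0r normrM (gtr0_norm (x := h)); last by slra.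
  by rewrite -[leRHS]mul1r ler_wpM2r//; slra.
have r0 := rad_gt0 p.
have [[h [he hX]]|allX] := pselect (exists h, 0 < h < Num.min e (rad p) /\ ~ (X `|` Xm) (shift_pt p d h)).
  rewrite lt_min in he; have [g [a [b [ag Ch _ _ fg]]]] := comps _ hX.
  have oC : open (arc_set l g) by rewrite -Ch; apply: component_open; exact: closed_openC.
  have : arc_set l g (shift_pt p d h) by rewrite -Ch; exact: connected_component_refl.
  move=> [t /= + gt]; rewrite in_itv/= => tl.
  have [[e1 e10 He1] Hh] := ag.2 t tl; have [d1 d10 Hd1] := Hh _ e10.
  have [e2 e20 He2] : exists2 e2 : R, 0 < e2 & forall q, mdist (shift_pt p d h) q < e2 -> arc_set l g q.
    by apply/nbhs_mdist; move: oC; rewrite openE; apply; exists t => //=; rewrite in_itv.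
  have [|eta [eta0 eta1 eta2 eta3]] := @exists_small R d1 e2 (Num.min e (rad p) - h) d10 e20.
    by rewrite subr_gt0 lt_min; slra.
  rewrite ltrBrDl lt_min in eta3.
  have dE : mdist (shift_pt p d h) (shift_pt p d (h + eta)) = eta.
    by rewrite mdist_shift_same//; [rewrite opprD addrA subrr add0r normrN gtr0_norm|slra|slra].
  have [|s /= + gs] := He2 (shift_pt p d (h + eta)); first by rewrite dE.
  rewrite in_itv/= => sl; have st : `|s - t| < e1 by apply: Hd1 => //; rewrite gs gt dE.
  have := He1 s t st; rewrite subrr normr0 => /(_ e10); rewrite gs gt metric_sym dE => eE.
  have := fg t s tl sl; rewrite gs gt !He; [|slra|slra].
  rewrite opprD addrACA subrr add0r -mulrBr addrAC subrr add0r => kE.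
  have : `|k%:~R| * eta = eta by rewrite {2}eE -kE normrM (gtr0_norm eta0).
  by move=> /(canRL (mulfK (lt0r_neq0 eta0))) ->; rewrite divff// lt0r_neq0.
have kz (h1 h2 : R) : 0 < h1 -> h1 < h2 -> h2 < e -> f (shift_pt p d h1) = f (shift_pt p d h2) -> `|k%:~R : R| <= 1.
  move=> h10 h12 h2e; rewrite !He; [|slra|slra] => /addrI/eqP.
  rewrite -subr_eq0 -mulrBr mulf_eq0 => /orP[/eqP ->|]; first by rewrite normr0 ler01.
  by rewrite subr_eq0 => /eqP; slra.
have inX (h : R) : 0 < h < Num.min e (rad p) -> (X `|` Xm) (shift_pt p d h).
  by move=> h1; apply: contrapT => hX; apply: allX; exists h.
pose m := Num.min e (rad p); have m0 : 0 < m by rewrite lt_min e0.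
have me : m <= e by rewrite ge_min lexx.
(* Three points, so that two of them fall in the same of the two sets. *)
have [i1 i2 i3] : [/\ (X `|` Xm) (shift_pt p d (m / 4)), (X `|` Xm) (shift_pt p d (m / 3)) & (X `|` Xm) (shift_pt p d (m / 2))].
  by split; apply: inX; rewrite -/m; slra.
have [m1 [m2 [m3 m4]]] : 0 < m / 4 /\ m / 4 < m / 3 /\ m / 3 < m / 2 /\ m / 2 < e by slra.
case: i1 i2 i3 => [a1|a1] [a2|a2] [a3|a3];
 first [by apply: (kz _ _ m1 m2 (lt_trans m3 m4)); auto|by apply: (kz _ _ (lt_trans m1 m2) m3 m4); auto
   |by apply: (kz _ _ m1 (lt_trans m2 m3) m4); auto].
Qed.

(** On an open segment the increase of [f] up to [X] is the remaining arc length [l - s]. It is at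
    most the distance to [X] because [f] is 1-Lipschitz, and at least that distance because an arc
    is no shorter than the distance of its ends. On [top_set] the function is constant, and its
    value is found by approaching the end of a shortest exit ray. *)
Lemma extremalE : exists M : R, forall p, f p = M - tdist p.
Proof.
have dl0 := dl_gt0; have XmE := extremal_min_set; have lip := extremal_lip.
case: ext => rf _ _ _ [fmax fmin [l comps]].
have Xx0 : X x0 by exact: connected_component_refl.
have fX x : X x -> f x = f x0 by move=> Xx; apply/eqP; rewrite eq_le !fmax.
have segm p : ~ X p -> tdist p < dl -> f p = f x0 - tdist p.
  move=> Xp tp; have [x [d [t [od tl pE]]]] := tdist_lt Xp tp; have h := dl_le od.
  have Hp : ~ (X `|` Xm) p by rewrite XmE; case=> //; rewrite /top_set/=; slra.
  have [g [a [b [ag Cp _ [Xb gb] fg]]]] := comps p Hp.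
  have : arc_set l g p by rewrite -Cp; exact: connected_component_refl.
  move=> [s /= + gs]; rewrite in_itv/= => sl.
  have lg := local_isometry_lip (open_arc_local_isometry ag).
  have near (e : R) : 0 < e -> exists2 r, s < r < l & l - r < e /\ mdist b (g r) < e.
    move=> e0; have [d1 d10 Hd1] := (lim0_cvg_left l g b).2 gb e e0.
    have [|z [z0 z1 z2 z3]] := @exists_small R d1 e (l - s) d10 e0; first by slra.
    exists (l - z); first by slra.
    by rewrite subKr; split=> //; apply: Hd1; slra.
  have E1 : f x0 - f p = l - s.
    apply/eqP; rewrite eq_le; apply/andP; split; apply/ler_addgt0Pl => e e0.
      have [r rl [r1 r2]] := near e e0; have rl' : 0 < r < l by slra.
      have := fg s r sl rl'; rewrite gs; have := lip b (g r); rewrite (fX b Xb); slra.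
    have e20 : 0 < e / 2 by slra.
    have [r rl [r1 r2]] := near _ e20; have rl' : 0 < r < l by slra.
    by have := fg s r sl rl'; rewrite gs; have := lip (g r) b; rewrite (fX b Xb) metric_sym; slra.
  have tE : tdist p = t by rewrite pE tdist_ray ?(min_idPr _)//; slra.
  have E2 : l - s <= tdist p.
    rewrite -E1 tE pE; rewrite -[leRHS](set_dist_ray od (t := t)); last by slra.
    apply: lb_le_inf; first by exists (mdist x0 (Gf x d t)), x0 => //; exists (Gf x d t).
    by move=> _ [y Xy [_ -> <-]]; rewrite -(fX y Xy).
  have E3 : tdist p <= l - s.
    apply/ler_addgt0Pl => e e0; have [r rl [r1 r2]] := near e e0.
    have := tdist_lip p b; rewrite (tdist_X Xb); have := metric_triangle p (g r) b.
    have := lg s r sl ltac:(slra); rewrite gs (metric_sym b) in r2 *.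
    by rewrite distrC ger0_norm; slra.
  by slra.
exists (f x0) => p.
have [Xp|Xp] := pselect (X p); first by rewrite (fX p Xp) tdist_X ?subr0.
have [tp|/lt_tdist tp] := pselect (tdist p = dl); last exact: segm.
have [x [d [od Ld]]] := dl_ex; have h := dl_le od.
have te : top_set (Gf x d dl) by rewrite /top_set/= tdist_ray ?minxx//; slra.
have -> : f p = f (Gf x d dl).
  by apply/eqP; rewrite eq_le !fmin// XmE//.
rewrite tp; have key (z : R) : 0 < z < dl -> f (Gf x d (dl - z)) = f x0 - (dl - z) /\
   mdist (Gf x d dl) (Gf x d (dl - z)) <= z.
  move=> zl; have tz : tdist (Gf x d (dl - z)) = dl - z by rewrite tdist_ray ?(min_idPr _)//; slra.
  split; first by rewrite segm ?tz//; [move=> /subX; apply; apply: out_ray_U => //; slra|slra].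
  apply: (le_trans (ray_lip (rayL od) _ _)); [slra|slra|].
  by rewrite subKr ger0_norm; slra.
apply/eqP; rewrite eq_le; apply/andP; split; apply/ler_addgt0Pl => e e0.
  have [|z [z0 z1 z2 _]] := @exists_small R (e / 2) dl dl _ dl0 dl0; first by slra.
  have [k1 k2] := key z ltac:(slra); have := lip (Gf x d dl) (Gf x d (dl - z)); slra.
have [|z [z0 z1 z2 _]] := @exists_small R (e / 2) dl dl _ dl0 dl0; first by slra.
have [k1 k2] := key z ltac:(slra); have := lip (Gf x d (dl - z)) (Gf x d dl).
by rewrite metric_sym; slra.
Qed.

Lemma extremal_ord p : ord f p = ord (fun q => - tdist q) p.
Proof.
have [M fE] := extremalE; apply: eq_bigr => d pd.
have [e e0 He] := rational_germ tdist_rational pd.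
apply: germ_outgoing_slope; exists e => // h /He E.
by rewrite !fE; slra.
Qed.

End Uniqueness.

(** * The divisor of the truncated distance *)

Lemma germ_opp (f : Gamma -> R) p d k : germ f p d k -> germ (fun q => - f q) p d (- k).
Proof. by move=> [e e0 He]; exists e => // h /He ->; rewrite mulrNz opprD mulNr. Qed.

Lemma slope_oppE (f : Gamma -> R) p d k : germ f p d k -> outgoing_slope (fun q => - f q) p d = - k.
Proof. by move=> /germ_opp /germ_outgoing_slope. Qed.

Lemma sum_unique (s : seq Gamma) (P : Gamma -> direction G -> bool) (F : Gamma -> direction G -> bool) x1 d1 :
  uniq s -> x1 \in s -> P x1 d1 -> F x1 d1 ->
  (forall x d, P x d -> F x d -> x = x1 /\ d = d1) ->
  \sum_(x <- s) \sum_(d | P x d) (F x d : nat)%:Z = 1.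
Proof.
move=> us xs P1 F1 H; rewrite (bigD1_seq x1)//= (bigD1 d1)//= F1.
rewrite [X in _ + X]big1_seq => [|x /andP[xx _]].
  rewrite addr0 big1 ?addr0// => d /andP[Pd dd]; case Fd : (F x1 d) => //.
  by have [_ E] := H _ _ Pd Fd; rewrite E eqxx in dd.
apply: big1 => d Pd; case Fd : (F x d) => //.
by have [E _] := H _ _ Pd Fd; rewrite E eqxx in xx.
Qed.

(** With the two uniqueness lemmas that follow, this matches the exit rays that reach a point at
    height [dl] with the directions of slope -1 of [tdist] there. Counting both ways gives the order
    at the point. *)
Lemma back_germ_ex x d : outpair x d ->
  exists e, dir_at (Gf x d dl) e /\ back_germ (Gf x d dl) e x d.
Proof.
move=> od; have dl0 := dl_gt0; have := dl_le od; rewrite le_eqVlt => /orP[/eqP E|lt_dl].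
  have [_ _ _ _ [e [_ ge [eps e0 He]]]] := rayL od.
  by exists e; rewrite E; split=> //; exists eps => // h h1; rewrite {1}E He.
have [ag _ _ C _] := rayL od; have tL : 0 < dl < L x d by slra.
have oA := component_open_arc (decompVS dV fS).1 (C dl tL).
have [d1 [d2 [[_ gd2] dd _ [eps e0 He]]]] := open_arc_valence ag oA tL.
exists d2; split=> //; exists eps => // h h1.
have [->|h0] := eqVneq h 0; first by rewrite subr0 shift_pt0.
by apply: (He h _).2; rewrite lt_neqAle eq_sym h0; slra.
Qed.

Lemma back_germ_dir_unique p e e' x d : dir_at p e -> dir_at p e' ->
  back_germ p e x d -> back_germ p e' x d -> e = e'.
Proof.
move=> pe pe' [e1 e10 H1] [e2 e20 H2].
have [||_ //] := @germ_eq _ _ p p e e' (Num.min e1 e2) pe pe'; first by rewrite lt_min e10.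
by move=> t; rewrite lt_min => t1; rewrite -H1 -?H2//; slra.
Qed.

Lemma back_germ_ray_unique p e x d x' d' : outpair x d -> outpair x' d' ->
  back_germ p e x d -> back_germ p e x' d' -> x = x' /\ d = d'.
Proof.
move=> od od' [e1 e10 H1] [e2 e20 H2]; have dl0 := dl_gt0.
have [h1 h2] := (dl_le od, dl_le od').
have [h [h0 he1 he2 hd]] := exists_small e10 e20 dl0.
have E : Gf x d (dl - h) = Gf x' d' (dl - h) by rewrite H1 ?H2//; slra.
by have [||-> -> _ //] := ray_meet od od' _ _ E; slra.
Qed.

(** The divisor is written down explicitly: each exit takes a chip from its start [x] and puts one
    at [Gf x d dl]. Degree and signs are then evident, and the work is to recognize the orders of
    [- tdist]. *)
Lemma tdist_div : exists F : divisor G, [/\ is_div (fun p => - tdist p) F /\ deg F = 0,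
  forall p, X p -> coeff p F = - (#|outdirs (~` U) p|%:Z),
  forall p, U p -> 0 <= coeff p F, forall p, ~ U p -> ~ X p -> coeff p F = 0 &
  forall x d, outpair x d -> 1 <= coeff (Gf x d dl) F].
Proof.
have dl0 := dl_gt0.
have [s us Ss] : exists2 s : seq Gamma, uniq s & forall x, S x <-> x \in s.
  have [s sE] := (finite_seqP S).1 fS; exists (undup s); first exact: undup_uniq.
  by move=> x; rewrite mem_undup sE.
pose od x d := `[< outpair x d >].
pose F : divisor G := \sum_(x <- s) \sum_(d | od x d) (<< Gf x d dl >> - << x >>).
pose ends p := \sum_(x <- s) \sum_(d | od x d) (Gf x d dl == p : nat)%:Z.
pose starts p := \sum_(x <- s) \sum_(d | od x d) (x == p : nat)%:Z.
have cF p : coeff p F = ends p - starts p.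
  rewrite raddf_sum -sumrB; apply: eq_bigr => x _; rewrite raddf_sum -sumrB; apply: eq_bigr => d _.
  by rewrite raddfB /= !coeffU !mul1r !natz.
have ends0 p : ~ U p -> ends p = 0.
  move=> Up; apply: big1 => x _; apply: big1 => d /asboolP oxd; case: eqP => // E.
  by case: Up; rewrite -E; apply: out_ray_U => //; rewrite dl0 dl_le.
have ends_ge0 p : 0 <= ends p.
  by apply: sumr_ge0 => x _; apply: sumr_ge0.
have starts0 p : ~ X p -> starts p = 0.
  move=> Xp; apply: big1 => x _; apply: big1 => d /asboolP oxd; case: eqP => // E.
  by case: Xp; rewrite -E; exact: oxd.1.
have startsX p : X p -> starts p = #|outdirs (~` U) p|%:Z.
  move=> Xp; have odE d : od p d = (d \in outdirs (~` U) p).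
    by apply/asboolP/idP => [[]|h] //; split.
  have H x : x != p -> \sum_(d | od x d) (x == p : nat)%:Z = 0.
    by move=> xp; apply: big1 => d _; rewrite (negPf xp).
  have cE : \sum_(d | od p d) (p == p : nat)%:Z = #|outdirs (~` U) p|%:Z.
    by rewrite eqxx -sum1_card (big_morph Posz PoszD (erefl _)) (eq_bigl _ _ odE).
  have [ps|ps] := boolP (p \in s).
    by rewrite /starts (bigD1_seq p)//= cE big1 ?addr0// => x xp; exact: H.
  rewrite /starts big1_seq; last first.
    by move=> x /andP[_ xs]; apply: H; apply: contraNneq ps => <-.
  have -> : outdirs (~` U) p = finset.set0; last by rewrite cards0.
  apply/finset.setP => d; rewrite finset.in_set0; apply/negP => pd; case/negP: ps.
  have opd : outpair p d by split.
  by apply/Ss; exact: (outpair_S fS opd).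
have ordX p : X p -> ord (fun q => - tdist q) p = - starts p.
  move=> Xp; rewrite startsX// /ord (eq_bigr (fun d => - ((d \in outdirs (~` U) p) : nat)%:Z)); last first.
    by move=> d pd; exact/slope_oppE/tdist_germ_X.
  rewrite sumrN; congr (- _); rewrite -sum1_card (big_morph Posz PoszD (erefl _)) big_mkcond [RHS]big_mkcond/=.
  apply: eq_bigr => d _; case: (boolP (d \in _)) => [/ucomp_outdirsP[->]//|_].
  by case: ifP.
have ord_off p : ~ U p -> ~ X p -> ord (fun q => - tdist q) p = 0.
  move=> Up Xp; apply: big1 => d pd; rewrite -oppr0; exact/slope_oppE/tdist_germ_off.
have ends_ray p : tdist p <> dl -> ends p = 0.
  move=> tp; apply: big1 => x _; apply: big1 => d /asboolP oxd; case: eqP => // E.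
  have h := dl_le oxd.
  by case: tp; rewrite -E tdist_ray ?minxx//; slra.
have ord_ray p : ~ X p -> tdist p <> dl -> ord (fun q => - tdist q) p = 0.
  move=> Xp /lt_tdist tp; have [x [d [t [oxd tl pE]]]] := tdist_lt Xp tp.
  have [d1 [d2 [[gd1 gd2] dd H g1 g2]]] := tdist_germ_ray oxd tl.
  rewrite /ord pE (bigD1 d1)//= (bigD1 d2)/=; last by rewrite gd2; apply/eqP => /esym.
  rewrite (slope_oppE g1) (slope_oppE g2) big1 ?addr0//.
  by move=> d3 /andP[/andP[gd3 /eqP h1] /eqP h2]; case: (H d3 gd3).
have ord_top p : ~ X p -> tdist p = dl -> ord (fun q => - tdist q) p = ends p.
  move=> Xp tp.
  have E1 : ends p = \sum_(x <- s) \sum_(d | od x d) \sum_(e | dir_at p e) (`[< back_germ p e x d >] : nat)%:Z.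
    apply: eq_bigr => x _; apply: eq_bigr => d /asboolP oxd; case: eqP => [pE|pE].
      have [e] := back_germ_ex oxd; rewrite pE => -[pe bg].
      rewrite (bigD1 e)//= asboolT// big1 ?addr0// => e' /andP[pe' ee']; rewrite asboolF//.
      by move=> /(back_germ_dir_unique pe pe' bg) E; rewrite E eqxx in ee'.
    rewrite big1// => e pe; rewrite asboolF// => /(back_germ_end oxd pe) E.
    by rewrite E in pE.
  rewrite E1; under eq_bigr do rewrite exchange_big /=.
  rewrite exchange_big /=; apply: eq_bigr => e pe.
  have [g0|[x [d [oxd bg]]]] := tdist_germ_top Xp tp pe.
    rewrite (slope_oppE g0) oppr0 big1// => x _; rewrite big1// => d /asboolP oxd.
    rewrite asboolF// => /(back_germ_germ oxd pe)/germ_outgoing_slope.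
    by rewrite (germ_outgoing_slope g0).
  rewrite (slope_oppE (back_germ_germ oxd pe bg)) opprK; symmetry.
  apply: (sum_unique (x1 := x) (d1 := d)) => //; first by apply/Ss; exact: (outpair_S fS oxd).
  - exact/asboolP.
  - exact/asboolP.
  by move=> x' d' /asboolP oxd' /asboolP bg'; exact: (back_germ_ray_unique oxd' oxd bg' bg).
exists F; split; first split.
- move=> p; rewrite cF; have [Xp|Xp] := pselect (X p).
    by rewrite ordX// ends0 ?sub0r//; exact: subX.
  rewrite starts0// subr0; have [tp|tp] := pselect (tdist p = dl); first by rewrite ord_top.
  by rewrite ord_ray// ends_ray.
- rewrite raddf_sum big1// => x _; rewrite raddf_sum big1// => d _.
  by rewrite raddfB /= !degU subrr.
- by move=> p Xp; rewrite cF startsX// ends0 ?sub0r//; exact: subX.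
- by move=> p Up; rewrite cF starts0 ?subr0// => /subX.
- by move=> p Up Xp; rewrite cF starts0// ends0// subrr.
move=> x d oxd; rewrite cF starts0 ?subr0; last first.
  by move=> /subX; apply; apply: out_ray_U => //; rewrite dl0 dl_le.
rewrite /ends (bigD1_seq x)//=; last by apply/Ss; exact: (outpair_S fS oxd).
rewrite (bigD1 d)/=; last exact/asboolP.
rewrite eqxx -addrA lerDl addr_ge0//; apply: sumr_ge0 => // y _; exact: sumr_ge0.
Qed.

End ExtremalFunction.

(** * Moves *)

Section Moves.
Context {R : realType} (G : metric_graph R).
Local Notation Gamma := (realization G).
Implicit Types (p q v w x : Gamma) (d e : direction G) (g : R -> Gamma) (l h t : R)
  (V S : set Gamma) (D E F : divisor G).

(** The rays agree near their start. If they were reverses of each other, then [h = l - h] and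
    [h / 2 = l - h / 2] for the same small [h > 0]. *)
Lemma ray_start_unique V w d l g l' g' : arc_decomp V -> ray V w d l g -> ray V w d l' g' ->
  l = l' /\ forall s, 0 <= s <= l -> g s = g' s.
Proof.
move=> dV r r'; have [ag [Vw wd] [e1 e10 H1] _ _] := r; have [ag' _ [e2 e20 H2] _ _] := r'.
have [l0 l0'] := (ag.1, ag'.1).
have [m [m0 me1 me2 _]] := exists_small e10 e20 e10.
have [h [h0 hm hl hl']] := exists_small m0 l0 l0'.
have E t : 0 <= t < m -> g t = g' t by move=> tm; rewrite H1 ?H2//; slra.
have [ll [[_ _ _ H]|[gl _ hE _]]] := ray_eq r r' (t := h) (t' := h) ltac:(slra) ltac:(slra) (E h ltac:(slra)).
  by split.
have [_ [[_ _ _ H]|[_ _ hE' _]]] := ray_eq r r' (t := h / 2) (t' := h / 2) ltac:(slra) ltac:(slra) (E (h / 2) ltac:(slra)).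
  by split.
by exfalso; slra.
Qed.

(** Collects what the procedure needs from one component, with the choice of exit rays hidden. *)
Lemma component_move V S v0 x0 : arc_decomp V -> V v0 -> finite_set S -> ~ S v0 ->
  let U := ucomp S v0 in let X := connected_component (~` U) x0 in ~ U x0 ->
  exists Xm f F, [/\ basic_extremal v0 X Xm f /\
      bd Xm = [set p | U p /\ set_dist X [set p] = set_dist X (U `&` V)],
    is_div f F /\ deg F = 0,
    [/\ forall p, X p -> coeff p F = - (#|outdirs (~` U) p|%:Z),
        forall p, U p -> 0 <= coeff p F & forall p, ~ U p -> ~ X p -> coeff p F = 0],
    (exists w, [/\ U w, V w & 1 <= coeff w F]) /\
    (forall x d l g, X x -> d \in outdirs (~` U) x -> ray (V `|` S) x d l g ->
       exists2 t, 0 < t <= l & 1 <= coeff (g t) F) &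
    forall Xm' f' F', basic_extremal v0 X Xm' f' ->
      bd Xm' = [set p | U p /\ set_dist X [set p] = set_dist X (U `&` V)] ->
      is_div f' F' -> F' = F].
Proof.
move=> dV Vv0 fS Sv0 U X Ux0.
have [L [Gf [dl [rayL dl_le dl0 [x [d [od Ld]]]]]]] := out_rays_ex dV fS Sv0 Ux0.
have dl_ex : exists x d, outpair S v0 x0 x d /\ L x d = dl by exists x, d.
have sd : set_dist X (U `&` V) = dl by exact: (set_dist_verts dV Vv0 fS Sv0 rayL dl_le dl0 dl_ex).
have [F [[Fdiv Fdeg] FX FU Foff Fend]] := tdist_div dV Vv0 fS Sv0 rayL dl_le dl0.
exists (top_set S v0 x0 L Gf dl), (fun p => - tdist S v0 x0 L Gf dl p), F; rewrite sd; split.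
- split; first exact: (tdist_extremal dV Vv0 fS Sv0 Ux0 rayL dl_le dl0).
  exact: (top_bd dV Vv0 fS Sv0 Ux0 rayL dl_le dl0).
- by split.
- by split.
- split.
    exists (Gf x d dl); split; last exact: Fend.
      by apply: (out_ray_U dV Vv0 fS Sv0 rayL od); rewrite dl0 dl_le.
    by rewrite -Ld; exact: (out_ray_end dV Vv0 fS Sv0 rayL od).
  move=> y e l g Xy oe r; have oye : outpair S v0 x0 y e by split.
  have [lE gE] := ray_start_unique (decompVS dV fS) r (rayL y e oye).
  have h := dl_le y e oye; exists dl; first by rewrite lE dl0.
  by rewrite gE ?Fend// lE h ltW.
move=> Xm' f' F' ext bdE Fdiv'; apply/eqP/freeg_eqP => p; rewrite Fdiv Fdiv'.
exact: (extremal_ord dV Vv0 fS Sv0 Ux0 rayL dl_le dl0 dl_ex ext bdE).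
Qed.

Lemma supp_finite D : finite_set (supp D).
Proof.
apply/finite_seqP; exists (dom D); apply/seteqP.
by split=> p /=; rewrite mem_dom.
Qed.

(** Each component has an exit, and exits start in the finite set [S]. *)
Lemma components_finite V S v0 : arc_decomp V -> V v0 -> finite_set S -> ~ S v0 ->
  finite_set [set connected_component (~` ucomp S v0) x | x in ~` ucomp S v0].
Proof.
move=> dV Vv0 fS Sv0.
apply: (@sub_finite_set _ _ ((connected_component (~` ucomp S v0)) @` S)); last exact: finite_image.
move=> _ [x Ux <-]; have [y [d od]] := outpair_ex fS Sv0 Ux; exists y; first exact: (outpair_S fS od).
by apply/esym/same_connected_component; exact: od.1.
Qed.

Lemma outdirs_bd S v0 p : finite_set S -> ~ ucomp S v0 p -> (0 < #|outdirs (~` ucomp S v0) p|)%N ->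
  bd (~` ucomp S v0) p.
Proof.
move=> fS Up /card_gt0P[d /ucomp_outdirsP[pd [e e0 He]]]; split; first exact: subset_closure.
move=> /nbhs_germ[_ /(_ d pd)[e' e'0 He']].
have [h [h0 h1 h2 _]] := exists_small e0 e'0 e0.
by apply: (He' h); [slra|apply: He; slra].
Qed.

Lemma bd_ucomp S v0 p : finite_set S -> bd (~` ucomp S v0) p ->
  ~ ucomp S v0 p /\ (0 < #|outdirs (~` ucomp S v0) p|)%N.
Proof.
move=> fS [cp ip]; have Up : ~ ucomp S v0 p.
  move: cp; rewrite -(closure_id _).1//; apply: open_closedC; exact: ucomp_open.
split=> //; rewrite lt0n; apply/eqP => /card0_eq H; apply: ip; apply/nbhs_germ; split=> // d pd.
by have [|e e0 He] := ucomp_outdirsPn (v0 := v0) fS pd; [rewrite H|exists e].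
Qed.

Section Move.
Context (Om : set Gamma) (hOm : vertex_set Om) (v0 : Gamma) (S : set Gamma) (D : divisor G)
  (hD : effective D) (SD : S `<=` supp D `\ v0) (sat : all_saturated D v0 S).
Local Notation U := (ucomp S v0).
Local Notation V := (Om `|` [set v0]).

Lemma base_decomp : arc_decomp V.
Proof. by apply: arc_decompU1; exact: vertex_set_arc_decomp. Qed.

Lemma base_in : V v0.
Proof. by right. Qed.

Lemma move_finite : finite_set S.
Proof. by apply: sub_finite_set (supp_finite D) => x /SD []. Qed.

Lemma move_base : ~ S v0.
Proof. by move=> /SD[_] /=. Qed.

Let move_comp x0 := @component_move V S v0 x0 base_decomp base_in move_finite move_base.

(** A point outside [U] lies in exactly one component and loses one chip per direction into [U],
    which is its outdegree: saturation is exactly what keeps the result effective. *)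
Lemma move_ex : exists E, [/\ v0_move Om v0 D S 1 E, effective E /\ deg E = deg D,
   forall p, U p -> coeff p D <= coeff p E,
   S !=set0 -> exists w, [/\ U w, V w & coeff w D < coeff w E] &
   forall x d l g, ~ U x -> d \in outdirs (~` U) x -> ray (V `|` S) x d l g ->
       exists2 t, 0 < t <= l & coeff (g t) D < coeff (g t) E].
Proof.
have [s us Es] : exists2 s : seq (set Gamma), uniq s &
    [set connected_component (~` U) x | x in ~` U] = [set` s].
  have [s sE] := (finite_seqP _).1 (components_finite base_decomp base_in move_finite move_base).
  exists (undup s); first exact: undup_uniq.
  by rewrite sE; apply/seteqP; split=> A /=; rewrite mem_undup.
pose X (j : 'I_(size s)) := tnth (in_tuple s) j.
have Xinj : injective X by apply/tuple_uniqP.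
have Xcomp j : exists2 x, ~ U x & X j = connected_component (~` U) x.
  have : [set` s] (X j) by rewrite /= mem_tnth.
  by rewrite -Es => -[x Ux <-]; exists x.
have XU j p : X j p -> ~ U p by have [x Ux ->] := Xcomp j; move=> /connected_component_sub.
have /choice[Fs HFs] : forall j, exists z : set Gamma * (Gamma -> R) * divisor G,
    [/\ basic_extremal v0 (X j) z.1.1 z.1.2 /\
      bd z.1.1 = [set p | U p /\ set_dist (X j) [set p] = set_dist (X j) (U `&` V)],
    is_div z.1.2 z.2 /\ deg z.2 = 0,
    [/\ forall p, X j p -> coeff p z.2 = - (#|outdirs (~` U) p|%:Z),
        forall p, U p -> 0 <= coeff p z.2 & forall p, ~ U p -> ~ X j p -> coeff p z.2 = 0],
    (exists w, [/\ U w, V w & 1 <= coeff w z.2]) &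
    (forall x d l g, X j x -> d \in outdirs (~` U) x -> ray (V `|` S) x d l g ->
       exists2 t, 0 < t <= l & 1 <= coeff (g t) z.2)].
  move=> j; have [x Ux ->] := Xcomp j; have [Xm [f [F [H1 H2 H3 [H4 H5] _]]]] := move_comp Ux.
  by exists (Xm, f, F); split.
pose F j := (Fs j).2; pose E := D + \sum_j F j.
have cE p : coeff p E = coeff p D + \sum_j coeff p (F j) by rewrite coeffD raddf_sum.
have EU p : U p -> coeff p D <= coeff p E.
  by move=> Up; rewrite cE lerDl; apply: sumr_ge0 => j _; have [_ _ [_ H _] _ _] := HFs j; exact: H.
have Xex x : ~ U x -> exists j, X j x.
  move=> Ux; have : [set` s] (connected_component (~` U) x) by rewrite -Es; exists x.
  move=> /= /(tnthP (in_tuple s))[j jE]; exists j; rewrite /X -jE.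
  exact: connected_component_refl.
have Xuniq j j' x : X j x -> X j' x -> j = j'.
  move=> jx jx'; apply: Xinj; have [y Uy E1] := Xcomp j; have [y' Uy' E2] := Xcomp j'.
  rewrite E1 in jx *; rewrite E2 in jx' *.
  by rewrite (same_connected_component jx) (same_connected_component jx').
have EnU p : ~ U p -> coeff p E = coeff p D - #|outdirs (~` U) p|%:Z.
  move=> Up; have [j jp] := Xex p Up; rewrite cE (bigD1 j)//= big1 ?addr0 => [|i ij].
    by have [_ _ [H _ _] _ _] := HFs j; rewrite -H.
  have [_ _ [_ _ H] _ _] := HFs i; apply: H => // ip.
  by rewrite (Xuniq _ _ _ ip jp) eqxx in ij.
have gain j p : U p -> 1 <= coeff p (F j) -> coeff p D < coeff p E.
  move=> Up H; rewrite cE ltrDl (bigD1 j)//= ltr_pwDl ?(lt_le_trans _ H)//.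
  by apply: sumr_ge0 => i _; have [_ _ [_ H' _] _ _] := HFs i; exact: H'.
exists E; split=> //.
- split=> //; first by rewrite ler01 lexx.
  rewrite oner_eq0; exists (size s), X, (fun j => (Fs j).1.1), (fun j => (Fs j).1.2), F.
  split=> //.
  + rewrite Es; apply/seteqP; split=> [_ [j _ <-]|A /=]; first by rewrite /= mem_tnth.
    by move=> /(tnthP (in_tuple s))[j ->]; exists j.
  + by move=> j; rewrite mul1r; have [] := HFs j.
  + by move=> j; have [_ []] := HFs j.
- split; last by rewrite raddfD raddf_sum /= big1 ?addr0// => j _; have [_ []] := HFs j.
  move=> p; have [Up|Up] := pselect (U p); first exact: le_trans (hD p) (EU p Up).
  rewrite EnU// subr_ge0; have [c0|c0] := posnP #|outdirs (~` U) p|.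
    by rewrite c0; exact: hD.
  by have := sat (outdirs_bd move_finite Up c0); rewrite /saturated outdeg_card.
- move=> [x Sx]; have [j jx] := Xex x (fun Ux => ucomp_sub Ux Sx).
  have [_ _ _ [w [Uw Vw H]] _] := HFs j; exists w; split=> //; exact: (gain j).
move=> x d l g Ux od r; have [j jx] := Xex x Ux; have [_ _ _ _ H] := HFs j.
have [t tl Ht] := H x d l g jx od r; exists t => //; apply: (gain j) => //.
have [H1 [H2 _]] := out_ray base_decomp base_in move_finite move_base r Ux od.
have [->//|tn] := eqVneq t l; apply: H1; case/andP: tl => -> tl /=.
by rewrite lt_neqAle tn.
Qed.

(** By uniqueness on each component, [F j] depends only on the set [X j]. Both families enumerate
    the components without repetition, so the two sums differ by a permutation. *)
Lemma move_unique E E' : v0_move Om v0 D S 1 E -> v0_move Om v0 D S 1 E' -> E = E'.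
Proof.
move=> [_ _ _ _]; rewrite oner_eq0 => -[J [X [Xm [f [F [iX rX H1 H2 ->]]]]]].
move=> [_ _ _ _]; rewrite oner_eq0 => -[J' [X' [Xm' [f' [F' [iX' rX' H1' H2' ->]]]]]].
have /choice[Phi HPhi] : forall A : set Gamma, exists F0 : divisor G,
    [set connected_component (~` U) x | x in ~` U] A -> forall Ym k K, basic_extremal v0 A Ym k ->
      bd Ym = [set p | U p /\ set_dist A [set p] = set_dist A (U `&` V)] -> is_div k K -> K = F0.
  move=> A; have [[x Ux <-]|no] := pselect ([set connected_component (~` U) x | x in ~` U] A); last by exists 0.
  by have [Ym [k [K [_ _ _ _ HK]]]] := move_comp Ux; exists K.
have FE j : F j = Phi (X j).
  have [ext bdE] := H1 j; rewrite mul1r in bdE.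
  by apply: (HPhi (X j) _ _ _ _ ext bdE (H2 j)); rewrite -rX; exists j.
have FE' j : F' j = Phi (X' j).
  have [ext bdE] := H1' j; rewrite mul1r in bdE.
  by apply: (HPhi (X' j) _ _ _ _ ext bdE (H2' j)); rewrite -rX'; exists j.
congr (D + _); rewrite (eq_bigr _ (fun j _ => FE j)) (eq_bigr _ (fun j _ => FE' j)).
rewrite -(big_map X xpredT Phi) -(big_map X' xpredT Phi); apply: perm_big.
apply: uniq_perm; [by rewrite map_inj_uniq ?index_enum_uniq|by rewrite map_inj_uniq ?index_enum_uniq|].
have mem (n : nat) (Z : 'I_n -> set Gamma) A : (A \in [seq Z j | j <- index_enum _]) <-> range Z A.
  split=> [/mapP[j _ ->]|[j _ <-]]; first by exists j.
  by apply: map_f; rewrite mem_index_enum.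
by move=> A; apply/idP/idP => /mem; rewrite ?rX ?rX' => H; apply/mem; rewrite ?rX ?rX'.
Qed.

End Move.
End Moves.

(** * Dhar's algorithm *)

Section Dhar.
Context {R : realType} (G : metric_graph R).
Local Notation Gamma := (realization G).
Implicit Types (p q v w x b : Gamma) (d e : direction G) (g : R -> Gamma) (l h t s : R)
  (V S B : set Gamma) (D : divisor G).

Lemma dhar_set_sub D v0 k : dhar_set D v0 k `<=` supp D `\ v0.
Proof. by elim: k => // k IH x /= [/IH]. Qed.

Lemma dhar_set_finite D v0 k : finite_set (dhar_set D v0 k).
Proof. by apply: sub_finite_set (supp_finite D) => x /dhar_set_sub[]. Qed.

(** Every boundary point belongs to the current set, so a round that removes nothing has only
    saturated boundary points and is a stopping round. Any other round shortens the list of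
    remaining points. *)
Lemma dhar_output_ex D v0 : effective D -> exists S, dhar_output D v0 S.
Proof.
move=> D0; suff : exists k, `[< dhar_stop D v0 (dhar_set D v0 k) >].
  move=> ex; have [k /asboolP Hk min] := ex_minnP ex.
  exists (dhar_set D v0 k); split=> //; exists k; split=> // j jk /asboolP/min.
  by rewrite leqNgt jk.
apply: contrapT => no; have [s0 s0E] := (finite_seqP _).1 (dhar_set_finite D v0 0).
suff H k : exists s : seq Gamma, dhar_set D v0 k = [set` s] /\ (size s + k <= size s0)%N.
  have [s [_]] := H (size s0).+1.
  by rewrite addnS ltnNge leq_addl.
elim: k => [|k [s [sE sk]]]; first by exists s0; rewrite addn0.
exists [seq x <- s | `[< dhar_set D v0 k.+1 x >]]; split.
  apply/seteqP; split=> x /=; rewrite mem_filter.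
    by move=> Hx; apply/andP; split; [exact/asboolP|case: Hx => + _; rewrite sE].
  by move=> /andP[/asboolP].
apply: leq_trans sk; rewrite addnS -addSn leq_add2r size_filter ltn_neqAle count_size andbT.
rewrite -all_count; apply/negP => /allP H; apply: no; exists k; apply/asboolP; right=> v bv.
have [Uv /card_gt0P[d od]] := bd_ucomp (dhar_set_finite D v0 k) bv.
have vs : v \in s by have := outdirs_in_S (dhar_set_finite D v0 k) Uv od; rewrite sE.
by have /asboolP[_ K] := H v vs; apply: contrapT => sat; apply: K.
Qed.

Lemma dhar_output_unique D v0 S S' : dhar_output D v0 S -> dhar_output D v0 S' -> S = S'.
Proof.
move=> [_ [k [Hk min ->]]] [_ [k' [Hk' min' ->]]].
by have [/min'|/min|->] := ltngtP k k'.
Qed.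

Lemma dhar_outputP D v0 S : dhar_output D v0 S -> S !=set0 ->
  [/\ effective D, S `<=` supp D `\ v0, all_saturated D v0 S & exists k, S = dhar_set D v0 k].
Proof.
move=> [D0 [k [[E|Hk] _ ->]]] [x Sx]; first by rewrite E in Sx.
by split=> //; [exact: dhar_set_sub|exists k].
Qed.

(** A germ at a point of [V] is the start of a ray; any other point is inside a ray and has only the
    two directions of that ray. *)
Lemma ray_open V A : arc_decomp V ->
  (forall w d l g t, ray V w d l g -> 0 <= t <= l -> A (g t) ->
     exists2 eps : R, 0 < eps & forall s, 0 < s < l -> `|s - t| < eps -> A (g s)) -> open A.
Proof.
move=> dV H; apply/open_germ => p Ap d pd; have [Vp|Vp] := pselect (V p).
  have [l [g r]] := ray_ex dV Vp pd; have [ag _ [e e0 He] _ _] := r; have l0 := ag.1.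
  have [||e' e'0 He'] := H _ _ _ _ 0 r; [slra|by rewrite (ray0 r)|].
  exists (Num.min (Num.min e e') l); first by rewrite !lt_min e0 e'0.
  move=> h; rewrite !lt_min => h1; rewrite -He; last by slra.
  by apply: He'; rewrite ?subr0 ?gtr0_norm; slra.
have [w [e [l [g [t [r [tl pE]]]]]]] := ray_cover dV Vp; have [ag _ _ C _] := r.
have oA := component_open_arc dV.1 (C t tl).
have [d1 [d2 [_ _ Hd [e1 e10 He]]]] := open_arc_valence ag oA tl.
have [||e' e'0 He'] := H _ _ _ _ t r; [slra|by rewrite -pE|].
have [m [m0 m1 m2 m3]] : exists m : R, [/\ 0 < m, m <= e1, m <= e' & m <= t /\ m <= l - t].
  exists (Num.min (Num.min e1 e') (Num.min t (l - t))).
  by rewrite !lt_min !ge_min !lexx ?orbT e10 e'0; split=> //; slra.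
exists m => // h hm; rewrite pE in pd *.
have [E1 E2] := He h ltac:(slra).
have [->|->] := Hd d pd; rewrite -?E1 -?E2; apply: He'; try slra.
  by rewrite addrAC subrr add0r gtr0_norm; slra.
by rewrite addrAC subrr add0r normrN gtr0_norm; slra.
Qed.

(** * Fire enclosed by chips *)

Section Blocked.
Context (V B : set Gamma) (v0 : Gamma) (D : divisor G) (dV : arc_decomp V) (BV : B `<=` V)
  (Bv0 : B v0) (D0 : effective D)
  (blocked : forall b d l g, B b -> ray V b d l g -> ~ B (g l) ->
     exists2 t, 0 < t < l & coeff (g t) D != 0).

(** [sg b d] is how far one may go from [b] in direction [d]: up to the end of the ray if that end
    is in [B], otherwise up to a chosen chip. *)
Let cut : exists (sg L : Gamma -> direction G -> R) (g : Gamma -> direction G -> R -> Gamma),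
  forall b d, B b -> dir_at b d ->
  [/\ ray V b d (L b d) (g b d), 0 < sg b d <= L b d,
      B (g b d (L b d)) -> sg b d = L b d &
      ~ B (g b d (L b d)) -> sg b d < L b d /\ coeff (g b d (sg b d)) D != 0].
Proof.
have /choice[F HF] : forall z : Gamma * direction G, exists y : R * R * (R -> Gamma),
    B z.1 -> dir_at z.1 z.2 ->
    [/\ ray V z.1 z.2 y.1.2 y.2, 0 < y.1.1 <= y.1.2,
      B (y.2 y.1.2) -> y.1.1 = y.1.2 &
      ~ B (y.2 y.1.2) -> y.1.1 < y.1.2 /\ coeff (y.2 y.1.1) D != 0].
  move=> [b d] /=; have [[Bb bd]|no] := pselect (B b /\ dir_at b d); last first.
    by exists (0, 0, fun=> b) => Bb bd; case: no.
  have [l [g r]] := ray_ex dV (BV Bb) bd; have l0 : 0 < l by case: r => -[].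
  have [Bl|Bl] := pselect (B (g l)); first by exists (l, l, g); split=> //; rewrite l0 lexx.
  by have [t tl ct] := blocked Bb r Bl; exists (t, l, g) => _ _; split=> //=; [slra|split=> //; slra].
exists (fun b d => (F (b, d)).1.1), (fun b d => (F (b, d)).1.2), (fun b d => (F (b, d)).2).
by move=> b d; exact: (HF (b, d)).
Qed.

(* [T] is what can be reached from [B] without crossing the chosen chips on the
   segments that leave [B], and [Y] consists of these chips; from [T], a point of
   [Y] can only be approached in one direction. *)
Lemma blocked_separation : exists T Y : set Gamma,
  [/\ T `&` V = B, open T, open (~` (T `|` Y)),
      forall y, Y y -> [/\ ~ T y, ~ V y & coeff y D != 0] &
      forall y, Y y -> exists d, forall d', dir_at y d' -> d' != d ->
        forall eps : R, 0 < eps -> exists2 h, 0 < h < eps & ~ T (shift_pt y d' h)].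
Proof.
have [sg [L [gv Hgv]]] := cut.
pose T p := B p \/ exists b d t, [/\ B b, dir_at b d, 0 < t < sg b d & p = gv b d t].
pose Y p := exists b d, [/\ B b, dir_at b d, ~ B (gv b d (L b d)) & p = gv b d (sg b d)].
(* A ray can be read from both ends. The two readings do not conflict: if both ends are in [B]
   neither is cut, and if only one is, no cut comes from the other. *)
have T_ray b d s : B b -> dir_at b d -> 0 < s < L b d -> T (gv b d s) -> s < sg b d.
  move=> Bb bd sL; have [r sgL BL _] := Hgv b d Bb bd.
  case=> [/BV/(ray_notin r sL)//|[b' [d' [t [Bb' bd' tb E]]]]].
  have [r' sgL' _ _] := Hgv b' d' Bb' bd'.
  have [_ [[b1 d1 t1 _]|[b1 _ _ _]]] := ray_eq r r' sL (t' := t) ltac:(slra) E.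
    by rewrite b1 d1 t1; slra.
  by rewrite BL ?b1//; slra.
have Y_ray b d s : B b -> dir_at b d -> 0 < s < L b d -> Y (gv b d s) -> s = sg b d.
  move=> Bb bd sL [b' [d' [Bb' bd' nB E]]]; have [r _ _ _] := Hgv b d Bb bd.
  have [r' sgL' _ /(_ nB)[sgL'' _]] := Hgv b' d' Bb' bd'.
  have [_ [[-> -> -> _]//|[_ b1 _ _]]] := ray_eq r r' sL (t' := sg b' d') ltac:(slra) E.
  have [Ll _] := ray_eq r r' sL (t' := sg b' d') ltac:(slra) E.
  by rewrite -Ll b1 in nB.
have off w d l g s : ray V w d l g -> ~ B w -> ~ B (g l) -> 0 < s < l -> ~ T (g s) /\ ~ Y (g s).
  move=> r Bw Bl sl; have key b' d' t : B b' -> dir_at b' d' -> 0 < t < L b' d' -> g s <> gv b' d' t.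
    move=> Bb' bd' tL E; have [r' _ _ _] := Hgv b' d' Bb' bd'.
    by have [_ [[E1 _ _ _]|[E1 _ _ _]]] := ray_eq r r' sl tL E; [apply: Bw|apply: Bl]; rewrite E1.
  split.
    case=> [/BV/(ray_notin r sl)//|[b' [d' [t [Bb' bd' tb E]]]]].
    by have [_ sL _ _] := Hgv b' d' Bb' bd'; apply: (key b' d' t) E => //; slra.
  move=> [b' [d' [Bb' bd' nB E]]]; have [_ sL _ /(_ nB)[sL' _]] := Hgv b' d' Bb' bd'.
  by apply: (key b' d' (sg b' d')) E => //; slra.
have TV p : T p -> V p -> B p.
  case=> // -[b [d [t [Bb bd tb ->]]]]; have [r sL _ _] := Hgv b d Bb bd.
  by move=> /(ray_notin r) []; slra.
have YnV p : Y p -> ~ V p.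
  move=> [b [d [Bb bd nB ->]]]; have [r sL _ /(_ nB)[sL' _]] := Hgv b d Bb bd.
  by apply: (ray_notin r); slra.
have gvE b d l g : B b -> ray V b d l g -> dir_at b d /\ l = L b d /\ forall s, 0 <= s <= l -> g s = gv b d s.
  move=> Bb r; have bd : dir_at b d by case: r => _ [].
  by have [r' _ _ _] := Hgv b d Bb bd; have [] := ray_start_unique dV r r'.
have rayA (A : set Gamma) :
    (forall b d t, B b -> dir_at b d -> 0 <= t <= L b d -> A (gv b d t) ->
       exists2 eps : R, 0 < eps & forall s, 0 < s < L b d -> `|s - t| < eps -> A (gv b d s)) ->
    (forall w d l g t, ray V w d l g -> ~ B w -> ~ B (g l) -> 0 <= t <= l -> A (g t) ->
       forall s, 0 < s < l -> A (g s)) -> open A.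
  move=> H1 H2; apply: (ray_open dV) => w d l g t r tl At.
  have fwd w' d' g' t' : B w' -> ray V w' d' l g' -> 0 <= t' <= l -> A (g' t') ->
      exists2 eps : R, 0 < eps & forall s, 0 < s < l -> `|s - t'| < eps -> A (g' s).
    move=> Bw r' tl'; have [wd' [lE gE]] := gvE _ _ _ _ Bw r'; rewrite gE// => At'.
    have [|e e0 He] := H1 w' d' t' Bw wd' _ At'; first by rewrite -lE.
    exists e => // s sl se; rewrite gE; last by slra.
    by apply: He => //; rewrite -lE.
  have [Bw|Bw] := pselect (B w); first exact: fwd r tl At.
  have [Bl|Bl] := pselect (B (g l)); last by exists 1 => // s sl _; exact: H2 r Bw Bl tl At s sl.
  have [d' r'] := ray_rev r.
  have [||e e0 He] := fwd _ _ _ (l - t) Bl r'; [slra|by rewrite subKr|].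
  exists e => // s sl se; have := He (l - s); rewrite subKr; apply; first by slra.
  by move: se; rewrite !ltr_distl; slra.
have oT : open T.
  apply: rayA => [b d t Bb bd tL Tt|w d l g t r Bw Bl tl Tt s sl]; last first.
    have [_ [Vw _] _ _ [_ [Vl _ _]]] := r.
    have [t0|t0] := eqVneq t 0; first by case: Bw; rewrite -(ray0 r) -t0; apply: TV; rewrite // t0 (ray0 r).
    have [t1|t1] := eqVneq t l; first by case: Bl; apply: TV => //; rewrite -t1.
    by case: (off _ _ _ _ t r Bw Bl) => //; rewrite !lt_neqAle t1 eq_sym t0.
  have [r sL BL _] := Hgv b d Bb bd.
  have inT s : 0 < s < sg b d -> T (gv b d s) by move=> sb; right; exists b, d, s.
  have [tL'|tL'] := eqVneq t (L b d).
    have Bl : B (gv b d (L b d)).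
      by have [_ _ _ _ [_ [Vl _ _]]] := r; apply: TV; rewrite // -tL'.
    exists (L b d); first by slra.
    by move=> s sl _; apply: inT; rewrite BL.
  have tsg : t < sg b d.
    have [->|t0] := eqVneq t 0; first by slra.
    by apply: T_ray => //; rewrite !lt_neqAle tL' eq_sym t0.
  exists (sg b d - t); first by slra.
  by move=> s sl; rewrite ltr_distl => se; apply: inT; slra.
exists T, Y; split=> //.
- apply/seteqP; split=> [p [Tp /(TV _ Tp)]//|p Bp].
  by split; [left|exact: BV].
- apply: rayA => [b d t Bb bd tL nTY|w d l g t r Bw Bl tl _ s sl]; last first.
    by have [h1 h2] := off _ _ _ _ s r Bw Bl sl; case.
  have [r sL BL nBL] := Hgv b d Bb bd.
  have tsg : sg b d < t.
    have [tL'|tL'] := eqVneq t (L b d).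
      by rewrite tL'; apply: (nBL _).1 => Bl; apply: nTY; left; left; rewrite tL'.
    rewrite ltNge; apply/negP => tsg.
    have [t0|t0] := eqVneq t 0; first by apply: nTY; left; left; rewrite t0 (ray0 r).
    have [ts|ts] := eqVneq t (sg b d).
      apply: nTY; right; exists b, d; split=> //; last by rewrite ts.
      by move=> /BL E; rewrite ts E eqxx in tL'.
    by apply: nTY; left; right; exists b, d, t; split=> //; rewrite !lt_neqAle ts eq_sym t0; slra.
  exists (t - sg b d); first by slra.
  move=> s sl; rewrite ltr_distl => se [/T_ray|/Y_ray] H.
    by have := H Bb bd sl; slra.
  by have := H Bb bd sl; slra.
- move=> y /[dup] yY [b [d [Bb bd nB yE]]]; have [r sL _ /(_ nB)[sL' cy]] := Hgv b d Bb bd.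
  split; [|exact: YnV|by rewrite yE].
  by rewrite yE => /T_ray H; have := H Bb bd; slra.
move=> y [b [d [Bb bd nB yE]]]; have [r sL _ /(_ nB)[sL' _]] := Hgv b d Bb bd.
have sl : 0 < sg b d < L b d by slra.
have [ag _ _ C _] := r; have oA := component_open_arc dV.1 (C _ sl).
have [d1 [d2 [_ _ Hd [e e0 He]]]] := open_arc_valence ag oA sl.
rewrite yE; exists d2 => d' yd' dd' eps eps0.
have -> : d' = d1 by case: (Hd d' yd') dd' => // ->; rewrite eqxx.
have [|h [h0 h1 h2 h3]] := @exists_small R e eps (L b d - sg b d) e0 eps0; first by slra.
exists h; first by slra.
have [<- _] := He h ltac:(slra); move=> /T_ray H.
by have := H Bb bd ltac:(slra); slra.
Qed.

(** By induction [Y] stays in every [dhar_set D v0 j]. As long as it does, the connected set [U] is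
    contained in [T], so a point of [Y] has at most one direction into [U] and at least one chip: it
    is saturated and not removed. *)
Lemma dhar_blocked k : ucomp (dhar_set D v0 k) v0 `&` V `<=` B.
Proof.
have [T [Y [TB oT oTY HY HY1]]] := blocked_separation.
have UT S : finite_set S -> ~ S v0 -> Y `<=` S -> ucomp S v0 `<=` T.
  move=> fS Sv0 YS; apply: (connected_split (B := ~` (T `|` Y))) => //.
  - exact: ucomp_connected.
  - move=> x Ux; have [Tx|Tx] := pselect (T x); first by left.
    by right=> -[//|/YS]; exact: ucomp_sub Ux.
  - by rewrite -subset0 => x [[_ Tx]]; apply; left.
  - exists v0; split; first exact: ucomp_base.
    by have [] : (T `&` V) v0 by rewrite TB.
have v0n j : ~ dhar_set D v0 j v0 by move=> /dhar_set_sub[_]; apply.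
have YS j : Y `<=` dhar_set D v0 j.
  elim: j => [|j IH] y Yy /=.
    have [_ nV cy] := HY y Yy; split=> //= yv; apply: nV; rewrite yv; exact: BV.
  split; first exact: IH.
  move=> [_]; apply; rewrite /saturated outdeg_card.
  have [d Hd] := HY1 y Yy; have [_ _ cy] := HY y Yy.
  apply: (@le_trans _ _ 1); last by rewrite -gtz0_ge1 lt_neqAle eq_sym cy D0.
  rewrite lez_nat -(cards1 d); apply: subset_leq_card; apply/fintype.subsetP => d'.
  move=> /ucomp_outdirsP[yd' [e e0 He]]; rewrite inE; apply/negPn/negP => dd'.
  have [h he] := Hd d' yd' dd' e e0; apply.
  exact: (UT _ (dhar_set_finite D v0 j) (v0n j) IH _ (He h he)).
move=> w [Uw Vw]; rewrite -TB; split=> //.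
exact: (UT _ (dhar_set_finite D v0 k) (v0n k) (@YS k)).
Qed.

End Blocked.
End Dhar.

(** * Termination *)

Section Termination.
Context {R : realType} (G : metric_graph R).
Local Notation Gamma := (realization G).
Implicit Types (p q v w x b : Gamma) (d e : direction G) (g : R -> Gamma) (l h t s : R)
  (V S B : set Gamma) (D : divisor G).

Lemma coeff_le_deg D p : effective D -> coeff p D <= deg D.
Proof.
move=> D0; have -> : deg D = \sum_(z <- dom D) coeff z D.
  by rewrite -[D in LHS]freeg_sumE raddf_sum; apply: eq_bigr => z _; exact: degU.
have [pD|/coeff_outdom->] := boolP (p \in dom D).
  rewrite (big_rem p pD) /= lerDl; apply: sumr_ge0 => z _; exact: D0.
by apply: sumr_ge0 => z _; exact: D0.
Qed.

Definition eventually_always (P : nat -> Prop) : Prop := exists N, forall i, (N <= i)%N -> P i.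

(** Induction on the room [M - u N]: for integers, a strict increase uses up at least one unit. *)
Lemma bounded_eventually_constant (u : nat -> int) (M : int) (N : nat) :
  (forall i, u i <= M) -> (forall i, (N <= i)%N -> u i <= u i.+1) ->
  eventually_always (fun i => u i = u i.+1).
Proof.
move=> uM; have [m] := ubnP `|M - u N|%N; elim: m N => // m IH N mN mono.
have [H|] := pselect (forall i, (N <= i)%N -> u i = u i.+1); first by exists N.
move=> /existsNP[i] /not_implyP[Ni /eqP ui].
have lt : u i < u i.+1 by rewrite lt_neqAle ui mono.
have le j : (N <= j)%N -> u N <= u j.
  elim: j => [|j IHj]; first by rewrite leqn0 => /eqP ->.
  rewrite leq_eqVlt => /orP[/eqP <-//|Nj]; exact: le_trans (IHj Nj) (mono j Nj).
apply: (IH i.+1) => [|j ij]; last by apply: mono; rewrite (leq_trans Ni)// ltnW.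
move: mN; rewrite -!ltz_nat !gez0_abs ?subr_ge0//; move: (le i Ni) lt.
by rewrite -lezD1 intS; lra.
Qed.

Lemma finite_eventually (T : choiceType) (A : set T) (P : T -> nat -> Prop) : finite_set A ->
  (forall a, A a -> eventually_always (P a)) ->
  eventually_always (fun i => forall a, A a -> P a i).
Proof.
move=> /finite_seqP[s ->]; elim: s => [|a s IH] H; first by exists 0%N.
have [|N HN] := IH; first by move=> b bs; apply: H; rewrite /= inE bs orbT.
have [|N' HN'] := H a; first by rewrite /= inE eqxx.
exists (maxn N N') => i; rewrite geq_max => /andP[Ni N'i] b; rewrite /= inE.
by move=> /orP[/eqP ->|bs]; [exact: HN'|exact: HN].
Qed.

(** Both rays start along the same arm, so the coordinate change between them has slope 1 and offset
    0. The end of the shorter one follows by continuity. *)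
Lemma subray V S b d l g l' g' : arc_decomp V -> finite_set S -> ray V b d l g ->
  ray (V `|` S) b d l' g' -> l' <= l /\ forall s, 0 <= s <= l' -> g' s = g s.
Proof.
move=> dV fS r r'.
have [ag [Vb bd] [e e0 He] C [_ [_ _ _]]] := r; have l0 := ag.1.
have [ag' _ [e' e'0 He'] C' [_ [_ _ _]]] := r'; have l0' := ag'.1.
have [x [x0 xe xe' xl]] := exists_small e0 e'0 l0.
have [y [y0 yx yl _]] := exists_small x0 l0' x0.
have E s : 0 <= s <= y -> g' s = g s by move=> sy; rewrite He ?He'//; slra.
have inA s : 0 < s < l' -> arc_set l g (g' s).
  move=> sl; rewrite -(C y); last by slra.
  rewrite -E; last by slra.
  apply: (@component_mono _ (~` (V `|` S))); first by move=> z; apply: contra_not; left.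
  by rewrite C'; [exists s => //=; rewrite in_itv|slra].
have [sg [c Hc]] := arc_transition ag l0' (open_arc_local_isometry ag') inA.
have key s : 0 < s <= y -> s = c + (if sg then s else - s).
  move=> sy; have [|h1] := Hc s; first by slra.
  by rewrite E; [apply: (open_arc_inj ag) => //|]; slra.
have H s : 0 < s < l' -> s < l /\ g' s = g s.
  have := key y; have := key (y / 2); case: (sg) Hc => Hc k1 k2 sl; have [h1 ->] := Hc s sl.
    have c0 : c = 0 by have := k2 ltac:(slra); slra.
    by move: h1; rewrite c0 add0r => /andP[].
  by exfalso; have := k1 ltac:(slra); have := k2 ltac:(slra); slra.
have l'l : l' <= l.
  rewrite leNgt; apply/negP => ll; have := (H ((l + l') / 2) ltac:(slra)).1; slra.
split=> // s /andP[s0 sl]; have [s0'|s0'] := eqVneq s 0; first by apply: E; slra.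
have [{s0 sl s0'}->|sl'] := eqVneq s l'; last by apply: (H s _).2; rewrite !lt_neqAle sl' eq_sym s0'; slra.
apply/eqP; rewrite -[_ == _]negbK -mdist_gt0; apply/negP => m0.
have [z [z0 zm zl _]] := @exists_small R (mdist (g' l') (g l') / 2) l' l' ltac:(slra) l0' l0'.
have h1 := ray_lip (s := l') (t := l' - z) r ltac:(slra) ltac:(slra).
have h2 := ray_lip (s := l') (t := l' - z) r' ltac:(slra) ltac:(slra).
have := metric_triangle (g' l') (g' (l' - z)) (g l').
rewrite (H (l' - z) ltac:(slra)).2 in h2 *; rewrite (metric_sym (g (l' - z))).
by rewrite subKr gtr0_norm// in h1 h2; slra.
Qed.

Section InfiniteRun.
Context (V : set Gamma) (v0 : Gamma) (dV : arc_decomp V) (Vv0 : V v0)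
  (Ds : nat -> divisor G) (Ss : nat -> set Gamma) (M : int).
Local Notation U i := (ucomp (Ss i) v0).
Hypotheses (D0 : forall i, effective (Ds i)) (Ddeg : forall i, deg (Ds i) = M)
  (SsE : forall i, exists k, Ss i = dhar_set (Ds i) v0 k)
  (mono : forall i p, U i p -> coeff p (Ds i) <= coeff p (Ds i.+1))
  (land : forall i, exists w, [/\ U i w, V w & coeff w (Ds i) < coeff w (Ds i.+1)])
  (gain : forall i x d l g, ~ U i x -> d \in outdirs (~` U i) x -> ray (V `|` Ss i) x d l g ->
     exists2 t, 0 < t <= l & coeff (g t) (Ds i) < coeff (g t) (Ds i.+1)).

Lemma infinite_run_absurd : False.
Proof.
pose B : set Gamma := [set b | V b /\ eventually_always (fun i => U i b)].
have fS i : finite_set (Ss i) by have [k ->] := SsE i; exact: dhar_set_finite.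
have Sv0 i : ~ Ss i v0 by have [k ->] := SsE i; move=> /dhar_set_sub[_]; apply.
have Bv0 : B v0 by split=> //; exists 0%N => i _; exact: ucomp_base.
have BV : B `<=` V by move=> b [].
have [N HN] : eventually_always (fun i => forall b, B b ->
    U i b /\ coeff b (Ds i) = coeff b (Ds i.+1)).
  apply: finite_eventually; first exact: sub_finite_set BV dV.1.
  move=> b [Vb [N HN]]; have [||N' HN'] := @bounded_eventually_constant (fun i => coeff b (Ds i)) M N.
  - by move=> i; rewrite -(Ddeg i); exact: coeff_le_deg.
  - by move=> i /HN; exact: mono.
  exists (maxn N N') => i; rewrite geq_max => /andP[Ni N'i].
  by split; [exact: HN|exact: HN'].
pose blk i b d := exists l g t, [/\ ray V b d l g, 0 < t < l & coeff (g t) (Ds i) != 0].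
(* Follow the ray from [b] for the finer marking by [V] and [Ss i]. If its end is in [U i], it is
   not in [Ss i], so this is the whole ray of [V]. Otherwise [gain], applied to the reversed ray,
   adds a chip on it; not at [b], where the number of chips no longer changes. *)
have step i b d l g : (N <= i)%N -> B b -> ray V b d l g ->
    blk i.+1 b d \/ forall t, 0 < t <= l -> U i (g t).
  move=> Ni Bb r; have [Ub Db] := HN i Ni b Bb; have bd : dir_at b d by case: r => _ [].
  have [||l' [g' r']] := @ray_ex _ _ (V `|` Ss i) b d _ _ bd; [exact: decompVS|by left; exact: BV|].
  have [l'l gE] := subray dV (fS i) r r'.
  have [ag' _ [e e0 He] _ [d' [Wl' ld' [e' e'0 He']]]] := r'; have l0' := ag'.1.
  have Ug' t : 0 < t < l' -> U i (g' t).
    have [e1 e10 H1] := (open_germ (U i)).1 (ucomp_open (fS i)) b Ub d bd.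
    have [y [y0 ye ye1 yl]] := exists_small e0 e10 l0'.
    apply: (ray_ucomp r' (t := y)); first by slra.
    by rewrite He; [apply: H1|]; slra.
  have [Ul'|Ul'] := pselect (U i (g' l')).
    right; have l'E : l' = l.
      apply/eqP; rewrite eq_le l'l leNgt; apply/negP => ll.
      apply: (ray_notin r (t := l')); first by slra.
      rewrite -gE; last by slra.
      by case: Wl' => // /(ucomp_sub Ul').
    move=> t tl; rewrite -gE; last by slra.
    have [->//|tn] := eqVneq t l'; apply: Ug'.
    by rewrite [_ < l']lt_neqAle tn; slra.
  left; have [d2 r2] := ray_rev r'.
  have [|t tl] := gain Ul' _ r2.
    have [_ [_ gd2] [e2 e20 He2] _ _] := r2.
    apply/ucomp_outdirsP; split=> //; exists (Num.min e2 l'); first by rewrite lt_min e20.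
    by move=> h; rewrite lt_min => h1; rewrite -He2; [apply: Ug'|]; slra.
  have [->|tn] := eqVneq t l'; first by rewrite subrr (ray0 r') Db ltxx.
  have tl' : 0 < t < l' by rewrite [_ < l']lt_neqAle tn; slra.
  rewrite gE; last by slra.
  move=> lt; exists l, g, (l' - t); split=> //; first by slra.
  by rewrite gt_eqF// (le_lt_trans _ lt)//; exact: D0.
(* When [step] yields no new chip, the old one lies in [U i], where no chip is lost. *)
have keep i b d : (N <= i)%N -> B b -> blk i b d -> blk i.+1 b d.
  move=> Ni Bb [l [g [t [r tl ct]]]]; have [//|H] := step i b d l g Ni Bb r.
  exists l, g, t; split=> //; rewrite gt_eqF// (lt_le_trans _ (mono (H t _)))//; last by slra.
  by rewrite lt_neqAle eq_sym ct; exact: D0.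
have [N' HN'] : eventually_always (fun i => forall z : Gamma * direction G, B z.1 -> 
    forall l g, ray V z.1 z.2 l g -> ~ B (g l) -> blk i z.1 z.2).
  suff [N' H] : eventually_always (fun i => forall z : Gamma * direction G, (B `*` [set: direction G]) z -> 
      forall l g, ray V z.1 z.2 l g -> ~ B (g l) -> blk i z.1 z.2).
    by exists N' => i /H Hi z Bz; apply: Hi.
  apply: finite_eventually; first by apply: finite_setX; [exact: sub_finite_set BV dV.1|exact: finite_finset].
  move=> [b d] [/= Bb _]; have [[l [g [r nB]]]|no] := pselect (exists l g, ray V b d l g /\ ~ B (g l)); last first.
    by exists 0%N => i _ l g r nB; case: no; exists l, g.
  (* The end is in [V] but not in [B], so it is missed by [U j] for some [j] beyond any given
     rank. *)
  have [j Nj Uj] : exists2 j, (N <= j)%N & ~ U j (g l).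
    apply: contrapT => H; have [_ _ _ _ [_ [Vl _ _]]] := r; apply: nB; split=> //.
    by exists N => j Nj; apply: contrapT => Uj; apply: H; exists j.
  have [[l0 _] _ _ _ _] := r.
  have bj : blk j.+1 b d by have [//|H] := step j b d l g Nj Bb r; case: Uj; apply: H; rewrite l0 lexx.
  exists j.+1 => i ji l1 g1 _ _; elim: i ji => // i IH.
  rewrite leq_eqVlt => /orP[/eqP <-//|ji]; apply: keep => //; last exact: IH.
  by rewrite (leq_trans Nj)// ltnW.
pose i := maxn N N'.
have [w [Uw Vw]] := land i; have [k Sk] := SsE i.
have Bw : B w.
  apply: (@dhar_blocked _ _ V B v0 (Ds i) dV BV Bv0 (D0 i) _ k); last by rewrite -Sk.
  move=> b d l g Bb r nB; have [l1 [g1 [t [r1 tl ct]]]] := HN' i (leq_maxr _ _) (b, d) Bb l g r nB.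
  have [lE gE] := ray_start_unique dV r1 r; exists t; first by rewrite -lE.
  by rewrite -gE//; slra.
by have [_ ->] := HN i (leq_maxl _ _) w Bw; rewrite ltxx.
Qed.

End InfiniteRun.
End Termination.


Theorem theorem2p14 (R : realType) (G : metric_graph R)
    (Om : set (realization G)) (D : divisor G) (v0 : realization G)
    (hOm : vertex_set Om) (hD : effective D) :
  exists (n : nat) (Ds : nat -> divisor G),
    [/\ run Om v0 D n Ds,
        dhar_output (Ds n) v0 set0 &
        forall (m : nat) (Es : nat -> divisor G), run Om v0 D m Es ->
          (m <= n)%N /\ forall i, (i <= m)%N -> Es i = Ds i].
Proof.
have dV := base_decomp hOm v0; have Vv0 := base_in Om v0.
(* [next] is made total: it returns [F] itself when [F] is not effective or when Dhar's output is
   empty. The infinite sequence [Ds] is thus available before termination is known. *)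
have /choice[next Hnext] : forall F : divisor G, exists y : divisor G * set (realization G),
    effective F -> [/\ dhar_output F v0 y.2, effective y.1 /\ deg y.1 = deg F &
      y.2 !=set0 -> [/\ v0_move Om v0 F y.2 1 y.1,
        forall p, ucomp y.2 v0 p -> coeff p F <= coeff p y.1,
        exists w, [/\ ucomp y.2 v0 w, (Om `|` [set v0]) w & coeff w F < coeff w y.1] &
        forall x d l g, ~ ucomp y.2 v0 x -> d \in outdirs (~` ucomp y.2 v0) x ->
          ray (Om `|` [set v0] `|` y.2) x d l g ->
          exists2 t, 0 < t <= l & coeff (g t) F < coeff (g t) y.1]].
  move=> F; have [F0|F0] := pselect (effective F); last by exists (F, set0).
  have [S HS] := dhar_output_ex v0 F0; have [[x Sx]|S0] := pselect (S !=set0); last by exists (F, S).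
  have [|_ SF sat _] := dhar_outputP HS; first by exists x.
  have [E [mv [E0 Edeg] EU land gain]] := move_ex hOm F0 SF sat.
  by exists (E, S) => _; split=> // S0; split=> //; exact: land.
pose Ds i := iter i (fun F => (next F).1) D; pose Ss i := (next (Ds i)).2.
have D0 i : effective (Ds i).
  by elim: i => //= i IH; have [_ [] ] := Hnext _ IH.
have out i : dhar_output (Ds i) v0 (Ss i) by have [] := Hnext _ (D0 i).
have Ddeg i : deg (Ds i) = deg D.
  by elim: i => //= i <-; have [_ []] := Hnext _ (D0 i).
have ex : exists n, `[< Ss n = set0 >].
  apply: contrapT => no; have Sn i : Ss i !=set0.
    by apply/set0P/eqP => S0; apply: no; exists i; apply/asboolP.
  have H i := let: And3 _ _ H := Hnext _ (D0 i) in H (Sn i).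
  apply: (@infinite_run_absurd _ _ _ v0 dV Vv0 Ds Ss (deg D)) => //.
  - by move=> i; have [_ _ _] := dhar_outputP (out i) (Sn i).
  - by move=> i; have [] := H i.
  - by move=> i; have [] := H i.
  - by move=> i; have [] := H i.
have [n /asboolP Sn min] := ex_minnP ex.
have Sne i : (i < n)%N -> Ss i !=set0.
  by move=> ni; apply/set0P/eqP => S0; move: ni; rewrite ltnNge min//; apply/asboolP.
exists n, Ds; split; [|by rewrite -Sn|].
  split=> // i ni; exists (Ss i); split=> //; first exact: Sne.
  by have [_ _ /(_ (Sne i ni))[]] := Hnext _ (D0 i).
(* Dhar's output and the move are both unique, and the output at [n] is empty, so every run is an
   initial part of [Ds]. *)
move=> m Es [Es0 Erun]; have key i : (i <= m)%N -> (i <= n)%N /\ Es i = Ds i.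
  elim: i => [|i IH] im; first by rewrite Es0.
  have [ni E] := IH (ltnW im); have [S [HS Sx mv]] := Erun i im; rewrite E in HS mv.
  have SE := dhar_output_unique HS (out i); rewrite SE in Sx mv.
  have ni' : (i < n)%N.
    rewrite ltn_neqAle ni andbT; apply/eqP => iN; move: Sx; rewrite iN Sn; case=> ? [].
  split=> //; have [_ SF _ _] := dhar_outputP (out i) Sx.
  apply: (move_unique hOm SF mv).
  by have [_ _ /(_ Sx)[]] := Hnext _ (D0 i).
by split=> [|i /key[]//]; have [] := key m (leqnn m).
Qed.
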